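(* Fix $p\in(0,1)$. Let $G=(g_{ij})_{1\le i,j\le n}$ be the adjacency matrix of the Erdős–Rényi random graph $G(n,p)$ on $n$ vertices, i.e. $g_{ii}=0$ for all $i$, $g_{ij}=g_{ji}$, and $(g_{ij})_{1\le i<j\le n}$ are independent $\operatorname{Ber}(p)$ random variables. Then there exist $c,c'>0$ and $C_p>0$ depending only on $p$ such that $$\mathbb{P}(\operatorname{Rank}G\le n-k)\le e^{-c'kn}\qquad\text{for all integers } k \text{ with } C_p\le k\le c\sqrt n.$$ In the special case $p=\frac12$, this inequality holds for all integers $k$ with $1\le k\le c\sqrt n$.
   Context: $\operatorname{Ber}(p)$ denotes the law of a random variable equal to $1$ with probability $p$ and $0$ with probability $1-p$. Rank is over $\mathbb{R}$. *)

(* Defs.v *)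
From mathcomp Require Import all_boot all_order all_algebra.
From mathcomp Require Import all_classical all_reals all_analysis.
Set Implicit Arguments.
Unset Strict Implicit.
Unset Printing Implicit Defensive.
Import Order.TTheory GRing.Theory Num.Theory.
Import numFieldNormedType.Exports.
Local Open Scope classical_set_scope.
Local Open Scope ring_scope.

Definition bernoulli_law (R : realType) (d : measure_display)
    (T : measurableType d) (P : probability T R) (p : R)
    (X : {RV P >-> R}) : Prop :=
  distribution P X [set 1] = p%:E /\ distribution P X [set 0] = (1 - p)%:E.

Definition mutually_independent (R : realType) (d : measure_display)
    (T : measurableType d) (P : probability T R) (I : finType) (D : {set I})
    (X : I -> {RV P >-> R}) : Prop :=
  forall (J : {set I}) (B : I -> set R),
    J \subset D -> (forall i, measurable (B i)) ->
    P (\bigcap_(i in [set i | i \in J]) (X i @^-1` B i)) =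
    (\prod_(i in J) P (X i @^-1` B i))%E.

Definition gnp_adjacency (R : realType) (d : measure_display)
    (T : measurableType d) (P : probability T R) (n : nat) (p : R)
    (g : 'I_n -> 'I_n -> {RV P >-> R}) : Prop :=
  [/\ forall i t, g i i t = 0,
      forall i j t, g i j t = g j i t,
      forall i j : 'I_n, (i < j)%N -> bernoulli_law p (g i j) &
      mutually_independent [set ij : 'I_n * 'I_n | (ij.1 < ij.2)%N]%SET
        (fun ij => g ij.1 ij.2)].

Definition random_mx (R : realType) (d : measure_display)
    (T : measurableType d) (P : probability T R) (n : nat)
    (g : 'I_n -> 'I_n -> {RV P >-> R}) (t : T) : 'M[R]_n :=
  \matrix_(i, j) g i j t.

(* Main.v *)
(* Fix a prime q with ln q of order th * m, where n = N + m and N is m or m + 1 (such q exist by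
   Chebyshev's central binomial argument).  The rank over F_q is at most the rank over R, so it
   suffices to bound the corank of the adjacency matrix A modulo q.

   Freeze the edges inside the two sides, of sizes N and m.  The modulus of the characteristic
   function of Ber(p) is dominated by the positive real characteristic function of the lazy law
   on {-1, 0, 1} with P(0) = 1 - p (1 - p), so P((u, v) A = w) is at most the probability that
   v X^T = 0 and u X = 0, for an N x m matrix X of independent lazy entries.  Summing over (u, v)
   gives E #ker A <= q E q^(2 corank X).

   The lazy matrix is treated as in Kahn, Komlos and Szemeredi: if the rows of X span V, a quarter
   of them can be replaced by rows of a still lazier law, whose probability of lying in V is
   larger by a big factor unless the annihilator of V contains a subspace of sparse vectors.  In this way the
   coranks above 4, and the positive coranks whose annihilator contains a structured vector (one
   with hit probability at least ga), contribute at most q^-2 to E q^(2 corank X).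

   Markov's inequality for #ker A settles k >= 20.  For 1 <= k < 20 it is enough to bound the
   probability of singularity.  If vA = 0 with v_i <> 0, let A' be the minor without i and x
   the row of i.  If A' is singular, a kernel vector u of A' satisfies x u^T = 0, which is
   unlikely unless u is structured.  If A' is regular, x A'^-1 x^T = 0, and taking the fourth power
   decouples the two blocks of x; this is unlikely unless (z, 0) A'^-1 is structured for the
   difference z of two independent copies of the first block.  The domination above excludes structured
   vectors in both cases. *)

Require Import Defs.
From mathcomp Require Import all_boot all_order all_algebra.
From mathcomp Require Import all_classical all_reals all_analysis.
From mathcomp Require Import zify ring lra.
From mathcomp Require Import complex mxabelem.
From mathcomp Require Import fintype finset.
Import Order.TTheory GRing.Theory Num.Theory.
Import numFieldNormedType.Exports.
Import ComplexField.Normc.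

Set Implicit Arguments.
Unset Strict Implicit.
Unset Printing Implicit Defensive.
Local Open Scope ring_scope.

(** * Independent coordinates *)

(** The target exp(-c k n) is the size of q^-k when q is exponential in n, so a kernel of dimension
    k is detected through its q^k elements. The obstacle is symmetry: each edge enters two rows of
    A, and the rows are not independent. Once the edges inside the sides are frozen, (u, v) A is an
    affine function of the independent cross edges. The price is a second moment: u and v range over
    both kernels of X, of joint size q^(2 corank), with one more factor q when N = m + 1. Coranks up
    to 4 are simply allowed. They cost q^8, hence E #ker A <= q^10, and Markov's inequality gives
    q^(10 - k), which is useful from k = 20 on. Below 20 the factor k is bounded and is absorbed by
    the constant in the exponent. The estimate is obtained for every k >= 1 once n >= n0; the
    constant c is then chosen so that 1 <= k <= c sqrt n excludes smaller n. *)

Section ProductWeights.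
Variables (R : realFieldType) (E : finType) (w : E -> R).
Hypothesis w_ge0 : forall e, 0 <= w e.
Hypothesis w_sum : \sum_e w e = 1.
Implicit Types T U : finType.

Definition pw T (f : {ffun T -> E}) : R := \prod_t w (f t).

Lemma pw_ge0 T (f : {ffun T -> E}) : 0 <= pw f.
Proof. by apply: prodr_ge0 => t _. Qed.

Lemma sum_pw_prod T (G : T -> E -> R) :
  \sum_f pw f * \prod_t G t (f t) = \prod_t \sum_e w e * G t e.
Proof.
rewrite bigA_distr_bigA; apply: eq_bigr => f _.
by rewrite /pw -big_split.
Qed.

Lemma sum_pw T : \sum_(f : {ffun T -> E}) pw f = 1.
Proof.
transitivity (\sum_(f : {ffun T -> E}) pw f * \prod_t (fun=> fun=> 1) t (f t)).
  by apply: eq_bigr => f _; rewrite big1 // mulr1.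
rewrite (sum_pw_prod (fun=> fun=> 1)) big1 // => t _.
by under eq_bigr do rewrite mulr1.
Qed.

Definition mix T (S : {set T}) (f g : {ffun T -> E}) : {ffun T -> E} :=
  [ffun t => if t \in S then f t else g t].

(** Conditioning on the coordinates outside [S]: exchanging two independent copies outside [S] is an
    involution that preserves the product of their weights. *)
Lemma pw_mix T (S : {set T}) (G : {ffun T -> E} -> R) :
  \sum_f pw f * G f = \sum_g \sum_f pw f * pw g * G (mix S f g).
Proof.
have -> : \sum_f pw f * G f =
    \sum_(g : {ffun T -> E}) \sum_f pw f * pw g * G f.
  rewrite exchange_big; apply: eq_bigr => f _.
  rewrite -mulr_suml -mulr_sumr sum_pw mulr1 //.
rewrite !pair_bigA /=.
pose h (p : {ffun T -> E} * {ffun T -> E}) := (mix S p.1 p.2, mix S p.2 p.1).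
have hK : involutive h.
  by case=> f g; rewrite /h /=; congr (_, _); apply/ffunP=> t; rewrite !ffunE; case: (t \in S).
rewrite (reindex_inj (inv_inj hK)) /=.
apply: eq_bigr => -[g f] _ /=.
suff -> : pw (mix S f g) * pw (mix S g f) = pw f * pw g by [].
rewrite /pw -!big_split; apply: eq_bigr => t _; rewrite !ffunE /=.
by case: ifP => // _; rewrite mulrC.
Qed.

(** The event that the restriction equals [h] is a product of constraints [K t] on single
    coordinates, and these are trivial off the range of [i]. *)
Lemma pw_marg T U (i : U -> T) (G : {ffun U -> E} -> R) : injective i ->
  \sum_f pw f * G [ffun u => f (i u)] = \sum_h pw h * G h.
Proof.
move=> i_inj; pose r (f : {ffun T -> E}) := [ffun u => f (i u)].
rewrite (partition_big r predT) //=; apply: eq_bigr => h _.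
rewrite (eq_bigr (fun f => pw f * G h)) => [|f /eqP <- //].
rewrite -mulr_suml; congr (_ * _).
pose K t e := [forall u, (i u == t) ==> (e == h u)].
have rE f : (r f == h) = [forall t, K t (f t)].
  apply/eqP/forallP => [rf t|Kf].
    by apply/forallP => u; apply/implyP => /eqP <-; rewrite -rf ffunE.
  apply/ffunP => u; rewrite ffunE.
  by have /forallP/(_ u) := Kf (i u); rewrite eqxx => /eqP.
rewrite big_mkcond (eq_bigr (fun f => pw f * \prod_t (K t (f t))%:R)); last first.
  move=> f _; rewrite rE; case: forallP => [Kf|nKf].
    by rewrite big1 ?mulr1 // => t _; rewrite Kf.
  have [t /negbTE nKt] : exists t, ~~ K t (f t).
    by apply/existsP; rewrite -negb_forall; apply/negP => /forallP.
  by rewrite (bigD1 t) //= nKt mul0r mulr0.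
rewrite (sum_pw_prod (fun t e => (K t e)%:R)) /pw.
rewrite (bigID (mem (codom i))) /= [X in _ * X]big1 ?mulr1; last first.
  move=> t tNi; rewrite -[RHS]w_sum; apply: eq_bigr => e _.
  suff -> : K t e by rewrite mulr1.
  apply/forallP => u; apply/implyP => /eqP iu.
  by case/negP: tNi; rewrite -iu codom_f.
rewrite big_mkcond.
rewrite -(big_mkcond (fun t => t \in codom i) (fun t => \sum_e w e * (K t e)%:R)).
transitivity (\prod_(t in [set i u | u in predT]) \sum_e w e * (K t e)%:R).
  apply: eq_bigl => t; apply/codomP/imsetP => [[u ->]|[u _ ->]]; by exists u.
rewrite big_imset /=; last by move=> x y _ _; exact: i_inj.
apply: eq_bigr => u _; rewrite (bigD1 (h u)) //= big1 ?addr0.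
  suff -> : K (i u) (h u) by rewrite mulr1.
  by apply/forallP => v; apply/implyP => /eqP/i_inj ->.
move=> e /negbTE neh; suff -> : K (i u) e = false by rewrite mulr0.
by apply/negbTE/negP => /forallP/(_ u); rewrite eqxx neh.
Qed.

Lemma sum_pw_forall T (K : T -> pred E) :
  \sum_f pw f * [forall t, K t (f t)]%:R = \prod_t \sum_(e | K t e) w e.
Proof.
transitivity (\sum_f pw f * \prod_t (fun t e => (K t e)%:R) t (f t)).
  apply: eq_bigr => f _; congr (_ * _).
  case: forallP => [Kf|nKf]; first by rewrite big1 // => t _; rewrite Kf.
  have [t /negbTE nKt] : exists t, ~~ K t (f t).
    by apply/existsP; rewrite -negb_forall; apply/negP => /forallP.
  by rewrite (bigD1 t) //= nKt mul0r.
rewrite (sum_pw_prod (fun t e => (K t e)%:R)); apply: eq_bigr => t _; rewrite [RHS]big_mkcond.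
by apply: eq_bigr => e _; case: (K t e); rewrite ?mulr1 ?mulr0.
Qed.

(** Given the coordinates outside [P], at most one choice is left for those in [P], and it costs a
    factor [al] per coordinate. *)
Lemma sum_pw_determined T (A : {set {ffun T -> E}}) (P : {set T}) (al : R) :
  (forall e, w e <= al) ->
  (forall f g, f \in A -> g \in A ->
     (forall t, t \notin P -> f t = g t) -> f = g) ->
  \sum_(f in A) pw f <= al ^+ #|P|.
Proof.
move=> w_le det.
have al_ge0 : 0 <= al ^+ #|P|.
  case: (pickP E) => [e _|E0]; first by rewrite exprn_ge0 // (le_trans _ (w_le e)).
  by move: w_sum; rewrite big_pred0 // => /esym/eqP; rewrite oner_eq0.
have -> : \sum_(f in A) pw f = \sum_f pw f * (f \in A)%:R.
  by rewrite big_mkcond; apply: eq_bigr => f _; case: (f \in A); rewrite ?mulr1 ?mulr0.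
rewrite (pw_mix P) -[leRHS]mul1r -[X in _ <= X * _](sum_pw T) mulr_suml.
apply: ler_sum => g _; under eq_bigr do rewrite mulrAC mulrC.
rewrite -mulr_sumr; apply: ler_wpM2l; first exact: pw_ge0.
case: (pickP [pred f | mix P f g \in A]) => [h /= hA|nA]; last first.
  by rewrite big1 // => f _; have /= -> := nA f; rewrite mulr0.
apply: (@le_trans _ _ (\sum_f pw f *
  [forall t, (fun t e => (t \in P) ==> (e == h t)) t (f t)]%:R)).
  apply: ler_sum => f _; apply: ler_wpM2l; first exact: pw_ge0.
  rewrite /=; case fA: (mix P f g \in A); last by rewrite ler0n.
  suff K : [forall t, (t \in P) ==> (f t == h t)].
    by rewrite K.
  have fh : mix P f g = mix P h g.
    by apply: det => // t /negbTE tP; rewrite !ffunE tP.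
  apply/forallP => t; apply/implyP => tP.
  by have := congr1 (fun F : {ffun _} => F t) fh; rewrite !ffunE tP => /eqP.
rewrite (sum_pw_forall (fun t e => (t \in P) ==> (e == h t))) (bigID (mem P)) /=.
rewrite [X in _ * X]big1 ?mulr1; last first.
  by move=> t /negbTE tP; rewrite -[RHS]w_sum; apply: eq_bigl => e; rewrite tP.
rewrite -prodr_const; apply: ler_prod => t tP.
by rewrite tP /= big_pred1_eq w_ge0 w_le.
Qed.

End ProductWeights.

Lemma pw_curry (R : realFieldType) (E A B : finType) (w : E -> R)
    (G : {ffun A * B -> E} -> R) :
  \sum_h pw w h * G h =
  \sum_(x : {ffun A -> {ffun B -> E}}) pw (pw w (T := B)) x * G [ffun p => x p.1 p.2].
Proof.
rewrite (reindex (fun x : {ffun A -> {ffun B -> E}} => [ffun p => x p.1 p.2])) /=.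
  apply: eq_bigr => x _; congr (_ * _); rewrite /pw pair_bigA /=.
  by apply: eq_bigr => p _; rewrite ffunE.
exists (fun h : {ffun A * B -> E} => [ffun a => [ffun b => h (a, b)]]) => [x _|h _].
  by apply/ffunP => a; apply/ffunP => b; rewrite !ffunE.
by apply/ffunP => -[a b]; rewrite !ffunE.
Qed.

(** * Exchanging rows for lazier rows *)

Section SpanOfFamily.
Variables (F : fieldType) (m : nat) (O : finType) (vec : O -> 'rV[F]_m).

(** The base [Y] lets a span start from rows of another family, as the exchange argument
    requires. *)
Definition span_on (T : finType) (A : {set T}) (x : {ffun T -> O})
    (Y : 'M[F]_m) : 'M[F]_m :=
  (Y + \sum_(i in A) <<vec (x i)>>)%MS.

Variable T : finType.
Implicit Types (A B : {set T}) (x : {ffun T -> O}) (Y V : 'M[F]_m).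

Lemma span_on_sub A x Y V :
  (span_on A x Y <= V)%MS = (Y <= V)%MS && [forall i in A, vec (x i) <= V]%MS.
Proof.
rewrite addsmx_sub; congr (_ && _); apply/sumsmx_subP/forall_inP => H i iA.
  by rewrite -(genmxE (vec _)) H.
by rewrite genmxE H.
Qed.

Lemma span_onU1 i A x Y :
  (span_on (i |: A) x Y :=: span_on A x Y + vec (x i))%MS.
Proof.
apply/eqmxP; apply/andP; split.
  rewrite span_on_sub (submx_trans (addsmxSl Y _) (addsmxSl _ _)) /=.
  apply/forall_inP => j; rewrite in_setU1 => /orP[/eqP->|jA]; first exact: addsmxSr.
  apply: submx_trans (addsmxSl _ _).
  have := submx_refl (span_on A x Y); rewrite span_on_sub => /andP[_ /forall_inP].
  exact.
rewrite addsmx_sub; have := submx_refl (span_on (i |: A) x Y).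
rewrite span_on_sub => /andP[YU /forall_inP H].
apply/andP; split; last by apply: H; rewrite setU11.
by rewrite span_on_sub YU; apply/forall_inP => j jA; apply: H; rewrite setU1r.
Qed.

Lemma span_on_in A x Y i : i \in A -> (vec (x i) <= span_on A x Y)%MS.
Proof.
by have := submx_refl (span_on A x Y); rewrite span_on_sub => /andP[_ /forall_inP]; apply.
Qed.

Lemma rank_add_row Y (v : 'rV[F]_m) : ~~ (v <= Y)%MS ->
  \rank (Y + v)%MS = (\rank Y).+1.
Proof.
move=> vY; apply/eqP; rewrite eqn_leq; apply/andP; split.
  apply: leq_trans (mxrank_adds_leqif _ _).1 _.
  by apply: leq_trans (leq_add (leqnn _) (rank_leq_row v)) _; rewrite addn1.
apply: rank_ltmx; rewrite ltmxE addsmxSl /=.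
by apply: contra vY => /(submx_trans (addsmxSr _ _)).
Qed.

(** The rank equation records that the vectors kept in [A] are independent modulo [Y]. *)
Lemma basis_extract B x Y : exists A, [/\ A \subset B,
  (span_on A x Y :=: span_on B x Y)%MS & \rank (span_on A x Y) = (\rank Y + #|A|)%N].
Proof.
have [n] := ubnP #|B|; elim: n B => // n IH B.
have [->|[i iB]] := set_0Vmem B.
  by move=> _; exists set0; rewrite /span_on big_set0 cards0 addn0 addsmx0 sub0set.
rewrite (cardsD1 i) iB ltnS => /IH [A [sAB eAB rA]].
have eB : (span_on B x Y :=: span_on A x Y + vec (x i))%MS.
  rewrite -{1}(setD1K iB); apply: eqmx_trans (span_onU1 _ _ _ _) _.
  by apply: adds_eqmx => //; apply: eqmx_sym.
have sA : A \subset B by exact: (fintype.subset_trans sAB (subD1set _ _)).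
have iA : i \notin A by apply/negP => /(subsetP sAB); rewrite !inE eqxx.
case viA: (vec (x i) <= span_on A x Y)%MS.
  exists A; split=> //; apply: eqmx_sym; apply: eqmx_trans eB _.
  by rewrite addsmxC; apply/addsmx_idPr; rewrite viA.
exists (i |: A); split.
- by rewrite subUset sub1set iB.
- apply: eqmx_trans (span_onU1 _ _ _ _) _; exact: eqmx_sym.
by rewrite span_onU1 rank_add_row ?viA // rA cardsU1 iA /= add1n addnS.
Qed.

Lemma span_on_mix A x x' Y : (span_on A (mix A x x') Y) = span_on A x Y.
Proof.
by rewrite /span_on; congr (_ + _)%MS; apply: eq_bigr => i iA; rewrite ffunE iA.
Qed.

End SpanOfFamily.

Section Exchange.
Variables (R : realFieldType) (F : fieldType) (m : nat) (O : finType).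
Variables (vec : O -> 'rV[F]_m).

Definition hit (w : O -> R) (V : 'M[F]_m) : R := \sum_(o | (vec o <= V)%MS) w o.

Variables (wX wY : O -> R).
Hypotheses (wX_ge0 : forall o, 0 <= wX o) (wY_ge0 : forall o, 0 <= wY o).
Hypotheses (wX_sum : \sum_o wX o = 1) (wY_sum : \sum_o wY o = 1).

Lemma hit_eqmx w (V V' : 'M[F]_m) : (V :=: V')%MS -> hit w V = hit w V'.
Proof. by move=> eV; apply: eq_bigl => o; rewrite eV. Qed.

Lemma hit_ge0 w V : (forall o, 0 <= w o) -> 0 <= hit w V.
Proof. by move=> w0; apply: sumr_ge0. Qed.

Lemma hit_le w (V V' : 'M[F]_m) : (forall o, 0 <= w o) -> (V <= V')%MS ->
  hit w V <= hit w V'.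
Proof.
move=> w0 sV; rewrite /hit [leRHS](bigID (fun o => (vec o <= V)%MS)) /=.
rewrite -[leLHS]addr0 lerD ?sumr_ge0 //.
rewrite [leLHS]big_mkcond [leRHS]big_mkcond; apply: ler_sum => o _.
case: ifP => [oV|_]; last by case: ifP.
by rewrite (submx_trans oV sV).
Qed.

Definition free_hit (r : nat) (V : 'M[F]_m) : R :=
  \sum_(y : {ffun 'I_r -> O}) pw wY y *
    ((span_on vec [set: 'I_r] y 0 <= V)%MS &&
     (\rank (span_on vec [set: 'I_r] y 0) == r))%:R.

(** Rows are revealed one at a time: if the earlier ones span [U] of rank below [r], the next one
    lands in [V] but outside [U] with probability at least the difference of the two hit
    probabilities. *)
Lemma free_hit_ge (r : nat) (V : 'M[F]_m) (a : R) :
  (forall U : 'M[F]_m, (\rank U < r)%N -> hit wY U <= a) -> a <= hit wY V ->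
  (hit wY V - a) ^+ r <= free_hit r V.
Proof.
move=> aU aV; suff H (A : {set 'I_r}) : (hit wY V - a) ^+ #|A| <=
    \sum_(y : {ffun 'I_r -> O}) pw wY y *
      ((span_on vec A y 0 <= V)%MS && (\rank (span_on vec A y 0) == #|A|))%:R.
  by have := H setT; rewrite cardsT card_ord.
have [n] := ubnP #|A|; elim: n A => // n IH A.
have [->|[i iA]] := set_0Vmem A.
  rewrite cards0 expr0 => _; rewrite -[leLHS](sum_pw wY_sum [the finType of 'I_r]).
  apply: ler_sum => y _; rewrite /span_on big_set0 !addsmx0 sub0mx mxrank0 eqxx.
  by rewrite mulr1.
set B := A :\ i; rewrite (cardsD1 i) iA ltnS => /IH H.
have iB : i \notin B by rewrite !inE eqxx.
rewrite (pw_mix wY_sum B) exchange_big /= -/B add1n exprSr.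
have a0 : 0 <= hit wY V - a by rewrite subr_ge0.
apply: le_trans (ler_wpM2r a0 H) _; rewrite mulr_suml; apply: ler_sum => y _.
rewrite -mulrA (eq_bigr (fun g : {ffun 'I_r -> O} => pw wY y * (pw wY g *
    ((span_on vec A (mix B y g) 0 <= V)%MS &&
     (\rank (span_on vec A (mix B y g) 0) == #|B|.+1))%:R))); last first.
  by move=> g _; rewrite mulrA.
rewrite -mulr_sumr.
apply: ler_wpM2l; first exact: pw_ge0.
case: andP => [[yV /eqP yr]|_]; last first.
  by rewrite mul0r; apply: sumr_ge0 => g _; rewrite mulr_ge0 ?pw_ge0 ?ler0n.
rewrite mul1r; set U := span_on vec B y 0.
have Ur : (\rank U < r)%N.
  rewrite yr; apply: leq_trans (_ : #|A| <= r)%N.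
    by rewrite (cardsD1 i A) iA add1n.
  by rewrite -[X in (_ <= X)%N]card_ord max_card.
pose K (t : 'I_r) (o : O) := (t == i) ==> ((vec o <= V) && ~~ (vec o <= U))%MS.
apply: (@le_trans _ _ (\sum_(g : {ffun 'I_r -> O}) pw wY g * [forall t, K t (g t)]%:R)).
  rewrite sum_pw_forall // (bigD1 i) //= [X in _ * X]big1 ?mulr1; last first.
    by move=> t ti; rewrite -[RHS]wY_sum; apply: eq_bigl => o; rewrite /K (negbTE ti).
  rewrite lerBlDr; apply: (@le_trans _ _
     (\sum_(o | K i o) wY o + hit wY U)); last by rewrite lerD2l aU.
  rewrite /hit (bigID (fun o => (vec o <= U)%MS)) /= addrC; apply: lerD.
    by rewrite le_eqVlt; apply/orP; left; apply/eqP/eq_bigl => o; rewrite /K eqxx.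
  rewrite [leLHS]big_mkcond [leRHS]big_mkcond; apply: ler_sum => o _.
  by case: (vec o <= U)%MS; rewrite ?andbT ?andbF //; case: ifP.
apply: ler_sum => g _; apply: ler_wpM2l; first exact: pw_ge0.
case: forallP => [Kg|_]; last by rewrite ler0n.
have := Kg i; rewrite /K eqxx /= => /andP[gV gU].
have eA : (span_on vec A (mix B y g) 0 :=: U + vec (g i))%MS.
  rewrite -(setD1K iA); apply: eqmx_trans (span_onU1 _ _ _ _ _) _.
  by rewrite -/B span_on_mix ffunE (negbTE iB).
by rewrite !eA addsmx_sub yV gV rank_add_row //= yr eqxx.
Qed.

(* The rows of [x] outside a suitable set [A] are redundant once the rows of
   [y] are adjoined to those in [A]; they only have to hit the row space. *)
Lemma exchange_bound (N r d : nat) (Pr : 'M[F]_m -> bool) (be : R) :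
  0 <= be -> (r <= d)%N ->
  (forall V : 'M[F]_m, \rank V = d -> Pr <<V>>%MS ->
     0 < free_hit r V /\ hit wX V ^+ (N - (d - r)) <= be * free_hit r V) ->
  \sum_(x : {ffun 'I_N -> O}) pw wX x *
     ((\rank (span_on vec [set: 'I_N] x 0) == d) &&
      Pr <<span_on vec [set: 'I_N] x 0>>%MS)%:R
  <= 'C(N, d - r)%:R * be.
Proof.
move=> be0 rd Hbe; pose sp (T : finType) (z : {ffun T -> O}) := span_on vec [set: T] z 0.
pose ok (V : 'M[F]_m) := (\rank V == d) && Pr <<V>>%MS.
have ok_eq V V' : (V :=: V')%MS -> ok V = ok V'.
  move=> e; rewrite /ok e.
  by have -> : <<V>>%MS = <<V'>>%MS by apply/genmxP; apply/eqmxP.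
pose gd (r' : nat) (y : {ffun 'I_r' -> O}) (V : 'M[F]_m) := (sp _ y <= V)%MS && (\rank (sp _ y) == r').
have fh_eq V V' : (V :=: V')%MS -> free_hit r V = free_hit r V'.
  by move=> e; apply: eq_bigr => y _; rewrite e.
(* Dividing by [free_hit] makes the good [y] for a fixed [x] carry total weight 1. The argument [x']
   stands for the rows outside [A], which are averaged later while the span is held fixed. *)
pose Q (A : {set 'I_N}) (y : {ffun 'I_r -> O}) x x' :=
  (ok (span_on vec A x (sp _ y)) &&
   [forall i, (i \notin A) ==> (vec (x' i) <= span_on vec A x (sp _ y))%MS])%:R /
   free_hit r (span_on vec A x (sp _ y)) : R.
have Q0 A y x x' : 0 <= Q A y x x'.
  rewrite /Q; case: andP => [[okV _]|_]; last by rewrite mul0r.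
  rewrite mul1r invr_ge0; move: okV => /andP[/eqP rV PV].
  by have [/ltW] := Hbe _ rV PV.
apply: (@le_trans _ _ (\sum_(x : {ffun 'I_N -> O}) \sum_(y : {ffun 'I_r -> O})
    pw wX x * pw wY y * \sum_(A : {set 'I_N} | #|A| == (d - r)%N) Q A y x x)).
  apply: ler_sum => x _.
  have -> : \sum_(y : {ffun 'I_r -> O})
     pw wX x * pw wY y * \sum_(A : {set 'I_N} | #|A| == (d - r)%N) Q A y x x =
     pw wX x * \sum_(y : {ffun 'I_r -> O})
      pw wY y * \sum_(A : {set 'I_N} | #|A| == (d - r)%N) Q A y x x.
    by rewrite mulr_sumr; apply: eq_bigr => y _; rewrite mulrA.
  apply: ler_wpM2l; first exact: pw_ge0.
  rewrite -/(ok _) -/(sp _ x); case okx: (ok (sp _ x)); last first.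
    apply: sumr_ge0 => y _; apply: mulr_ge0; first exact: pw_ge0.
    by apply: sumr_ge0 => A _.
  have /andP[/eqP rx Px] := okx; have [fx _] := Hbe _ rx Px.
  apply: (@le_trans _ _ (\sum_(y : {ffun 'I_r -> O}) pw wY y *
       ((gd _ y (sp _ x))%:R / free_hit r (sp _ x)))).
    under eq_bigr do rewrite mulrA.
    by rewrite -mulr_suml -/(free_hit r (sp _ x)) divff ?gt_eqF.
  apply: ler_sum => y _; apply: ler_wpM2l; first exact: pw_ge0.
  case gy: (gd _ y _); last by rewrite mul0r; apply: sumr_ge0.
  have /andP[yx /eqP ry] := gy.
  (* Completing the rows of [y] to a basis of the row space of [x] selects the [d - r] indices of
     [A]. *)
  have [A [_ eA rA]] := basis_extract vec setT x (sp _ y).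
  have ex : (span_on vec A x (sp _ y) :=: sp _ x)%MS.
    apply: eqmx_trans eA _; apply/eqmxP; apply/andP; split; rewrite span_on_sub.
      by rewrite yx; apply/forall_inP => i iT; apply: span_on_in.
    by rewrite sub0mx; apply/forall_inP => i iT; apply: span_on_in.
  have cA : #|A| == (d - r)%N.
    by move: rA; rewrite ex rx ry => ->; rewrite addKn.
  rewrite (bigD1 A) //= -[leLHS]addr0 lerD ?sumr_ge0 //.
  rewrite /Q (ok_eq _ _ ex) okx (fh_eq _ _ ex) /=.
  rewrite (_ : [forall i, _]) //; apply/forallP => i; apply/implyP => _.
  by rewrite ex; apply: span_on_in; rewrite inE.
rewrite exchange_big /=.
have -> : 'C(N, d - r)%:R * be = \sum_(y : {ffun 'I_r -> O}) pw wY y * ('C(N, d - r)%:R * be).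
  by rewrite -mulr_suml sum_pw // mul1r.
apply: ler_sum => y _.
have -> : \sum_(x : {ffun 'I_N -> O}) pw wX x * pw wY y *
     \sum_(A : {set 'I_N} | #|A| == (d - r)%N) Q A y x x =
   pw wY y * \sum_(A : {set 'I_N} | #|A| == (d - r)%N)
     \sum_(x : {ffun 'I_N -> O}) pw wX x * Q A y x x.
  rewrite exchange_big mulr_sumr; apply: eq_bigr => x _.
  by rewrite -mulr_sumr; ring.
apply: ler_wpM2l; first exact: pw_ge0.
have -> : 'C(N, d - r)%:R * be = \sum_(A : {set 'I_N} | #|A| == (d - r)%N) be.
  rewrite sumr_const -[RHS]mulr_natl; congr (_%:R * _).
  transitivity #|[set A : {set 'I_N} | #|A| == (d - r)%N]|.
    by rewrite card_draws card_ord.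
  by apply: eq_card => A; rewrite inE.
apply: ler_sum => A /eqP cA.
rewrite (pw_mix wX_sum A) exchange_big /=.
rewrite -[be]mul1r -[X in _ <= X * _](sum_pw wX_sum [the finType of 'I_N]) mulr_suml.
apply: ler_sum => x _.
have -> : \sum_(g : {ffun 'I_N -> O}) pw wX x * pw wX g * Q A y (mix A x g) (mix A x g)
  = pw wX x * \sum_(g : {ffun 'I_N -> O}) pw wX g * Q A y x g.
  rewrite mulr_sumr; apply: eq_bigr => g _; rewrite mulrA; congr (_ * _).
  rewrite /Q span_on_mix; congr ((_ && _)%:R / _).
  by apply: eq_forallb => i; case iA: (i \in A) => //=; rewrite ffunE iA.
apply: ler_wpM2l; first exact: pw_ge0.
rewrite /Q; set V := span_on vec A x (sp _ y).
case okV: (ok V); last first.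
  by rewrite big1 ?be0 // => g _; rewrite /= mul0r mulr0.
have /andP[/eqP rV PV] := okV; have [fV hV] := Hbe _ rV PV.
rewrite /=; under eq_bigr do rewrite mulrA.
rewrite -mulr_suml ler_pdivrMr //; apply: le_trans hV.
pose K (i : 'I_N) (o : O) := (i \notin A) ==> (vec o <= V)%MS.
rewrite (sum_pw_forall wX K) (bigID (mem A)) /= [X in X * _]big1 ?mul1r; last first.
  by move=> i iA; rewrite -[RHS]wX_sum; apply: eq_bigl => o; rewrite /K iA.
rewrite (eq_bigr (fun=> hit wX V)) => [|i iA]; last first.
  by apply: eq_bigl => o; rewrite /K iA.
rewrite prodr_const.
suff -> : #|[pred i | i \notin A]| = (N - (d - r))%N by [].
rewrite -cA -[X in (X - _)%N](card_ord N) -(cardC (mem A)) addKn.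
by apply: eq_card => i; rewrite !inE.
Qed.

End Exchange.

(** * Odlyzko's bound on the probability of hitting a subspace *)

Section Odlyzko.
Variables (R : realFieldType) (F : fieldType) (E : finType) (w : E -> R).
Hypotheses (w_ge0 : forall e, 0 <= w e) (w_sum : \sum_e w e = 1).
Variables (val_of : E -> F) (al : R).
Hypotheses (val_inj : injective val_of) (w_le : forall e, w e <= al).

Definition vec_of m (o : {ffun 'I_m -> E}) : 'rV[F]_m := \row_j val_of (o j).

(* A subspace of rank [r] determines [m - r] of the coordinates from the others. *)
Lemma hit_le_expn m (V : 'M[F]_m) : hit (@vec_of m) (pw w (T := 'I_m)) V <= al ^+ (m - \rank V).
Proof.
pose C := cokermx V; pose f := maxrankfun C.
pose P : {set 'I_m} := [set f k | k in [set: 'I_(\rank C)]].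
have cP : #|P| = (m - \rank V)%N.
  by rewrite card_imset ?cardsT ?card_ord ?mxrank_coker //; apply: maxrankfun_inj.
rewrite -cP /hit; pose A : {set {ffun 'I_m -> E}} := [set o | (vec_of o <= V)%MS].
rewrite (eq_bigl (mem A)) => [|o]; last by rewrite !inE.
apply: sum_pw_determined => // o o'; rewrite !inE => oV oV' eoo'.
pose u : 'rV[F]_m := vec_of o - vec_of o'.
have uC : u *m C = 0.
  by apply/eqP; rewrite -submxE /u addmx_sub // eqmx_opp.
have u0 i : i \notin P -> u 0 i = 0.
  by move=> iP; rewrite !mxE eoo' // subrr.
pose u' : 'rV[F]_(\rank C) := \row_k u 0 (f k).
have u'0 : u' = 0.
  have /row_free_inj := maxrowsub_free C; move/(_ 1%N u' 0); apply.
  rewrite mul0mx -uC; apply/rowP => j; rewrite !mxE.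
  rewrite [RHS](bigID (mem P)) /= [X in _ = _ + X]big1 ?addr0; last first.
    by move=> i iP; rewrite u0 ?mul0r.
  rewrite big_imset /=; last by move=> k l _ _; apply: maxrankfun_inj.
  by apply: eq_big => [k|k _]; rewrite ?inE // !mxE.
apply/ffunP => i; have [/imsetP[k _ ->]|iP] := boolP (i \in P); last exact: eoo'.
have := congr1 (fun M : 'rV[F]_(\rank C) => M 0 k) u'0.
by rewrite !mxE => /eqP; rewrite subr_eq0 => /eqP/val_inj.
Qed.

End Odlyzko.

(** * Rank deficiency among few columns *)

Section SparseColumns.
Variables (R : realFieldType) (F : fieldType) (O : finType) (N : nat).
Variables (vec : O -> 'rV[F]_N) (w : O -> R) (al : R).
Hypotheses (w_ge0 : forall o, 0 <= w o) (w_sum : \sum_o w o = 1).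
Hypotheses (al_ge0 : 0 <= al) (al_le1 : al <= 1).
Hypothesis hit_le : forall V : 'M[F]_N, hit vec w V <= al ^+ (N - \rank V).

(** Union bound over the set [A] of columns that carry a basis. The other columns, at least [d] in
    number, fall into a space of rank at most [#|I0|], and each of them costs
    [al ^+ (N - #|I0|)]. *)
Lemma rank_deficient_subset (T : finType) (I0 : {set T}) (d : nat) :
  \sum_(c : {ffun T -> O}) pw w c *
    (\rank (span_on vec I0 c 0) + d <= #|I0|)%N%:R
  <= 2 ^+ #|I0| * al ^+ ((N - #|I0|) * d).
Proof.
pose K (A : {set T}) (V : 'M[F]_N) (i : T) (o : O) :=
  (i \in I0 :\: A) ==> (vec o <= V)%MS.
apply: (@le_trans _ _ (\sum_(A in powerset I0 | (#|A| + d <= #|I0|)%N)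
   \sum_(c : {ffun T -> O}) pw w c * [forall i, K A (span_on vec A c 0) i (c i)]%:R)).
  rewrite exchange_big /=; apply: ler_sum => c _.
  rewrite -mulr_sumr; apply: ler_wpM2l; first exact: pw_ge0.
  case: (leqP (\rank (span_on vec I0 c 0) + d) #|I0|) => [rI|_]; last first.
    by apply: sumr_ge0 => A _; rewrite ler0n.
  have [A [sA eA rA]] := basis_extract vec I0 c 0.
  rewrite (bigD1 A) /=; last first.
    by rewrite inE sA /=; move: rI; rewrite -eA rA mxrank0.
  suff -> : [forall i, K A (span_on vec A c 0) i (c i)].
    by rewrite lerDl; apply: sumr_ge0 => B _; rewrite ler0n.
  apply/forallP => i; apply/implyP; rewrite inE => /andP[_ iI].
  by rewrite eA; apply: span_on_in.
apply: (@le_trans _ _ (\sum_(A in powerset I0) al ^+ ((N - #|I0|) * d))); last first.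
  by rewrite sumr_const card_powerset -[leLHS]mulr_natl natrX.
rewrite [leRHS](bigID (fun A : {set T} => (#|A| + d <= #|I0|)%N)) /= -[leLHS]addr0.
apply: lerD; last by apply: sumr_ge0 => A _; rewrite exprn_ge0.
apply: ler_sum => A /andP[]; rewrite inE => sA dA.
rewrite (pw_mix w_sum A) exchange_big /=.
rewrite -[leRHS]mul1r -[X in _ <= X * _](sum_pw w_sum T) mulr_suml.
apply: ler_sum => c _.
rewrite (eq_bigr (fun g => pw w c * (pw w g *
   [forall i, K A (span_on vec A c 0) i (g i)]%:R))); last first.
  move=> g _; rewrite span_on_mix mulrA; congr (_ * _%:R); congr (nat_of_bool _).
  apply: eq_forallb => i; rewrite /K ffunE; case iA: (i \in A) => //.
  by rewrite inE iA.
rewrite -mulr_sumr; apply: ler_wpM2l; first exact: pw_ge0.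
rewrite (sum_pw_forall w (K A (span_on vec A c 0))) (bigID (mem (I0 :\: A))) /=.
rewrite [X in _ * X]big1 ?mulr1; last first.
  by move=> i /negbTE iA; rewrite -[RHS]w_sum; apply: eq_bigl => o; rewrite /K iA.
set V := span_on vec A c 0.
have rV : (\rank V <= #|A|)%N.
  have [B [sB eB rB]] := basis_extract vec A c 0.
  by rewrite -/V in eB; rewrite -eB rB mxrank0 add0n subset_leq_card.
apply: (@le_trans _ _ (\prod_(i in I0 :\: A) al ^+ (N - #|I0|))).
  apply: ler_prod => i iA; apply/andP; split; first by apply: sumr_ge0.
  rewrite (eq_bigl (fun o => (vec o <= V)%MS)); last by move=> o; rewrite /K iA.
  apply: le_trans (hit_le V) _; apply: ler_wiXn2l => //.
  by apply: leq_sub2l; apply: leq_trans rV (subset_leq_card sA).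
rewrite prodr_const -exprM; apply: ler_wiXn2l => //.
by rewrite leq_mul2l cardsD (setIidPr sA) leq_subRL ?dA ?orbT // subset_leq_card.
Qed.

End SparseColumns.

(** * Characters of the prime field *)

Section Characters.
Variable R : realType.
Local Notation C := R[i].
Local Notation "x %:C" := (real_complex R x) : ring_scope.

Definition expi (x : R) : C := Complex (cos x) (sin x).

Lemma expiD x y : expi (x + y) = expi x * expi y.
Proof. by rewrite /expi cosD sinD; congr Complex; rewrite addrC mulrC [X in _ + X]mulrC addrC. Qed.

Lemma normc_expi x : normc (expi x) = 1.
Proof. by rewrite /expi /normc cos2Dsin2 sqrtr1. Qed.

Lemma expi_2pi_nat n : expi (2 * pi * n%:R) = 1.
Proof.
elim: n => [|n IH]; first by rewrite mulr0 /expi cos0 sin0.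
rewrite -[n.+1%:R]natr1 mulrDr mulr1 expiD IH mul1r mulr_natl.
by rewrite /expi cos2pi sin2pi.
Qed.

Lemma normc_sum (I : finType) (P : pred I) (f : I -> C) :
  normc (\sum_(i | P i) f i) <= \sum_(i | P i) normc (f i).
Proof.
elim/big_ind2: _ => [|a b c d ab cd|//]; first by rewrite normc0.
by apply: le_trans (le_normcD _ _) _; apply: lerD.
Qed.

Lemma normc_prod (I : finType) (P : pred I) (f : I -> C) :
  normc (\prod_(i | P i) f i) = \prod_(i | P i) normc (f i).
Proof. by apply: (big_morph (@normc R)) => [x y|]; rewrite ?normcM ?normc1. Qed.

Lemma real_complex_prod (I : finType) (P : pred I) (f : I -> R) :
  (\prod_(i | P i) f i)%:C = \prod_(i | P i) (f i)%:C.
Proof. exact: rmorph_prod. Qed.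

Variable q : nat.
Hypothesis q_pr : prime q.
Local Notation F := 'F_q.

Definition chi (a : F) : C := expi (2 * pi * (a : nat)%:R / q%:R).

Let q_gt0 : (0 < q)%N. Proof. exact: prime_gt0. Qed.
Let q_neq0 : q%:R != 0 :> R. Proof. by rewrite pnatr_eq0 -lt0n. Qed.

Lemma expi_modn n : expi (2 * pi * (n %% q)%:R / q%:R) = expi (2 * pi * n%:R / q%:R).
Proof.
rewrite [in RHS](divn_eq n q) natrD natrM.
have -> : 2 * pi * ((n %/ q)%:R * q%:R + (n %% q)%:R) / q%:R =
  2 * pi * (n %/ q)%:R + 2 * pi * (n %% q)%:R / q%:R :> R by field.
by rewrite expiD expi_2pi_nat mul1r.
Qed.

Lemma chi0 : chi 0 = 1.
Proof. by rewrite /chi mulr0 mul0r /expi cos0 sin0. Qed.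

Lemma chiD a b : chi (a + b) = chi a * chi b.
Proof.
rewrite /chi -expiD -mulrDl -mulrDr -natrD -expi_modn -[in RHS]expi_modn.
suff -> : ((a + b)%R : nat) = ((a + b) %% q)%N by rewrite modn_mod.
by rewrite -[X in _ = (_ %% X)%N]Fp_cast.
Qed.

Lemma chi_sum (I : finType) (P : pred I) (f : I -> F) :
  chi (\sum_(i | P i) f i) = \prod_(i | P i) chi (f i).
Proof. exact: (big_morph chi chiD chi0). Qed.

Lemma normc_chi a : normc (chi a) = 1. Proof. exact: normc_expi. Qed.

Lemma chiN a : chi (- a) = (chi a)^*%C.
Proof.
have e : chi (- a) * chi a = 1 by rewrite -chiD addNr chi0.
have e2 : (chi a)^*%C * chi a = 1.
  rewrite /chi /expi /=; apply/eqP; rewrite eq_complex /=.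
  set x := (_ / _); have := cos2Dsin2 x; rewrite !expr2 => <-.
  by apply/andP; split; apply/eqP; ring.
have ca : chi a != 0 by apply/eqP => ca; move/eqP: e; rewrite ca mulr0 eq_sym oner_eq0.
by apply: (mulIf ca); rewrite e e2.
Qed.

Lemma cos_lt1 (x : R) : 0 < x < 2 * pi -> cos x < 1.
Proof.
move=> /andP[x0 x2]; have -> : x = (x / 2) *+ 2 by rewrite -mulr_natr; field.
have h : 0 < sin (x / 2).
  by apply: sin_gt0_pi; apply/andP; split; [rewrite divr_gt0 | rewrite ltr_pdivrMr // mulrC].
rewrite cos_mulr2n cos2sin2 mulr2n.
have := exprn_gt0 2 h; lra.
Qed.

(** This is half of |[chi a] - 1|^2, a measure of the distance from the residue to 0 on the
    circle. *)
Definition cc (a : F) : R := 1 - complex.Re (chi a).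

Lemma ccE a : cc a = 1 - cos (2 * pi * (a : nat)%:R / q%:R). Proof. by []. Qed.

Lemma cc_ge0 a : 0 <= cc a. Proof. by rewrite ccE subr_ge0 cos_le1. Qed.
Lemma cc_le2 a : cc a <= 2. Proof. by rewrite ccE -[2]/(1 + 1) lerD2l lerNl cos_geN1. Qed.
Lemma cc0 : cc 0 = 0. Proof. by rewrite /cc chi0 /= subrr. Qed.

Lemma ltn_Fp (a : F) : (a < q)%N.
Proof. by rewrite -[X in (_ < X)%N]Fp_cast. Qed.

Lemma cc_gt0 a : a != 0 -> 0 < cc a.
Proof.
move=> a0; rewrite ccE subr_gt0 cos_lt1 //; apply/andP; split.
  rewrite !mulr_gt0 ?pi_gt0 ?invr_gt0 ?ltr0n // lt0n.
  by apply: contra a0 => /eqP a0; apply/eqP/val_inj.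
by rewrite ltr_pdivrMr ?ltr0n // ltr_pM2l ?ltr_nat ?ltn_Fp // mulr_gt0 ?pi_gt0.
Qed.

Lemma chi_neq1 a : a != 0 -> chi a != 1.
Proof.
move=> /cc_gt0; rewrite /cc; apply: contraTneq => ->.
by rewrite /= subrr ltxx.
Qed.

Lemma ccN a : cc (- a) = cc a.
Proof. by rewrite /cc chiN /chi. Qed.

Definition sn (a : F) : R := complex.Im (chi a).

Lemma snE a : sn a ^+ 2 = cc a * (2 - cc a).
Proof.
rewrite /sn /cc /chi /=; set x := (_ / _).
by have := cos2Dsin2 x; set u := cos x; set v := sin x => h; lra.
Qed.

(** The triangle inequality for |[chi a] - 1|, combined with (x + y)^2 <= 2 x^2 + 2 y^2. *)
Lemma cc_triangle a b : cc (a + b) <= 2 * cc a + 2 * cc b.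
Proof.
suff H (x y : R) : 1 - cos (x + y) <= 2 * (1 - cos x) + 2 * (1 - cos y).
  have -> : cc (a + b) = 1 - cos (2 * pi * (a : nat)%:R / q%:R + 2 * pi * (b : nat)%:R / q%:R).
    by rewrite /cc chiD /chi -expiD.
  exact: H.
rewrite cosD; have := cos2Dsin2 x; have := cos2Dsin2 y.
have := cos_le1 x; have := cos_le1 y; have := cos_geN1 x; have := cos_geN1 y.
set u := cos x; set v := sin x; set s := cos y; set t := sin y => *.
have h1 := sqr_ge0 (v - t); have h2 := sqr_ge0 (u - s).
have h3 := sqr_ge0 (u - 1); have h4 := sqr_ge0 (s - 1).
nra.
Qed.

Definition dot n (x y : 'rV[F]_n) : F := \sum_i x 0 i * y 0 i.

Lemma dotDl n (x y z : 'rV[F]_n) : dot (x + y) z = dot x z + dot y z.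
Proof. by rewrite -big_split; apply: eq_bigr => i _; rewrite mxE mulrDl. Qed.

Lemma dotC n (x y : 'rV[F]_n) : dot x y = dot y x.
Proof. by apply: eq_bigr => i _; rewrite mulrC. Qed.

Lemma dotNl n (x y : 'rV[F]_n) : dot (- x) y = - dot x y.
Proof. by rewrite -sumrN; apply: eq_bigr => i _; rewrite mxE mulNr. Qed.

Lemma dotZl n a (x y : 'rV[F]_n) : dot (a *: x) y = a * dot x y.
Proof. by rewrite mulr_sumr; apply: eq_bigr => i _; rewrite mxE mulrA. Qed.

Lemma dotDr n (x y z : 'rV[F]_n) : dot z (x + y) = dot z x + dot z y.
Proof. by rewrite !(dotC z) dotDl. Qed.

Lemma dot_sumr n (I : finType) (P : pred I) (f : I -> 'rV[F]_n) z :
  dot z (\sum_(i | P i) f i) = \sum_(i | P i) dot z (f i).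
Proof.
rewrite exchange_big; apply: eq_bigr => i _; rewrite summxE mulr_sumr //.
Qed.

Lemma dotZr n a (x y : 'rV[F]_n) : dot x (a *: y) = a * dot x y.
Proof. by rewrite dotC dotZl dotC. Qed.

Lemma dotNr n (x y : 'rV[F]_n) : dot y (- x) = - dot y x.
Proof. by rewrite dotC dotNl dotC. Qed.

(** Closure under differences is what the doubling argument delivers; over a prime field such a set
    is a subspace, see [subgroupZ]. *)
Definition subgroup_set n (K : {set 'rV[F]_n}) :=
  0 \in K /\ forall x y, x \in K -> y \in K -> x - y \in K.

Lemma chi_orthogonal n (K : {set 'rV[F]_n}) (x : 'rV[F]_n) : subgroup_set K ->
  \sum_(t in K) chi (dot t x) = (#|K|%:R * [forall t in K, dot t x == 0]%:R : R)%:C.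
Proof.
move=> [K0 KB]; case: (boolP [forall t in K, _]) => [/forall_inP H|].
  rewrite (eq_bigr (fun=> 1)) => [|t tK]; last by rewrite (eqP (H _ tK)) chi0.
  by rewrite sumr_const mulr1 rmorph_nat.
rewrite negb_forall => /existsP[t0]; rewrite negb_imply => /andP[t0K t0x].
rewrite mulr0; set S := (LHS).
have KN y : y \in K -> - y \in K by move=> yK; rewrite -[- y]add0r KB.
have e : S = chi (dot t0 x) * S.
  rewrite {1}/S (reindex_inj (addrI t0)) mulr_sumr /=.
  apply: eq_big => [t|t _]; last by rewrite dotDl chiD.
  apply/idP/idP => tK; last by rewrite -[t]opprK KB ?KN.
  by have := KB _ _ tK t0K; rewrite addrAC subrr add0r.
apply/eqP; rewrite rmorph0; have /eqP := e; rewrite -subr_eq0 -{1}[S]mul1r -mulrBl mulf_eq0.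
by rewrite subr_eq0 eq_sym (negbTE (chi_neq1 t0x)).
Qed.

Lemma chi_orthogonalT n (x : 'rV[F]_n) :
  \sum_t chi (dot t x) = ((q ^ n)%:R * (x == 0)%:R : R)%:C.
Proof.
have := @chi_orthogonal n [set: 'rV[F]_n] x.
under eq_bigl do rewrite inE; move=> ->; last by split=> [|y z]; rewrite ?inE.
congr (_ _); rewrite cardsT card_mx card_Fp // mul1n; congr (_ * _%:R).
congr nat_of_bool; apply/forall_inP/eqP => [H|-> t _]; last first.
  by rewrite /dot big1 // => i _; rewrite mxE mulr0.
apply/rowP => i; rewrite mxE; have /eqP := H (delta_mx 0 i) (in_setT _).
rewrite /dot (bigD1 i) //= big1 ?addr0 => [|j /negbTE ji]; last by rewrite mxE ji andbF mul0r.
by rewrite mxE !eqxx mul1r.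
Qed.

Section LinearForm.
Variables (E T : finType) (w : E -> R) (v : E -> F).
Hypotheses (w_ge0 : forall e, 0 <= w e) (w_sum : \sum_e w e = 1).

Definition charf (a : F) : C := \sum_e (w e)%:C * chi (a * v e).

Variables (n : nat) (A : T -> 'rV[F]_n).
Definition lform (h : {ffun T -> E}) : 'rV[F]_n := \sum_t v (h t) *: A t.

Lemma charf_lform xi :
  \sum_h (pw w h)%:C * chi (dot xi (lform h)) = \prod_t charf (dot xi (A t)).
Proof.
rewrite bigA_distr_bigA; apply: eq_bigr => h _.
rewrite big_split /= -real_complex_prod; congr (_ * _).
rewrite dot_sumr chi_sum; apply: eq_bigr => t _.
by rewrite dotZr mulrC.
Qed.

Lemma prob_fourier z :
  (\sum_h pw w h * (lform h == z)%:R)%:C * ((q ^ n)%:R : R)%:C =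
  \sum_xi chi (- dot xi z) * \prod_t charf (dot xi (A t)).
Proof.
under [RHS]eq_bigr => xi _ do rewrite -charf_lform mulr_sumr.
rewrite exchange_big /= rmorph_sum mulr_suml; apply: eq_bigr => h _.
have -> : (pw w h * (lform h == z)%:R)%:C * ((q ^ n)%:R : R)%:C =
    (pw w h)%:C * ((q ^ n)%:R * (lform h - z == 0)%:R : R)%:C.
  by rewrite subr_eq0 !rmorphM /=; ring.
rewrite -chi_orthogonalT mulr_sumr.
apply: eq_bigr => xi _; rewrite dotDr dotNr chiD; ring.
Qed.

(** Poisson summation: averaging the characters over [K] alone, and not over the whole dual, leaves
    the indicator of orthogonality to [K]. *)
Lemma prob_orthogonal (K : {set 'rV[F]_n}) : subgroup_set K ->
  (\sum_h pw w h * [forall t in K, dot t (lform h) == 0]%:R)%:C * (#|K|%:R : R)%:C =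
  \sum_(xi in K) \prod_t charf (dot xi (A t)).
Proof.
move=> sK; under [RHS]eq_bigr => xi _ do rewrite -charf_lform.
rewrite exchange_big /= rmorph_sum mulr_suml; apply: eq_bigr => h _.
rewrite -mulr_sumr chi_orthogonal // !rmorphM; ring.
Qed.

End LinearForm.

(* Passing to a law whose characteristic function is real and dominates the
   modulus of the given one can only increase the concentration. *)
Lemma prob_le_dominated (E1 E2 T : finType) (w1 : E1 -> R) (w2 : E2 -> R)
    (v1 : E1 -> F) (v2 : E2 -> F) (psi : F -> R) (n : nat) (A : T -> 'rV[F]_n) z :
  (forall a, normc (charf w1 v1 a) <= psi a) ->
  (forall a, charf w2 v2 a = (psi a)%:C) ->
  \sum_h pw w1 h * (lform v1 A h == z)%:R <= \sum_h pw w2 h * (lform v2 A h == 0)%:R.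
Proof.
move=> le1 eq2; have qn : 0 < (q ^ n)%:R :> R by rewrite ltr0n expn_gt0 q_gt0.
rewrite -(ler_pM2r qn).
have -> : (\sum_h pw w2 h * (lform v2 A h == 0)%:R) * (q ^ n)%:R =
  \sum_(xi : 'rV[F]_n) \prod_t psi (dot xi (A t)).
  apply: (@complexI R); rewrite rmorphM /= prob_fourier [RHS]rmorph_sum.
  apply: eq_bigr => xi _; rewrite [RHS]rmorph_prod.
  rewrite {1}/dot big1 => [|i _]; last by rewrite mxE mulr0.
  by rewrite oppr0 chi0 mul1r; apply: eq_bigr => t _; rewrite eq2.
set L := (X in X <= _); have -> : L = complex.Re (L%:C) by [].
have -> : L%:C = \sum_(xi : 'rV[F]_n) chi (- dot xi z) * \prod_t charf w1 v1 (dot xi (A t)).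
  by rewrite -prob_fourier -rmorphM.
have Re_le (y : C) : complex.Re y <= normc y.
  case: y => a b; rewrite /normc /=; apply: le_trans (ler_norm a) _.
  by rewrite -sqrtr_sqr ler_wsqrtr // lerDl sqr_ge0.
apply: le_trans (Re_le _) _; apply: le_trans (normc_sum _ _) _.
apply: ler_sum => xi _; rewrite normcM normc_chi mul1r normc_prod.
by apply: ler_prod => t _; rewrite le1 andbT /normc; case: (charf _ _ _) => a b; apply: sqrtr_ge0.
Qed.

End Characters.

(** * Lazy and Bernoulli laws, their characteristic functions, and hits of subspaces *)

Section Laws.
Variables (R : realType) (q : nat).
Hypothesis q_pr : prime q.
Local Notation F := 'F_q.
Local Notation "x %:C" := (real_complex R x) : ring_scope.

Definition tern (e : 'I_3) : int := if e == 0 then 0 else if e == 1 then 1 else -1.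
(** The characteristic function of this law is 1 - [mu] [cc], which is real and, for [mu] at most
    1/2, nonnegative. *)
Definition lazy (mu : R) (e : 'I_3) : R := if e == 0 then 1 - mu else mu / 2.

Lemma lazy_ge0 mu e : 0 <= mu <= 1 -> 0 <= lazy mu e.
Proof. by move=> /andP[? ?]; rewrite /lazy; case: ifP => _; lra. Qed.

Lemma lazy_sum mu : \sum_e lazy mu e = 1.
Proof. by rewrite !big_ord_recl big_ord0 /lazy /=; lra. Qed.

Lemma lazy_le mu e : 0 <= mu <= 1 / 2 -> lazy mu e <= 1 - mu.
Proof. by move=> /andP[? ?]; rewrite /lazy; case: ifP => _; lra. Qed.

Lemma charf_lazy mu a :
  charf (lazy mu) (fun e => (tern e)%:~R : F) a = (1 - mu * cc R a)%:C.
Proof.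
rewrite /charf !big_ord_recl big_ord0 /lazy /tern /= mulr0 chi0 //.
rewrite mulr1 mulrN1 (chiN R q_pr) addr0 mulr1.
have -> : cc R a = 1 - complex.Re (chi R a) by [].
case: (chi R a) => x y; apply/eqP; rewrite eq_complex /=.
by apply/andP; split; apply/eqP; rewrite /=; lra.
Qed.

Definition ber (p : R) (b : bool) : R := if b then p else 1 - p.

Lemma ber_ge0 p b : 0 <= p <= 1 -> 0 <= ber p b.
Proof. by move=> /andP[? ?]; rewrite /ber; case: b; lra. Qed.

Lemma ber_sum p : \sum_b ber p b = 1.
Proof. by rewrite big_bool /= /ber; lra. Qed.

(** With z = p (1 - p) (1 - cos x) the squared modulus is 1 - 2 z, which is at most (1 - z)^2. *)
Lemma normc_charf_ber p a : 0 <= p <= 1 ->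
  normc (charf (ber p) (fun b => b%:R : F) a) <= 1 - p * (1 - p) * cc R a.
Proof.
move=> /andP[p0 p1]; rewrite /charf big_bool.
have -> : a * true%:R = a by rewrite mulr1.
have -> : a * false%:R = 0 by rewrite mulr0.
rewrite /ber chi0 //.
have c0 := cc_ge0 R a; have c2 := cc_le2 R a.
move: c0 c2; rewrite /cc /chi /expi; set x := (_ / _) => c0 c2.
rewrite [X in normc X](_ : _ = Complex (1 - p + p * cos x) (p * sin x)); last first.
  by apply/eqP; rewrite eq_complex /=; apply/andP; split; apply/eqP; lra.
rewrite /normc /=; move: c0 c2; rewrite /=.
have := cos2Dsin2 x; set u := cos x; set v := sin x => uv c0 c2.
have pp : 0 <= p * (1 - p) by rewrite mulr_ge0 // subr_ge0.
have pp1 : p * (1 - p) <= 1 / 4 by have := sqr_ge0 (p - 1 / 2); lra.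
have B0 : 0 <= 1 - p * (1 - p) * (1 - u) by nra.
rewrite -[leRHS]ger0_norm // -sqrtr_sqr ler_wsqrtr //.
have -> : (1 - p + p * u) ^+ 2 + (p * v) ^+ 2 = 1 - 2 * (p * (1 - p) * (1 - u)).
  have -> : (p * v) ^+ 2 = p ^+ 2 * (1 - u ^+ 2) by rewrite -uv; ring.
  by ring.
by have := sqr_ge0 (p * (1 - p) * (1 - u)); set z := p * (1 - p) * (1 - u) => ?; lra.
Qed.

(** Symmetrising squares the modulus of the characteristic function; the difference law appears when
    the quadratic form is decoupled. *)
Lemma charf_ber_diff p a :
  charf (fun b : bool * bool => ber p b.1 * ber p b.2)
     (fun b => b.1%:R - b.2%:R : F) a = (1 - 2 * (p * (1 - p)) * cc R a)%:C.
Proof.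
rewrite /charf (eq_bigr (fun b : bool * bool => (ber p (b.1, b.2).1 * ber p (b.1, b.2).2)%:C *
   chi R (a * ((b.1, b.2).1%:R - (b.1, b.2).2%:R)))); last by case.
rewrite -(pair_bigA _ (fun b b' => (ber p b * ber p b')%:C * chi R (a * (b%:R - b'%:R)))) /=.
rewrite !big_bool /= /ber subrr !mulr0 subr0 sub0r mulr1 mulrN1 subrr mulr0 chi0 // (chiN R q_pr).
have -> : cc R a = 1 - complex.Re (chi R a) by [].
case: (chi R a) => x y; apply/eqP; rewrite eq_complex /=.
by apply/andP; split; apply/eqP; lra.
Qed.

Section Hits.
Variable m : nat.
Local Notation tv := (fun e : 'I_3 => (tern e)%:~R : F).
Local Notation rv := (@vec_of F _ tv m).

Definition annihilator n (V : 'M[F]_(n, m)) : {set 'rV[F]_m} := [set t | V *m t^T == 0].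

Lemma dotE n (x y : 'rV[F]_n) : dot x y = (y *m x^T) 0 0.
Proof. by rewrite mxE; apply: eq_bigr => i _; rewrite mxE mulrC. Qed.

Lemma annihilator_subgroup n (V : 'M[F]_(n, m)) : subgroup_set (annihilator V).
Proof.
split=> [|x y]; first by rewrite inE trmx0 mulmx0.
by rewrite !inE linearB /= mulmxBr => /eqP -> /eqP ->; rewrite subrr.
Qed.

(** Double annihilator: the columns of the cokernel matrix are test vectors enough. *)
Lemma sub_annihilator n (V : 'M[F]_(n, m)) (x : 'rV[F]_m) :
  (x <= V)%MS = [forall t in annihilator V, dot t x == 0].
Proof.
apply/idP/forall_inP => [/submxP[D ->] t|H].
  by rewrite inE => /eqP Vt; rewrite dotE -mulmxA Vt mulmx0 mxE.
rewrite submxE; apply/eqP/rowP => j; rewrite [RHS]mxE.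
have := H (col j (cokermx V))^T; rewrite inE trmxK colE mulmxA mulmx_coker mul0mx eqxx => /(_ isT)/eqP.
by rewrite dotE trmxK mulmxA -colE mxE.
Qed.

Lemma card_annihilator n (V : 'M[F]_(n, m)) : #|annihilator V| = (q ^ (m - \rank V))%N.
Proof.
have -> : annihilator V = rowg (kermx V^T).
  apply/setP => t; rewrite !inE sub_kermx; apply/eqP/eqP => e.
    by apply: trmx_inj; rewrite trmx_mul trmxK e trmx0.
  by apply: trmx_inj; rewrite trmx_mul trmxK e trmx0.
by rewrite card_rowg mxrank_ker mxrank_tr card_Fp.
Qed.

(* By [hit_weight_sum], this is [q] to the codimension times the probability that a lazy vector lies in the space
   annihilated by [K]. *)
Definition weight_sum (mu : R) (K : {set 'rV[F]_m}) : R :=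
  \sum_(t in K) \prod_j (1 - mu * cc R (t 0 j)).

Lemma hit_weight_sum mu (V : 'M[F]_m) :
  hit rv (pw (lazy mu) (T := 'I_m)) V * (q ^ (m - \rank V))%:R =
  weight_sum mu (annihilator V).
Proof.
pose A (j : 'I_m) : 'rV[F]_m := delta_mx 0 j.
have vE o : rv o = lform tv A o.
  by rewrite [LHS]row_sum_delta; apply: eq_bigr => j _; rewrite mxE.
apply: (@complexI R); rewrite rmorphM /= -card_annihilator.
have := prob_orthogonal q_pr (lazy mu) tv A (annihilator_subgroup V).
set K := annihilator V => H; rewrite [RHS]rmorph_sum.
under [RHS]eq_bigr => t _.
  rewrite rmorph_prod /=; under eq_bigr => j _.
    rewrite (_ : t 0 j = dot t (A j)) -?charf_lazy //; first over.
    rewrite /dot (bigD1 j) //= big1 => [|i /negbTE ij]; last by rewrite mxE ij andbF mulr0.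
    by rewrite mxE !eqxx mulr1 addr0.
  over.
rewrite /= -H; congr (_%:C * _); rewrite /hit big_mkcond; apply: eq_bigr => o _.
by rewrite sub_annihilator vE; case: ifP => _; rewrite ?mulr1 ?mulr0.
Qed.

End Hits.
End Laws.

(** * Growth of lazier hit probabilities: few dimensions *)

Section Doubling.
Variable V : finZmodType.
Implicit Types (A : {set V}).

Definition sumset A : {set V} := [set x + y | x in A, y in A].

(* Small doubling: every difference of [A] is represented by more than half of
   the elements of [A], so any two representations share an element. *)
Lemma sumset_subgroup A : (forall x, x \in A -> - x \in A) ->
  (2 * #|sumset A| < 3 * #|A|)%N ->
  forall d d', d \in sumset A -> d' \in sumset A -> d - d' \in sumset A.
Proof.
move=> AN small; pose rep d := [set a in A | a - d \in A].
have repP d : d \in sumset A -> (#|A| < 2 * #|rep d|)%N.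
  move=> /imset2P[x y xA yA ->].
  (* Both translates lie in the sumset, which has fewer than 3/2 [#|A|] elements, so they meet in
     more than half of [#|A|]. Shifted by [x], the intersection lies in [rep (x + y)]. *)
  pose A1 := [set a - x | a in A]; pose A2 := [set a + y | a in A].
  have sub1 : A1 \subset sumset A.
    by apply/subsetP => z /imsetP[a aA ->]; apply/imset2P; exists a (- x); rewrite ?AN.
  have sub2 : A2 \subset sumset A.
    by apply/subsetP => z /imsetP[a aA ->]; apply/imset2P; exists a y.
  have c1 : #|A1| = #|A| by rewrite card_imset //; apply: addIr.
  have c2 : #|A2| = #|A| by rewrite card_imset //; apply: addIr.
  have sU : (#|A1 :|: A2| <= #|sumset A|)%N.
    by apply: subset_leq_card; rewrite subUset sub1.
  have sI : (#|A1 :&: A2| <= #|rep (x + y)%R|)%N.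
    rewrite -(card_imset (mem (A1 :&: A2)) (addIr x)); apply: subset_leq_card.
    apply/subsetP => z /imsetP[c]; rewrite inE => /andP[/imsetP[a aA ca] /imsetP[b bA cb]] ->.
    rewrite inE {1}ca subrK aA /= {1}cb.
    by have -> : b + y + x - (x + y) = b by rewrite opprD addrA addrK addrK.
  have := cardsUI A1 A2; rewrite c1 c2; lia.
move=> d d' dS d'S.
have [z] : exists z, z \in rep d :&: rep d'.
  apply/set0Pn; rewrite -card_gt0.
  have := cardsUI (rep d) (rep d'); have := repP _ dS; have := repP _ d'S.
  have : (#|rep d :|: rep d'| <= #|A|)%N.
    by apply: subset_leq_card; rewrite subUset; apply/andP; split;
       apply/subsetP => z; rewrite inE => /andP[].
  lia.
rewrite !inE => /andP[/andP[zA zd] /andP[_ zd']].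
apply/imset2P; exists (z - d') (- (z - d)); rewrite ?AN //.
by rewrite opprB [RHS]addrC addrA subrK.
Qed.

End Doubling.

Section Growth.
Variables (R : realType) (q : nat).
Hypothesis q_pr : prime q.
Local Notation F := 'F_q.
Variable m : nat.
Implicit Types (K : {set 'rV[F]_m}) (t : 'rV[F]_m).

Definition energy t : R := \sum_j cc R (t 0 j).

Lemma energy_ge0 t : 0 <= energy t.
Proof. by apply: sumr_ge0 => j _; apply: cc_ge0. Qed.

Lemma energy0 : energy 0 = 0.
Proof. by apply: big1 => j _; rewrite mxE cc0. Qed.

Lemma energyN t : energy (- t) = energy t.
Proof. by apply: eq_bigr => j _; rewrite mxE ccN. Qed.

Lemma energyD t t' : energy (t + t') <= 2 * energy t + 2 * energy t'.
Proof.
rewrite !mulr_sumr -big_split; apply: ler_sum => j _.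
by rewrite mxE cc_triangle.
Qed.

Lemma energy_le t : energy t <= 2 * m%:R.
Proof.
rewrite mulr_natr -[X in _ *+ X]card_ord -sumr_const.
by apply: ler_sum => j _; apply: cc_le2.
Qed.

Definition ball K (s : R) : {set 'rV[F]_m} := [set t in K | energy t <= s].

Lemma prod_lazy_le (mu : R) t : 0 <= mu <= 1 / 2 ->
  \prod_j (1 - mu * cc R (t 0 j)) <= expR (- (mu * energy t)).
Proof.
move=> /andP[mu0 mu1]; rewrite mulr_sumr -sumrN expR_sum.
apply: ler_prod => j _; have := cc_ge0 R (t 0 j); have := cc_le2 R (t 0 j) => ? ?.
by rewrite expR_ge1Dx // andbT; nra.
Qed.

Lemma prod_lazy_ge (mu : R) t : 0 <= mu <= 1 / 4 ->
  expR (- (2 * mu * energy t)) <= \prod_j (1 - mu * cc R (t 0 j)).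
Proof.
move=> /andP[mu0 mu1]; rewrite mulr_sumr -sumrN expR_sum.
apply: ler_prod => j _; rewrite expR_ge0 /=.
have := cc_ge0 R (t 0 j); have := cc_le2 R (t 0 j); set c := cc R _ => c2 c0.
have x0 : 0 <= mu * c by rewrite mulr_ge0.
have x1 : mu * c <= 1 / 2 by nra.
rewrite expRN -[leLHS]mulr1 mulrC ler_pdivrMr ?expR_gt0 //.
have := expR_ge1Dx (2 * mu * c); have := expR_gt0 (2 * mu * c).
by set y := expR _; set x := mu * c in x0 x1 *; rewrite -mulrA -/x => ? ?; nra.
Qed.

Lemma ball_sumset K s : subgroup_set K -> sumset (ball K s) \subset ball K (4 * s).
Proof.
move=> [K0 KB]; apply/subsetP => z /imset2P[x y]; rewrite !inE.
move=> /andP[xK xs] /andP[yK ys] ->; apply/andP; split.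
  by rewrite -[y]opprK KB // -[- y]add0r KB.
apply: le_trans (energyD _ _) _; lra.
Qed.

Lemma ballN K s : subgroup_set K -> forall x, x \in ball K s -> - x \in ball K s.
Proof.
by move=> [K0 KB] x; rewrite !inE energyN => /andP[xK ->]; rewrite andbT -sub0r KB.
Qed.

(** Sums of two elements of a ball stay in the ball of four times the radius, so each step compares
    a ball with its sumset inside the next one. A subgroup, once found, serves all later steps. *)
Lemma ball_growth K s j : subgroup_set K -> 0 <= s ->
  ((3 / 2) ^+ j * #|ball K s|%:R <= #|ball K (4 ^+ j * s)|%:R :> R) \/
  (exists D : {set 'rV[F]_m}, [/\ subgroup_set D, D \subset K,
     (#|ball K s| <= #|D|)%N & forall t, t \in D -> energy t <= 4 ^+ j * s]).
Proof.
move=> sK s0; elim: j => [|j [IH|[D [sD DK cD Ds]]]].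
- by left; rewrite !expr0 !mul1r.
- set A := ball K (4 ^+ j * s) in IH *.
  have AA : sumset A \subset ball K (4 ^+ j.+1 * s) by rewrite exprS -mulrA; apply: ball_sumset.
  have [small|big] := ltnP (2 * #|sumset A|) (3 * #|A|).
    right; exists (sumset A).
    have A0 : 0 \in A by rewrite inE energy0 sK.1 mulr_ge0 ?exprn_ge0.
    have AS : A \subset sumset A.
      by apply/subsetP => x xA; apply/imset2P; exists x 0; rewrite ?addr0.
    split.
    - split; first exact: (subsetP AS).
      by apply: sumset_subgroup => // x; apply: ballN.
    - by apply: fintype.subset_trans AA _; apply/subsetP => x; rewrite inE => /andP[].
    - apply: leq_trans (subset_leq_card AS); apply: subset_leq_card.
      apply/subsetP => x; rewrite !inE => /andP[-> /= xs]; apply: le_trans xs _.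
      by rewrite ler_peMl // exprn_ege1 // ler1n.
    by move=> t /(subsetP AA); rewrite inE => /andP[].
  left; have big' : (3 * #|A| <= 2 * #|ball K (4 ^+ j.+1 * s)|)%N.
    by apply: leq_trans big _; rewrite leq_mul2l /= subset_leq_card.
  move: big'; rewrite -(ler_nat R) !natrM => big'.
  by rewrite exprS -mulrA; lra.
right; exists D; split=> // t /Ds; move/le_trans; apply.
by rewrite exprS -mulrA ler_peMl ?mulr_ge0 ?exprn_ge0 // ler1n.
Qed.

Lemma geometric_sum_lt (B : nat) : \sum_(i < B) (2 / 3 : R) ^+ i < 3.
Proof.
suff -> : \sum_(i < B) (2 / 3 : R) ^+ i = 3 - 3 * (2 / 3) ^+ B.
  by rewrite gtrBl mulr_gt0 // exprn_gt0 // divr_gt0.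
elim: B => [|B IH]; first by rewrite big_ord0 expr0; ring.
by rewrite big_ord_recr /= IH exprS; field.
Qed.

(** Pigeonhole over the integer levels of [nu * energy]. If every level failed, the total weight
    would be below a third of itself times the sum of exp(-i/2), and since exp(-1/2) <= 2/3 this sum
    is less than 3. *)
Lemma heavy_level K (nu : R) : 0 <= nu <= 1 / 2 ->
  0 < weight_sum nu K ->
  exists i : nat, expR (i%:R / 2) * weight_sum nu K <=
    3 * #|[set t in K | nu * energy t <= i.+1%:R]|%:R.
Proof.
move=> /andP[nu0 nu1] Z0; apply/not_existsP => H.
pose Fi i := #|[set t in K | nu * energy t <= i.+1%:R]|%:R : R.
have {}H i : 3 * Fi i < expR (i%:R / 2) * weight_sum nu K.
  by rewrite ltNge; apply/negP/H.
pose lev t := Num.truncn (nu * energy t).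
have nE0 t : 0 <= nu * energy t by rewrite mulr_ge0 ?energy_ge0.
have levB t : (lev t < (2 * m).+1)%N.
  rewrite -(ltr_nat R); apply: le_lt_trans (_ : nu * energy t < _).
    by have /andP[] := truncn_itv (nE0 t).
  apply: (@le_lt_trans _ _ (2 * m)%:R); last by rewrite ltr_nat.
  rewrite natrM; have := energy_le t; have := energy_ge0 t; nra.
have : weight_sum nu K <= \sum_(i < (2 * m).+1) expR (- i%:R) * Fi i.
  rewrite /weight_sum (partition_big (fun t => Ordinal (levB t)) predT) //=.
  apply: ler_sum => i _; rewrite /Fi mulr_natr -sumr_const.
  rewrite [leRHS](bigID (fun t => Ordinal (levB t) == i)) /= -[leLHS]addr0.
  apply: lerD; last by apply: sumr_ge0 => t _; apply: expR_ge0.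
  rewrite [leLHS]big_mkcond [leRHS]big_mkcond; apply: ler_sum => t _.
  case: ifP => [/andP[tK ti]|_]; last by case: ifP => // _; apply: expR_ge0.
  have /andP[l1 l2] := truncn_itv (nE0 t).
  have li : lev t = i by rewrite -(eqP ti).
  rewrite inE tK ti andbT /= -li (ltW l2).
  apply: le_trans (prod_lazy_le _ _) _; first by rewrite nu0.
  by rewrite ler_expR lerN2.
apply/negP; rewrite -ltNge.
apply: (@le_lt_trans _ _ (\sum_(i < (2 * m).+1) (2 / 3) ^+ i * (weight_sum nu K / 3))).
  apply: ler_sum => i _.
  have e : expR (- i%:R) = expR (- (i%:R / 2)) * expR (- (i%:R / 2)) :> R.
    by rewrite -expRD; congr expR; field.
  have hi : expR (- (i%:R / 2)) <= (2 / 3) ^+ i :> R.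
    have -> : - (i%:R / 2) = i%:R * (- (1 / 2)) :> R by ring.
    rewrite expRM_natl; apply: lerXn2r; rewrite ?nnegrE ?expR_ge0 ?divr_ge0 //.
    rewrite expRN -[leLHS]mul1r ler_pdivrMr ?expR_gt0 //.
    have := expR_ge1Dx (1 / 2 : R); lra.
  rewrite e -mulrA; apply: ler_pM => //; rewrite ?mulr_ge0 ?expR_ge0 ?ler0n //.
  rewrite expRN ler_pdivrMl ?expR_gt0 // mulrA ler_pdivlMr // [leLHS]mulrC.
  exact/ltW/H.
rewrite -mulr_suml mulrA ltr_pdivrMr // [ltRHS]mulrC ltr_pM2r //.
exact: geometric_sum_lt.
Qed.

(* Each dilation of the ball by 4 multiplies its cardinality by 3/2 until the doubling is small enough
   for [sumset_subgroup]; the subgroup so obtained consists of vectors of small energy. *)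
Lemma growth_or_subgroup K (nu eta La : R) j : subgroup_set K ->
  0 < nu <= 1 / 4 -> eta = nu / 4 ^+ j.+1 ->
  0 < weight_sum nu K -> #|K|%:R <= expR La * weight_sum nu K ->
  ((3 / 2) ^+ j / 6 * weight_sum nu K <= weight_sum eta K) \/
  (exists D : {set 'rV[F]_m}, [/\ subgroup_set D, D \subset K,
     weight_sum nu K <= 3 * #|D|%:R &
     forall t, t \in D -> energy t <= 4 ^+ j * ((2 * La + 5) / nu)]).
Proof.
move=> sK /andP[nu0 nu1] etaE Z0 cK.
have nu12 : 0 <= nu <= 1 / 2 by apply/andP; split; lra.
have [i Hi] := heavy_level nu12 Z0.
pose s := i.+1%:R / nu.
have s0 : 0 <= s by rewrite divr_ge0 // ltW.
have eB : [set t in K | nu * energy t <= i.+1%:R] = ball K s.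
  by apply/setP => t; rewrite !inE /s ler_pdivlMr // mulrC.
rewrite eB in Hi.
(* The heavy level satisfies i <= 2 [La] + 4: the ball has at most [expR La * weight_sum nu K]
   elements, and 3 <= exp 2. *)
have iLa : s <= (2 * La + 5) / nu.
  rewrite ler_pM2r ?invr_gt0 // -natr1.
  have e3 : 3 <= expR 2 :> R by have := expR_ge1Dx (2 : R); lra.
  have : expR (i%:R / 2) <= expR (2 + La) :> R.
    rewrite expRD -(ler_pM2r Z0); apply: le_trans Hi _.
    have : #|ball K s|%:R <= #|K|%:R :> R.
      by rewrite ler_nat subset_leq_card //; apply/subsetP => t; rewrite inE => /andP[].
    move=> /le_trans/(_ cK) h; rewrite -mulrA ler_pM ?ler0n //.
  by rewrite ler_expR; lra.
have [grow|[D [sD DK cD Ds]]] := ball_growth j sK s0; last first.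
  right; exists D; split=> //.
    have : #|ball K s|%:R <= #|D|%:R :> R by rewrite ler_nat.
    have : 1 <= expR (i%:R / 2) :> R by rewrite -expR0 ler_expR divr_ge0.
    nra.
  by move=> t /Ds/le_trans; apply; rewrite ler_wpM2l ?exprn_ge0.
left; have eta0 : 0 <= eta <= 1 / 4.
  have p4 : 1 <= 4 ^+ j.+1 :> R by rewrite exprn_ege1 // ler1n.
  rewrite etaE divr_ge0 ?(ltW nu0) ?(le_trans _ p4) //=.
  by rewrite ler_pdivrMr ?(lt_le_trans _ p4) //; nra.
(* [eta] is chosen so that 2 [eta] times the radius [4 ^+ j * s] equals (i + 1)/2: on the dilated
   ball the lazier weight loses no more than what the heavy level gained, up to the factor exp(1/2)
   <= 2. *)
have Hw : expR (- (i.+1%:R / 2)) * #|ball K (4 ^+ j * s)|%:R <= weight_sum eta K.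
  rewrite mulr_natr -sumr_const /weight_sum.
  rewrite [leRHS](bigID (fun t => energy t <= 4 ^+ j * s)) /= -[leLHS]addr0; apply: lerD.
    rewrite (eq_bigl (fun t => (t \in K) && (energy t <= 4 ^+ j * s))) => [|t]; last by rewrite inE.
    apply: ler_sum => t /andP[_ ts]; apply: le_trans (prod_lazy_ge _ eta0).
    rewrite ler_expR lerN2.
    have -> : i.+1%:R / 2 = 2 * eta * (4 ^+ j * s).
      by rewrite etaE /s exprS; field; rewrite ?expf_neq0 ?gt_eqF.
    by rewrite ler_wpM2l // mulr_ge0 //; case/andP: eta0.
  by apply: sumr_ge0 => t _; apply: le_trans (prod_lazy_ge _ eta0); exact: expR_ge0.
apply: le_trans Hw.
have e2 : 1 / 2 <= expR (- (1 / 2)) :> R by have := expR_ge1Dx (- (1 / 2) : R); lra.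
have -> : expR (- (i.+1%:R / 2)) = expR (- (i%:R / 2)) * expR (- (1 / 2)) :> R.
  by rewrite -expRD -natr1; congr expR; field.
have h1 : weight_sum nu K / 3 <= expR (- (i%:R / 2)) * #|ball K s|%:R.
  by rewrite ler_pdivrMr // expRN -mulrA ler_pdivlMl ?expR_gt0 // [_ * 3]mulrC.
have P0 : 0 <= (3 / 2) ^+ j :> R by rewrite exprn_ge0 // divr_ge0.
have h2 := ler_wpM2l (expR_ge0 (- (i%:R / 2) : R)) grow.
have h3 := ler_wpM2l P0 h1.
have h4 : 0 <= expR (- (i%:R / 2)) * #|ball K (4 ^+ j * s)|%:R :> R by rewrite mulr_ge0 ?expR_ge0 ?ler0n.
have h5 := ler_wpM2l h4 e2.
rewrite [leRHS]mulrAC; apply: le_trans h5; rewrite mulrCA in h2; lra.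
Qed.

End Growth.

(** * Growth of lazier hit probabilities: many dimensions *)

(** Jensen's inequality for the [p]-th power. The induction rests on (x - c)(x^p - c^p) >= 0. *)
Lemma power_mean (R : realFieldType) (T : finType) (P : pred T) (h x : T -> R) (c : R) p :
  (forall i, P i -> 0 <= h i) -> (forall i, P i -> 0 <= x i) -> 0 <= c ->
  c * (\sum_(i | P i) h i) <= \sum_(i | P i) h i * x i ->
  c ^+ p * (\sum_(i | P i) h i) <= \sum_(i | P i) h i * x i ^+ p.
Proof.
move=> h0 x0 c0 H; elim: p => [|p IH].
  by rewrite expr0 mul1r; under [leRHS]eq_bigr do rewrite expr0 mulr1.
have key t : P t -> h t * (c ^+ p * x t) + c * (h t * x t ^+ p) <= h t * x t ^+ p.+1 + c ^+ p.+1 * h t.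
  move=> Pt; rewrite !exprS.
  have xp := x0 _ Pt.
  suff : 0 <= (x t - c) * (x t ^+ p - c ^+ p).
    by have := h0 _ Pt; set X := x t ^+ p; set C := c ^+ p; nra.
  case: (lerP c (x t)) => hc.
    by rewrite mulr_ge0 ?subr_ge0 // lerXn2r.
  by apply: mulr_le0; rewrite subr_le0 ?(ltW hc) // lerXn2r ?nnegrE // ltW.
have : \sum_(t | P t) (h t * (c ^+ p * x t) + c * (h t * x t ^+ p)) <=
       \sum_(t | P t) (h t * x t ^+ p.+1 + c ^+ p.+1 * h t) by apply: ler_sum.
rewrite !big_split /= -!mulr_sumr.
under eq_bigr do rewrite mulrCA.
rewrite -mulr_sumr => k1.
have k2 := ler_wpM2l (exprn_ge0 p c0) H.
have k3 := ler_wpM2l c0 IH.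
rewrite !mulrA -exprSr in k2; rewrite mulrA -exprS in k3.
lra.
Qed.

Section ShiftGrowth.
Variables (R : realType) (q : nat).
Hypothesis q_pr : prime q.
Local Notation F := 'F_q.
Variable m : nat.
Implicit Types (K : {set 'rV[F]_m}) (t : 'rV[F]_m).

Lemma ccD (a b : F) :
  cc R (a + b) = cc R a + (1 - cc R a) * cc R b + sn R a * sn R b.
Proof.
rewrite /cc /sn chiD //; case: (chi R a) => x y; case: (chi R b) => u v /=; ring.
Qed.

Lemma snN (a : F) : sn R (- a) = - sn R a.
Proof. by rewrite /sn chiN //; case: (chi R a). Qed.

Lemma cosh_le (y : R) : (expR y + expR (- y)) / 2 <= expR (2 * y ^+ 2).
Proof.
wlog y0 : y / 0 <= y => [H|].
  by have [/H//|/ltW y0] := lerP 0 y; rewrite -[y in expR y]opprK addrC -sqrrN H ?oppr_ge0.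
have [y1|y1] := lerP (1 / 2) y.
  have h1 : expR y <= expR (2 * y ^+ 2) by rewrite ler_expR; nra.
  have h2 : expR (- y) <= expR (2 * y ^+ 2) by rewrite ler_expR; nra.
  lra.
have e1 : expR y <= (1 - y)^-1.
  rewrite -[y in expR y]opprK expRN lef_pV2 ?posrE ?expR_gt0 //; last lra.
  exact: expR_ge1Dx.
have e2 : expR (- y) <= (1 + y)^-1.
  by rewrite expRN lef_pV2 ?posrE ?expR_gt0 ?expR_ge1Dx //; lra.
have e3 : ((1 - y)^-1 + (1 + y)^-1) / 2 = (1 - y ^+ 2)^-1.
  field; apply/and3P; split; apply/lt0r_neq0; nra.
have e4 : (1 - y ^+ 2)^-1 <= expR (2 * y ^+ 2).
  have x0 : 0 <= y ^+ 2 by rewrite sqr_ge0.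
  have x1 : y ^+ 2 <= 1 / 4 by nra.
  apply: le_trans (expR_ge1Dx _); rewrite -[leLHS]mul1r ler_pdivrMr; nra.
lra.
Qed.

(** Expand [ccD] and use 1 + x <= exp x. The term odd in [b] is kept apart so that it can be
    averaged over [b] and [- b]. *)
Lemma lazy_shift_le (nu : R) (a b : F) : 0 <= nu <= 1 / 4 ->
  1 - nu * cc R (a + b) <= (1 - nu * cc R a) *
    expR (- (nu * cc R b) + 2 * nu * (cc R a * cc R b)
          - (nu / (1 - nu * cc R a) * sn R a) * sn R b).
Proof.
move=> /andP[nu0 nu1]; rewrite ccD.
have := cc_ge0 R a; have := cc_le2 R a; have := cc_ge0 R b.
move: (cc R a) (cc R b) (sn R a) (sn R b) => c u s v u0 c2 c0.
have D0 : 1 / 2 <= 1 - nu * c by nra.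
have Dn : 1 - nu * c != 0 by rewrite gt_eqF //; lra.
have D1 : 0 < 1 - nu * c by lra.
rewrite -ler_pdivrMl //; apply: le_trans (expR_ge1Dx _).
rewrite ler_pdivrMl // !mulrDr mulrN mulr1.
have -> : (1 - nu * c) * - (nu / (1 - nu * c) * s * v) = - (nu * s * v) by field.
have h : 0 <= nu * u * c by rewrite !mulr_ge0.
have h2 : 0 <= nu * u * c * (2 * (1 - nu * c) + nu - 1) by rewrite mulr_ge0 //; lra.
lra.
Qed.

Lemma prod_expR_superadd (I : finType) (g : I -> R) : (forall i, 0 <= g i) ->
  \sum_i (expR (g i) - 1) <= expR (\sum_i g i) - 1.
Proof.
move=> g0; suff H (s : seq I) : \sum_(i <- s) (expR (g i) - 1) <= expR (\sum_(i <- s) g i) - 1 by apply: H.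
elim: s => [|i s IH]; first by rewrite !big_nil expR0 subrr.
rewrite !big_cons expRD.
have a1 : 1 <= expR (g i) by rewrite -expR0 ler_expR.
have b1 : 1 <= expR (\sum_(j <- s) g j) by rewrite -expR0 ler_expR sumr_ge0.
nra.
Qed.

Variables (d : nat) (w : 'I_d -> 'rV[F]_m) (nu kap A : R) (K : {set 'rV[F]_m}).
Hypotheses (d0 : (0 < d)%N) (nu0 : 0 < nu) (nu1 : nu <= 1 / 4) (A0 : 0 <= A).
Hypotheses (sK : subgroup_set K) (wK : forall l, w l \in K).
Hypothesis w_energy : forall l, kap <= energy R (w l).
Hypothesis w_cc : forall j, \sum_l cc R (w l 0 j) <= A.
Hypothesis w_sn : forall b : 'I_m -> R,
  \sum_l (\sum_j b j * sn R (w l 0 j)) ^+ 2 <= A * \sum_j b j ^+ 2.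

Local Notation f t := (\prod_j (1 - nu * cc R (t 0 j))).

Let nu14 : 0 <= nu <= 1 / 4. Proof. by rewrite ltW. Qed.

Lemma lazy_prod_gt0 t : 0 < f t.
Proof.
apply: prodr_gt0 => j _; have n0 := nu0; have n1 := nu1; have := cc_ge0 R (t 0 j); have := cc_le2 R (t 0 j); move: (cc R _) => c ? ?; nra.
Qed.

Let bv t j : R := nu / (1 - nu * cc R (t 0 j)) * sn R (t 0 j).
Let y t l : R := \sum_j bv t j * sn R (w l 0 j).
Let g t l : R := 2 * nu * (\sum_j cc R (t 0 j) * cc R (w l 0 j)) + 2 * y t l ^+ 2.

Lemma shift_one t l (v : 'rV[F]_m) (sg : R) :
  (forall j, cc R (v 0 j) = cc R (w l 0 j)) -> (forall j, sn R (v 0 j) = sg * sn R (w l 0 j)) ->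
  f (t + v) <= f t * expR (- (nu * kap) + 2 * nu * (\sum_j cc R (t 0 j) * cc R (w l 0 j)) - sg * y t l).
Proof.
move=> ev es; apply: (@le_trans _ _ (\prod_j ((1 - nu * cc R (t 0 j)) *
    expR (- (nu * cc R (v 0 j)) + 2 * nu * (cc R (t 0 j) * cc R (v 0 j))
          - bv t j * sn R (v 0 j))))).
  apply: ler_prod => j _; rewrite mxE lazy_shift_le // andbT.
  have := cc_ge0 R (t 0 j + v 0 j); have := cc_le2 R (t 0 j + v 0 j); move: (cc R _) nu0 nu1 => c ? ? ? ?; nra.
rewrite big_split /= ler_pM2l ?lazy_prod_gt0 // -expR_sum ler_expR.
rewrite sumrB big_split /= sumrN -!mulr_sumr.
rewrite (eq_bigr _ (fun j _ => ev j)) [X in _ + 2 * nu * X](eq_bigr (fun j => cc R (t 0 j) * cc R (w l 0 j))) => [|j _]; last by rewrite ev.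
rewrite [X in _ - X <= _](eq_bigr (fun j => sg * (bv t j * sn R (w l 0 j)))) => [|j _]; last by rewrite es mulrCA.
rewrite -mulr_sumr -/(y t l) -/(energy R (w l)) !lerD2r lerN2 ler_pM2l //; exact: w_energy.
Qed.

(** The two shifts differ only in the sign of the term linear in [y t l]; their mean is a hyperbolic
    cosine, bounded by a Gaussian factor. *)
Lemma shift_pair t l : (f (t + w l) + f (t - w l)) / 2 <= f t * expR (- (nu * kap)) * expR (g t l).
Proof.
have h1 := @shift_one t l (w l) 1 (fun=> erefl) (fun=> esym (mul1r _)).
have h2 := @shift_one t l (- w l) (-1).
have {}h2 := h2 (fun j => ltac:(by rewrite mxE ccN)) (fun j => ltac:(by rewrite mxE snN mulN1r)).
rewrite mul1r in h1; rewrite mulN1r opprK in h2.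
rewrite /g expRD [X in _ <= X](_ : _ = f t * expR (- (nu * kap) + 2 * nu * (\sum_j cc R (t 0 j) * cc R (w l 0 j))) * expR (2 * y t l ^+ 2)); last first.
  by rewrite expRD; ring.
have := cosh_le (y t l); set B := expR (2 * _).
rewrite expRD mulrA in h1; rewrite expRD mulrA in h2.
set P := f t * _ in h1 h2 *.
have P0 : 0 <= P by rewrite mulr_ge0 ?expR_ge0 // ltW // lazy_prod_gt0.
move=> h3; have := ler_wpM2l P0 h3; lra.
Qed.

Lemma g_sum t : \sum_l g t l <= 6 * nu * A * energy R t.
Proof.
rewrite /g big_split /= -!mulr_sumr.
have h1 : \sum_l \sum_j cc R (t 0 j) * cc R (w l 0 j) <= A * energy R t.
  rewrite exchange_big mulr_sumr; apply: ler_sum => j _.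
  by rewrite -mulr_sumr [leRHS]mulrC ler_wpM2l ?cc_ge0.
have h2 : \sum_l y t l ^+ 2 <= A * (2 * nu * energy R t).
  apply: le_trans (w_sn _) _; apply: ler_wpM2l => //.
  rewrite mulr_sumr; apply: ler_sum => j _.
  rewrite /bv exprMn snE exprMn exprVn.
  have := cc_ge0 R (t 0 j); have := cc_le2 R (t 0 j); move: (cc R (t 0 j)) => c c2 c0.
  have n0' := nu0; have n1 := nu1; have D0 : 1 / 2 <= 1 - nu * c by nra.
  have D1 : 0 < (1 - nu * c) ^+ 2 by rewrite exprn_gt0 //; lra.
  rewrite mulrAC ler_pdivrMr //.
  have D2 : 1 / 4 <= (1 - nu * c) ^+ 2 by nra.
  have n0 : 0 <= nu * c by rewrite mulr_ge0 // ltW.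
  have := ler_wpM2l n0 D2; have : nu * (nu * c) <= 1 / 4 * (nu * c) by apply: ler_wpM2r.
  have : 0 <= nu * nu * c * c by rewrite !mulr_ge0 // ltW.
  nra.
have := ler_wpM2l (ltW nu0) h1; lra.
Qed.

(** The weight sum is invariant under shifts by elements of [K], so it equals its average over all
    the shifts by [w l] and [- w l]. By superadditivity the [d] exponentials sum to at most d - 1
    plus the exponential of the total exponent, and the d - 1 copies of the weight are
    subtracted. *)
Lemma shift_exp_moment :
  (1 + d%:R * (nu * kap)) * weight_sum nu K <=
  \sum_(t in K) f t * expR (6 * nu * A * energy R t).
Proof.
set Z := weight_sum nu K.
have sh v : v \in K -> \sum_(t in K) f (t + v) = Z.
  move=> vK; rewrite /Z /weight_sum [RHS](reindex_inj (addIr v)) /=.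
  apply: eq_bigl => t; apply/idP/idP => tK.
    by rewrite -[v]opprK sK.2 // -sub0r sK.2 // sK.1.
  by rewrite -[t](addrK v) sK.2.
have wNK l : - w l \in K by rewrite -sub0r sK.2 // sK.1.
have H : d%:R * Z * expR (nu * kap) <= \sum_(t in K) f t * \sum_l expR (g t l).
  rewrite -ler_pdivlMr ?expR_gt0 // -expRN mulr_suml.
  have -> : d%:R * Z = \sum_(t in K) \sum_l (f (t + w l) + f (t - w l)) / 2.
    rewrite exchange_big /= (eq_bigr (fun=> Z)) => [|l _].
      by rewrite sumr_const card_ord mulr_natl.
    by rewrite -mulr_suml big_split /= sh // sh //; field.
  apply: ler_sum => t _; rewrite mulrAC mulr_sumr; apply: ler_sum => l _.
  exact: shift_pair.
have H2 : d%:R * Z * expR (nu * kap) <= \sum_(t in K) f t * (d%:R - 1 + expR (6 * nu * A * energy R t)).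
  apply: le_trans H _; apply: ler_sum => t _; apply: ler_wpM2l; first exact/ltW/lazy_prod_gt0.
  have g0 l : 0 <= g t l.
    rewrite /g addr_ge0 //; last by rewrite mulr_ge0 ?sqr_ge0.
    rewrite !mulr_ge0 ?(ltW nu0) //.
    by apply: sumr_ge0 => j _; rewrite mulr_ge0 ?cc_ge0.
  have := prod_expR_superadd g0; rewrite sumrB sumr_const card_ord.
  have : expR (\sum_l g t l) <= expR (6 * nu * A * energy R t) by rewrite ler_expR g_sum.
  by set S := \sum_l expR _; rewrite -mulr_natl mulr1; lra.
move: H2; under eq_bigr do rewrite mulrDr.
rewrite big_split /= -mulr_suml -/(weight_sum nu K) -/Z; set S := (\sum_(t in K) _) => H2.
have Z0 : 0 <= Z by apply: sumr_ge0 => t _; apply/ltW/lazy_prod_gt0.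
have := expR_ge1Dx (nu * kap); have d0' : 0 <= d%:R :> R by [].
move=> e; have dZ : 0 <= d%:R * Z by rewrite mulr_ge0.
have := ler_wpM2l dZ e; lra.
Qed.

(* Averaging the weight over shifts by the nearly orthogonal short vectors [w l], Bessel's inequality shows
   that the typical energy of a heavy element is of order [d], on which the lazier weight gains. *)
Lemma shift_growth (eta : R) p : 0 <= eta -> eta <= nu / 4 -> 6 * A * p%:R <= 1 / 2 ->
  0 <= kap ->
  (1 + d%:R * (nu * kap)) ^+ p * weight_sum nu K <= weight_sum eta K.
Proof.
move=> e0 e1 Ap kap0; rewrite /weight_sum.
apply: (@le_trans _ _ (\sum_(t in K) f t * expR (6 * nu * A * energy R t) ^+ p)).
  apply: power_mean => [t _|t _||].
  - exact/ltW/lazy_prod_gt0.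
  - exact: expR_ge0.
  - by rewrite addr_ge0 // !mulr_ge0 ?ler0n // ltW.
  - exact: shift_exp_moment.
apply: ler_sum => t _.
have n0 := nu0; have n1 := nu1; have eta14 : 0 <= eta <= 1 / 4 by rewrite e0 /=; lra.
apply: le_trans (prod_lazy_ge _ eta14).
(* The bound on 6 [A] p lets the moment use up at most half of the decay exp(- [nu] energy); the
   other half is below the weight at [eta], since 2 [eta] <= [nu] / 2. *)
apply: (@le_trans _ _ (expR (- (nu * energy R t)) * expR (6 * nu * A * energy R t) ^+ p)).
  apply: ler_wpM2r; first by rewrite exprn_ge0 ?expR_ge0.
  by apply: prod_lazy_le; apply/andP; split; lra.
rewrite -expRM_natl -expRD ler_expR.
have nE : 0 <= nu * energy R t by rewrite mulr_ge0 ?energy_ge0 // ltW.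
have := ler_wpM2r nE Ap; have : eta * energy R t <= nu / 4 * energy R t by rewrite ler_wpM2r ?energy_ge0.
lra.
Qed.

End ShiftGrowth.

(** * Elementary bounds on sine and cosine *)

Section Trigonometry.
Variable R : realType.
Implicit Types x y : R.

Lemma sin_mvt x : 0 <= x -> exists2 c, 0 <= c <= x & sin x = cos c * x.
Proof.
move=> x0.
have [c] := @MVT_segment R (@sin R) (@cos R) 0 x x0 (fun y _ => is_derive_sin y)
  (continuous_subspaceT (@continuous_sin R)).
by rewrite in_itv sin0 !subr0 /=; exists c.
Qed.

Lemma normr_sin_le x : `|sin x| <= `|x|.
Proof.
wlog x0 : x / 0 <= x => [H|].
  by have [/H//|/ltW x0] := lerP 0 x; have := H (- x); rewrite sinN !normrN oppr_ge0; apply.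
have [c _ ->] := sin_mvt x0; rewrite normrM ler_piMl ?normr_ge0 //; exact: cos_max.
Qed.

Lemma cos_half x : 1 - cos x = 2 * sin (x / 2) ^+ 2.
Proof.
have {1}-> : x = (x / 2) *+ 2 by rewrite -mulr_natr; field.
by rewrite cos_mulr2n cos2sin2 -mulr_natr; ring.
Qed.

Lemma sqr_sin_le x : sin x ^+ 2 <= x ^+ 2.
Proof. by rewrite -real_normK ?num_real // -[leRHS]real_normK ?num_real // lerXn2r ?nnegrE ?normr_ge0 ?normr_sin_le. Qed.

Lemma cos_lower x : 1 - cos x <= x ^+ 2 / 2.
Proof. by rewrite cos_half; have := sqr_sin_le (x / 2); lra. Qed.

Lemma sin_sub_sqr x : (x - sin x) ^+ 2 <= x ^+ 6.
Proof.
wlog x0 : x / 0 <= x => [H|].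
  have [/H//|/ltW x0] := lerP 0 x; have := H (- x); rewrite oppr_ge0 sinN => /(_ x0).
  have -> : (- x - - sin x) ^+ 2 = (x - sin x) ^+ 2 by ring.
  by have -> : (- x) ^+ 6 = x ^+ 6 by ring.
have [c /andP[c0 cx] ->] := sin_mvt x0.
have -> : x - cos c * x = (1 - cos c) * x by ring.
have h1 : 0 <= 1 - cos c by rewrite subr_ge0 cos_le1.
have h2 : 1 - cos c <= x ^+ 2.
  by apply: le_trans (cos_lower c) _; nra.
have -> : x ^+ 6 = (x ^+ 2 * x) ^+ 2 by ring.
by rewrite lerXn2r ?nnegrE ?mulr_ge0 ?sqr_ge0 // ler_wpM2r.
Qed.

Lemma cos_upper_small x : `|x| <= 1 / 2 -> x ^+ 2 / 8 <= 1 - cos x.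
Proof.
move=> x1; have s1 := sin_sub_sqr x.
have x2 : x ^+ 2 <= 1 / 4.
  by rewrite -real_normK ?num_real //; have := normr_ge0 x; nra.
have x2' := sqr_ge0 x.
have e6 : x ^+ 6 <= x ^+ 2 * (1 / 16).
  have -> : x ^+ 6 = x ^+ 2 * (x ^+ 2) ^+ 2 by ring.
  apply: ler_wpM2l => //; nra.
have s2 : x ^+ 2 / 4 <= sin x ^+ 2.
  have : x ^+ 2 <= 2 * sin x ^+ 2 + 2 * (x - sin x) ^+ 2.
    by have := sqr_ge0 (sin x - (x - sin x)); nra.
  nra.
have := cos2Dsin2 x; have := cos_le1 x; have := cos_geN1 x.
by move: s2; set u := cos x; set v := sin x ^+ 2 => *; nra.
Qed.

(** Beyond 1/2 monotonicity gives 1 - cos x >= 1/32, while x^2 <= 16; hence the crude constant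
    512. *)
Lemma cos_upper x : `|x| <= pi -> x ^+ 2 / 512 <= 1 - cos x.
Proof.
move=> xpi; have [x1|x1] := lerP `|x| (1 / 2).
  by apply: le_trans (cos_upper_small x1); have := sqr_ge0 x; lra.
have h : 1 / 32 <= 1 - cos (1 / 2 : R).
  apply: le_trans (cos_upper_small _); last by rewrite ger0_norm.
  by rewrite -subr_ge0 [X in 0 <= X](_ : _ = 0) //; field.
have pi4 : pi <= 4 :> R by have := @pihalf_lt2 R; lra.
have c : cos `|x| <= cos (1 / 2).
  have pi2 := @pi_ge2 R.
  rewrite leNgt ltr_cos ?in_itv /= ?normr_ge0 ?xpi ?andbT //; first by rewrite -leNgt ltW.
  by apply/andP; split; lra.
rewrite cos_norm in c; rewrite -real_normK ?num_real //.
have := normr_ge0 x; nra.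
Qed.

End Trigonometry.

(** * Bessel's inequality for nearly orthogonal families *)

Section NearOrthogonal.
Variable R : realType.

Lemma cauchy_schwarz (I : finType) (a b : I -> R) :
  (\sum_i a i * b i) ^+ 2 <= (\sum_i a i ^+ 2) * \sum_i b i ^+ 2.
Proof.
rewrite -subr_ge0 -(pmulr_rge0 _ (ltr0n R 2)).
have -> : 2%:R * ((\sum_i a i ^+ 2) * (\sum_i b i ^+ 2) - (\sum_i a i * b i) ^+ 2) =
   \sum_i \sum_j (a i * b j - a j * b i) ^+ 2.
  have e i j : (a i * b j - a j * b i) ^+ 2 =
     a i ^+ 2 * b j ^+ 2 + b i ^+ 2 * a j ^+ 2 - 2 * (a i * b i) * (a j * b j) by ring.
  under [RHS]eq_bigr => i _.
    under eq_bigr => j _ do rewrite e.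
    rewrite sumrB big_split /= -!mulr_sumr; over.
  rewrite sumrB big_split /= -!mulr_suml -mulr_sumr; ring.
by apply: sumr_ge0 => i _; apply: sumr_ge0 => j _; apply: sqr_ge0.
Qed.

(** Schur's test: absolute row sums of the Gram matrix bound its norm, so the combination z = sum of
    y_l u_l has |z|^2 <= [A] S. Since S is the inner product of b and z, Cauchy-Schwarz finishes. *)
Lemma bessel (d m : nat) (u : 'I_d -> 'I_m -> R) (A : R) : 0 <= A ->
  (forall l, \sum_l' `|\sum_j u l j * u l' j| <= A) ->
  forall b : 'I_m -> R, \sum_l (\sum_j b j * u l j) ^+ 2 <= A * \sum_j b j ^+ 2.
Proof.
move=> A0 H b; pose y l := \sum_j b j * u l j; set S := \sum_l _.
have S0 : 0 <= S by apply: sumr_ge0 => l _; apply: sqr_ge0.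
have B0 : 0 <= \sum_j b j ^+ 2 by apply: sumr_ge0 => l _; apply: sqr_ge0.
pose G l l' := \sum_j u l j * u l' j.
pose z j := \sum_l y l * u l j.
have SE : S = \sum_j b j * z j.
  rewrite /z; under [RHS]eq_bigr do rewrite mulr_sumr.
  rewrite exchange_big; apply: eq_bigr => l _; rewrite expr2 -/(y l) [in LHS]/y mulr_suml.
  by apply: eq_bigr => j _; rewrite -mulrA [u l j * _]mulrC.
have zE : \sum_j z j ^+ 2 <= A * S.
  have -> : \sum_j z j ^+ 2 = \sum_l \sum_l' y l * y l' * G l l'.
    transitivity (\sum_j \sum_l \sum_l' (y l * u l j) * (y l' * u l' j)).
      by apply: eq_bigr => j _; rewrite expr2 /z mulr_suml; apply: eq_bigr => l _; rewrite mulr_sumr.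
    rewrite exchange_big; apply: eq_bigr => l _; rewrite exchange_big; apply: eq_bigr => l' _.
    by rewrite /G mulr_sumr; apply: eq_bigr => j _; ring.
  apply: (@le_trans _ _ (\sum_l \sum_l' (y l ^+ 2 + y l' ^+ 2) / 2 * `|G l l'|)).
    apply: ler_sum => l _; apply: ler_sum => l' _.
    apply: le_trans (ler_norm _) _; rewrite normrM ler_wpM2r ?normr_ge0 // normrM.
    rewrite -[y l ^+ 2]real_normK ?num_real // -[y l' ^+ 2]real_normK ?num_real //.
    by have := sqr_ge0 (`|y l| - `|y l'|); lra.
  have e1 : \sum_l \sum_l' (y l ^+ 2) * `|G l l'| <= A * S.
    rewrite mulr_sumr; apply: ler_sum => l _; rewrite -mulr_sumr mulrC.
    by rewrite ler_wpM2r ?sqr_ge0 // H.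
  have e2 : \sum_l \sum_l' (y l' ^+ 2) * `|G l l'| <= A * S.
    rewrite exchange_big; apply: le_trans e1; apply: ler_sum => l _; apply: ler_sum => l' _.
    by rewrite /G; under eq_bigr do rewrite mulrC.
  have -> : \sum_l \sum_l' (y l ^+ 2 + y l' ^+ 2) / 2 * `|G l l'| =
    (\sum_l \sum_l' (y l ^+ 2) * `|G l l'| + \sum_l \sum_l' (y l' ^+ 2) * `|G l l'|) / 2.
    rewrite -big_split mulr_suml; apply: eq_bigr => l _; rewrite -big_split mulr_suml.
    by apply: eq_bigr => l' _ /=; field.
  lra.
have CS := cauchy_schwarz b z; rewrite -SE in CS.
have [->|Sn] := eqVneq S 0; first exact: mulr_ge0.
have Sp : 0 < S by rewrite lt0r Sn.
rewrite -(ler_pM2r Sp) -expr2; apply: le_trans CS _.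
by rewrite mulrAC [leRHS]mulrC ler_wpM2l.
Qed.

End NearOrthogonal.

Section RankReduction.
Variables (F : fieldType) (L : numFieldType).

Lemma unit_intmx_reduction n (M : 'M[int]_n) :
  map_mx (fun z : int => z%:~R : F) M \in unitmx -> map_mx (fun z : int => z%:~R : L) M \in unitmx.
Proof.
rewrite !unitmxE !det_map_mx !unitfE intr_eq0; apply: contraNneq => ->.
by rewrite rmorph0.
Qed.

(** A maximal minor that is nonzero over [F] is the image of a nonzero integer, hence nonzero over
    [L]. *)
Lemma rank_intmx_reduction a b (M : 'M[int]_(a, b)) :
  (\rank (map_mx (fun z : int => z%:~R : F) M) <= \rank (map_mx (fun z : int => z%:~R : L) M))%N.
Proof.
set A := map_mx _ M; pose f := maxrankfun A.
have fA : row_free (rowsub f A) := maxrowsub_free A.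
have fAT : row_full (rowsub f A)^T by rewrite /row_full mxrank_tr; apply: fA.
pose g := fullrankfun fAT.
have U : rowsub g (rowsub f A)^T \in unitmx by apply: fullrowsub_unit.
have E (K : nzRingType) : map_mx (fun z : int => z%:~R : K) (rowsub g (rowsub f M)^T) =
    rowsub g (rowsub f (map_mx (fun z : int => z%:~R : K) M))^T.
  by apply/matrixP => i j; rewrite !mxE.
have := @unit_intmx_reduction _ (rowsub g (rowsub f M)^T); rewrite !E => /(_ U).
move=> /mxrank_unit e; rewrite -[leqLHS]e.
apply: leq_trans (mxrankS (rowsub_sub _ _)) _; rewrite mxrank_tr.
exact: mxrankS (rowsub_sub _ _).
Qed.

End RankReduction.

Section NearOrthogonalCombinations.
Variable R : realType.

(* Greedy choice: round a real combination of the rows of [X] that is orthogonal to the vectors already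
   chosen and has norm [tau]. *)
Lemma near_orthogonal (d m : nat) (X : 'M[R]_(d, m)) (rho tau : R) : row_free X ->
  (forall i, \sum_j X i j ^+ 2 <= rho ^+ 2) -> 0 <= rho -> 0 < tau -> d%:R * rho <= tau / 4 ->
  forall k, (k <= d)%N -> exists n : 'I_k -> 'I_d -> int,
    let W l j := \sum_i (n l i)%:~R * X i j in
    (forall l, `|\sum_j W l j ^+ 2 - tau ^+ 2| <= 3 * tau * (d%:R * rho)) /\
    (forall l l', l != l' -> `|\sum_j W l j * W l' j| <= 3 * tau * (d%:R * rho)).
Proof.
move=> frX Xrho rho0 tau0 dr; elim=> [|k IH] kd.
  by exists (fun _ _ => 0); split => [[]|[]].
have [n /= [nd no]] := IH (ltnW kd).
pose W l j := \sum_i (n l i)%:~R * X i j.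
rewrite -/W in nd no.
pose B : 'M[R]_(d, k) := X *m (\matrix_(l, j) W l j)^T.
(* Fewer than [d] vectors have been chosen, so some nonzero real combination of the rows of [X] is
   orthogonal to all of them. *)
have kn0 : kermx B != 0.
  rewrite -mxrank_eq0 mxrank_ker -lt0n subn_gt0.
  exact: leq_ltn_trans (rank_leq_col _) kd.
have [v /sub_kermxP vB v0] := rowV0Pn kn0.
pose s := \sum_j (v *m X) 0 j ^+ 2.
have s0 : 0 < s.
  rewrite lt0r; apply/andP; split; last by apply: sumr_ge0 => j _; apply: sqr_ge0.
  apply: contraNneq v0 => /eqP; rewrite psumr_eq0 => [/allP h|j _]; last exact: sqr_ge0.
  rewrite -(mulmx_free_eq0 _ frX); apply/eqP/rowP => j; rewrite [RHS]mxE.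
  by have := h j; rewrite mem_index_enum sqrf_eq0 => /(_ isT)/eqP.
pose c i := tau / Num.sqrt s * v 0 i.
pose x j := \sum_i c i * X i j.
have xE j : x j = tau / Num.sqrt s * (v *m X) 0 j.
  by rewrite mxE mulr_sumr; apply: eq_bigr => i _; rewrite mulrA.
have xn : \sum_j x j ^+ 2 = tau ^+ 2.
  under eq_bigr do rewrite xE exprMn.
  rewrite -mulr_sumr -/s exprMn exprVn sqr_sqrtr ?ltW // -mulrA mulVf ?mulr1 // gt_eqF //.
have xW l : \sum_j x j * W l j = 0.
  have := congr1 (fun M : 'rV[R]_k => M 0 l) vB; rewrite mulmxA !mxE => e.
  under eq_bigr do rewrite xE -mulrA.
  rewrite -mulr_sumr (_ : \sum_i _ = 0) ?mulr0 // -[RHS]e.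
  by apply: eq_bigr => j _; rewrite !mxE.
(* Rounding the coefficients moves the vector by [e], of norm at most [d%:R * rho]. *)
pose z i := Num.floor (c i).
pose e j := \sum_i (c i - (z i)%:~R) * X i j.
have ed i : 0 <= c i - (z i)%:~R <= 1.
  have /andP[h1 h2] := floor_itv (c i); rewrite subr_ge0 h1 /= lerBlDl.
  by rewrite -/(z i) in h2; rewrite -[X in _ <= _ + X]/(1%:~R) -intrD ltW.
have dr0 : 0 <= d%:R * rho by rewrite mulr_ge0.
have en : \sum_j e j ^+ 2 <= (d%:R * rho) ^+ 2.
  apply: (@le_trans _ _ (\sum_j d%:R * \sum_i X i j ^+ 2)).
    apply: ler_sum => j _; apply: le_trans (cauchy_schwarz _ _) _.
    apply: ler_wpM2r; first by apply: sumr_ge0 => i _; apply: sqr_ge0.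
    rewrite -[X in _ <= X%:R]card_ord -sumr_const; apply: ler_sum => i _.
    by have := ed i; move=> /andP[? ?]; rewrite exprn_ile1.
  rewrite -mulr_sumr exchange_big /= exprMn expr2 -mulrA ler_wpM2l //.
  by rewrite mulr_natl -[X in _ *+ X]card_ord -sumr_const; apply: ler_sum.
pose y j := \sum_i (z i)%:~R * X i j.
have yE j : y j = x j - e j.
  by rewrite -sumrB; apply: eq_bigr => i _; rewrite -mulrBl subKr.
have cs (a b : 'I_m -> R) (A2 B2 : R) : 0 <= A2 -> 0 <= B2 ->
   \sum_j a j ^+ 2 <= A2 ^+ 2 -> \sum_j b j ^+ 2 <= B2 ^+ 2 -> `|\sum_j a j * b j| <= A2 * B2.
  move=> A0 B0 hA hB; rewrite -[leRHS]ger0_norm ?mulr_ge0 // -ler_sqr ?nnegrE ?normr_ge0 //.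
  rewrite !real_normK ?num_real // exprMn; apply: le_trans (cauchy_schwarz _ _) _.
  by apply: ler_pM => //; apply: sumr_ge0 => j _; apply: sqr_ge0.
have We l : `|\sum_j y j * W l j| <= 3 * tau * (d%:R * rho).
  have -> : \sum_j y j * W l j = - \sum_j e j * W l j.
    by under eq_bigr do rewrite yE mulrBl; rewrite sumrB xW sub0r.
  rewrite normrN [leRHS]mulrC -[X in _ * X](mulrC tau); apply: cs => //.
    by rewrite mulr_ge0 // ltW.
  by have := nd l; rewrite ler_norml => /andP[_]; nra.
(* The error is at most |e|^2 + 2 [tau] |e|, and |e| <= d [rho] <= [tau] makes this at most 3 [tau]
   d [rho]. *)
have yy : `|\sum_j y j ^+ 2 - tau ^+ 2| <= 3 * tau * (d%:R * rho).
  have -> : \sum_j y j ^+ 2 - tau ^+ 2 = \sum_j e j ^+ 2 - 2 * \sum_j x j * e j.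
    rewrite -xn mulr_sumr -!sumrB; apply: eq_bigr => j _; rewrite yE; ring.
  have := cs x e tau (d%:R * rho) (ltW tau0) dr0; rewrite xn lexx => /(_ isT en).
  have : 0 <= \sum_j e j ^+ 2 by apply: sumr_ge0 => j _; apply: sqr_ge0.
  rewrite !ler_norml => h /andP[h1 h2]; apply/andP; split; nra.
pose nn (l : 'I_k.+1) i := if unlift ord_max l is Some l' then n l' i else z i.
pose W' l j := \sum_i (nn l i)%:~R * X i j.
exists nn; suff : (forall l, `|\sum_j W' l j ^+ 2 - tau ^+ 2| <= 3 * tau * (d%:R * rho)) /\
   (forall l l', l != l' -> `|\sum_j W' l j * W' l' j| <= 3 * tau * (d%:R * rho)) by [].
have W1 l j : W' (lift ord_max l) j = W l j by rewrite /W' /nn liftK.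
have W2 j : W' ord_max j = y j by rewrite /W' /nn unlift_none.
split=> [l|l l'].
  case: (unliftP ord_max l) => [l1|] ->.
    by under eq_bigr do rewrite W1; apply: nd.
  by under eq_bigr do rewrite W2; apply: yy.
case: (unliftP ord_max l) => [l1|] ->; case: (unliftP ord_max l') => [l1'|] -> ll.
- under eq_bigr do rewrite !W1; apply: no.
  by apply: contraNneq ll => ->.
- by under eq_bigr do rewrite W1 W2 mulrC; apply: We.
- by under eq_bigr do rewrite W1 W2; apply: We.
- by rewrite eqxx in ll.
Qed.

End NearOrthogonalCombinations.

(** * From residues modulo q to short real vectors *)

Section ShortVectors.
Variables (R : realType) (q : nat).
Hypothesis q_pr : prime q.
Local Notation F := 'F_q.

(** The representative of least absolute value, so that small energy means a small real vector. *)
Definition ilift (a : F) : int := if (2 * a <= q)%N then (a : nat)%:Z else (a : nat)%:Z - q%:Z.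

Lemma natrF_q : q%:R = 0 :> F.
Proof. by rewrite (@pcharf0 _ q) // pchar_Fp. Qed.

Lemma iliftK a : (ilift a)%:~R = a.
Proof.
rewrite /ilift; case: ifP => _; first by rewrite -pmulrn natr_Zp.
by rewrite intrB -!pmulrn natr_Zp natrF_q subr0.
Qed.

Lemma normr_ilift_le a : `|(ilift a)%:~R| <= q%:R / 2 :> R.
Proof.
have aq := ltn_Fp q_pr a; have q2 : q%:R = 2 * (q%:R / 2) :> R by field.
rewrite /ilift; case: leqP => h.
  by rewrite -pmulrn ger0_norm ?ler0n //; move: h; rewrite -(ler_nat R) natrM; lra.
rewrite intrB -!pmulrn ler0_norm; last by rewrite subr_le0 ler_nat ltnW.
by move: h; rewrite -(ltr_nat R) natrM; lra.
Qed.

Lemma chi_int (z : int) : chi R (z%:~R : F) = expi (2 * pi * z%:~R / q%:R).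
Proof.
have nat_case n : chi R (n%:R : F) = expi (2 * pi * n%:R / q%:R).
  rewrite /chi -[RHS]expi_modn //; congr (expi (_ * _%:R / _)).
  by rewrite val_Fp_nat.
case: z => n; first exact: nat_case.
rewrite NegzE !mulrNz -!pmulrn chiN // nat_case /expi; apply/eqP.
by rewrite eq_complex /= mulrN mulNr cosN sinN !eqxx.
Qed.

End ShortVectors.

Section SubgroupSpace.
Variables (q m : nat).
Hypothesis q_pr : prime q.
Local Notation F := 'F_q.
Variable K : {set 'rV[F]_m}.
Hypothesis sK : subgroup_set K.

Lemma subgroupN x : x \in K -> - x \in K.
Proof. by move=> xK; rewrite -sub0r sK.2 // sK.1. Qed.

Lemma subgroupD x y : x \in K -> y \in K -> x + y \in K.
Proof. by move=> xK yK; rewrite -[y]opprK sK.2 // subgroupN. Qed.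

Lemma subgroup_sum (I : finType) (P : pred I) (f : I -> 'rV[F]_m) :
  (forall i, P i -> f i \in K) -> \sum_(i | P i) f i \in K.
Proof.
move=> H; elim/big_ind: _ => //; first exact: sK.1.
exact: subgroupD.
Qed.

Lemma subgroupZ a x : x \in K -> a *: x \in K.
Proof.
move=> xK; rewrite -[a]natr_Zp scaler_nat.
by elim: (nat_of_ord a) => [|n IH]; rewrite ?mulr0n ?sK.1 // mulrS subgroupD.
Qed.

End SubgroupSpace.

(** The constraints on the scale e in [angle_growth]: enough growth, angles below 1/2, cubic error
    of the sine, the condition 6 A p <= 1/2 of [shift_growth], and e at most 1. *)
Lemma scale_numerics (R : realFieldType) (e : R) : 32 * 64 * e = 1 ->
  [/\ 1 / (50 * 50) <= 17 * 100 * (e * e), 96 * (e * e) <= 1 / 4,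
      96 * 96 * 96 * e * (e * e) <= 1, 12 * 100 * (17 * 100) * (e * e) <= 1 / 2 & e * e <= 1].
Proof.
move=> eE; have -> : e = (32 * 64)^-1 by lra.
split; lra.
Qed.

Section ShortVectorGrowth.
Variables (R : realType) (q m : nat).
Hypothesis q_pr : prime q.
Local Notation F := 'F_q.
Variables (K : {set 'rV[F]_m}).
Hypothesis sK : subgroup_set K.

Let q0 : q%:R != 0 :> R. Proof. by rewrite pnatr_eq0 -lt0n prime_gt0. Qed.

Lemma cc_int (z : int) : cc R (z%:~R : F) = 1 - cos (2 * pi * (z%:~R / q%:R)).
Proof. by rewrite /cc chi_int // mulrA. Qed.

Lemma sn_int (z : int) : sn R (z%:~R : F) = sin (2 * pi * (z%:~R / q%:R)).
Proof. by rewrite /sn chi_int // mulrA. Qed.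

(** The angle is 2 pi x with (2 pi)^2 >= 16, and 512 / 16 = 32. *)
Lemma sqr_ilift_le (a : F) : ((ilift a)%:~R / q%:R) ^+ 2 <= 32 * cc R a :> R.
Proof.
rewrite -{2}[a](iliftK q_pr) cc_int; set x := _ / _.
have p2 := @pi_ge2 R; have p4 : pi <= 4 :> R by have := @pihalf_lt2 R; lra.
have xq : `|x| <= 1 / 2.
  rewrite normrM normfV [`|q%:R|]ger0_norm ?ler0n // ler_pdivrMr ?ltr0n ?prime_gt0 //.
  by have := normr_ilift_le R q_pr a; lra.
have h : (2 * pi * x) ^+ 2 / 512 <= 1 - cos (2 * pi * x).
  apply: cos_upper; rewrite !normrM [`|2|]ger0_norm // [`|pi|]ger0_norm ?pi_ge0 //.
  rewrite normrM in xq; move: xq; set u := _ * _ => xq.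
  have u0 : 0 <= u by rewrite mulr_ge0.
  by nra.
have p22 : 4 <= pi ^+ 2 :> R by nra.
by have := sqr_ge0 x; move: h; rewrite !exprMn; nra.
Qed.

(** This is [shift_growth] with kap = [tau]^2, A = 200 [tau]^2 and p = 1700 d^2, where d [tau] = e.
    The value 200 covers 3/2 times the Bessel constant 128 plus 3 for replacing angles by sines.
    Bernoulli's inequality turns each block of 1700 d factors into one factor 1 + [nu] / 2500. *)
Lemma angle_growth (e : R) (d : nat) (tau nu : R) (w : 'I_d -> 'rV[F]_m) (ph : 'I_d -> 'I_m -> R) (eta : R) :
  (32 * 64) * e = 1 -> (0 < d)%N -> 0 < nu -> nu <= 1 / 4 -> 0 < tau -> d%:R * tau = e ->
  (forall l, w l \in K) ->
  (forall l j, cc R (w l 0 j) = 1 - cos (ph l j)) -> (forall l j, sn R (w l 0 j) = sin (ph l j)) ->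
  (forall l, 8 * tau ^+ 2 <= \sum_j ph l j ^+ 2) -> (forall l, \sum_j ph l j ^+ 2 <= 96 * tau ^+ 2) ->
  (forall b : 'I_m -> R, \sum_l (\sum_j b j * ph l j) ^+ 2 <= 128 * tau ^+ 2 * \sum_j b j ^+ 2) ->
  0 <= eta -> eta <= nu / 4 ->
  (1 + nu / (50 * 50)) ^+ d * weight_sum nu K <= weight_sum eta K.
Proof.
move=> eE d0 nu0 nu1 tau0 dt wK ccw snw phlow phsum besselph eta0 eta1.
have e0 : 0 < e by lra.
have tsq0 : 0 < tau ^+ 2 by rewrite exprn_gt0.
have tsmall : d%:R ^+ 2 * tau ^+ 2 = e * e by rewrite -exprMn dt expr2.
have tau1 : tau ^+ 2 <= e * e.
  by rewrite -tsmall; apply: ler_peMl; [exact: ltW | apply: exprn_ege1; rewrite ler1n].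
have ph1 l j : ph l j ^+ 2 <= 96 * tau ^+ 2.
  by apply: le_trans (phsum l); rewrite (bigD1 j) //= lerDl sumr_ge0 // => j' _; apply: sqr_ge0.
have [N NE] : exists N : nat, N%:R = (17 * 100) :> R by exists (17 * 100)%N; rewrite natrM.
have [gr grE gr0] : exists2 gr : R, gr = nu / (50 * 50) & 0 <= gr.
  by exists (nu / (50 * 50)); [reflexivity | rewrite divr_ge0 ?(ltW nu0) ?mulr_ge0 ?ler0n].
rewrite -grE; pose p := (N * d ^ 2)%N.
have [e1 e2 e3 e4 e5] := scale_numerics eE.
apply: (@le_trans _ _ ((1 + d%:R * (nu * (tau ^+ 2))) ^+ p * weight_sum nu K)).
  apply: ler_wpM2r.
    apply: sumr_ge0 => t _; apply: prodr_ge0 => j _.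
    by have := cc_ge0 R (t 0 j); have := cc_le2 R (t 0 j); move: (cc R _) => c *; nra.
  rewrite /p [X in (N * X)%N]expnS expn1 mulnA exprM.
  apply: lerXn2r; rewrite ?nnegrE.
  - by rewrite addr_ge0.
  - by rewrite exprn_ge0 // addr_ge0 // !mulr_ge0 // ltW.
  set x := d%:R * _.
  have x0 : 0 <= x by rewrite /x !mulr_ge0 // ltW.
  have bern : 1 + (N * d)%:R * x <= (1 + x) ^+ (N * d).
    elim: (N * d)%N => [|k IH]; first by rewrite mul0r addr0 expr0.
    rewrite exprS -natr1; have k0 : 0 <= k%:R * x by rewrite mulr_ge0.
    have := ler_wpM2l (addr_ge0 ler01 x0) IH; move: (_ ^+ _) => *; nra.
  apply: le_trans bern; rewrite lerD2l natrM NE grE.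
  have -> : (17 * 100) * d%:R * x = nu * ((17 * 100) * (d%:R ^+ 2 * tau ^+ 2)) by rewrite /x; ring.
  by rewrite tsmall; have := ler_wpM2l (ltW nu0) e1; lra.
apply: (@shift_growth R q q_pr m d w nu (tau ^+ 2) (200 * tau ^+ 2) K) => //.
- by rewrite mulr_ge0 // ltW.
- move=> l; apply: (@le_trans _ _ (\sum_j ph l j ^+ 2 / 8)).
    by rewrite -mulr_suml ler_pdivlMr // mulrC.
  apply: ler_sum => j _; rewrite ccw; apply: cos_upper_small.
  rewrite -(@ler_sqr R) ?nnegrE ?normr_ge0 ?divr_ge0 // real_normK ?num_real //.
  apply: le_trans (ph1 l j) _; have -> : (1 / 2) ^+ 2 = 1 / 4 :> R by field.
  by apply: le_trans e2; rewrite ler_pM2l // ltr0n.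
- move=> j; apply: (@le_trans _ _ (\sum_l ph l j ^+ 2 / 2)).
    by apply: ler_sum => l _; rewrite ccw; apply: cos_lower.
  have := besselph (fun j' => (j' == j)%:R).
  rewrite [X in _ * X](_ : _ = 1) => [|]; last first.
    rewrite (bigD1 j) //= eqxx expr1n big1 ?addr0 // => j' /negbTE ->.
    by rewrite expr0n.
  rewrite (eq_bigr (fun l => ph l j ^+ 2)) => [|l _]; last first.
    rewrite (bigD1 j) //= eqxx mul1r big1 ?addr0 // => j' /negbTE ->.
    by rewrite mul0r.
  by rewrite -mulr_suml; move: (tau ^+ 2) (\sum_l _) tsq0 => *; lra.
- move=> b; set B := \sum_j b j ^+ 2.
  have B0 : 0 <= B by apply: sumr_ge0 => j _; apply: sqr_ge0.
  apply: (@le_trans _ _ (\sum_l (3 / 2 * (\sum_j b j * ph l j) ^+ 2 + 3 * (\sum_j b j * (ph l j - sin (ph l j))) ^+ 2))).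
    apply: ler_sum => l _; under eq_bigr do rewrite snw.
    have -> : \sum_j b j * sin (ph l j) = \sum_j b j * ph l j - \sum_j b j * (ph l j - sin (ph l j)).
      by rewrite -sumrB; apply: eq_bigr => j _; ring.
    move: (\sum_j b j * ph l j) (\sum_j b j * (_ - _)) => y z.
    by have := sqr_ge0 (y + 2 * z); nra.
  rewrite big_split /= -!mulr_sumr.
  have h1 := besselph b; rewrite -/B in h1.
  have h2 : \sum_l (\sum_j b j * (ph l j - sin (ph l j))) ^+ 2 <= tau ^+ 2 * B.
    apply: (@le_trans _ _ (\sum_(l < d) B * (96 * tau ^+ 2) ^+ 3)).
      apply: ler_sum => l _; apply: le_trans (cauchy_schwarz _ _) _; rewrite -/B.
      apply: ler_wpM2l => //.
      apply: (@le_trans _ _ (\sum_j (96 * tau ^+ 2) ^+ 2 * ph l j ^+ 2)).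
        apply: ler_sum => j _; apply: le_trans (sin_sub_sqr _) _.
        have -> : ph l j ^+ 6 = (ph l j ^+ 2) ^+ 2 * ph l j ^+ 2 by ring.
        by apply: ler_wpM2r; rewrite ?sqr_ge0 // lerXn2r ?nnegrE ?sqr_ge0 ?ph1 // mulr_ge0 // ltW.
      rewrite -mulr_sumr exprS [X in _ <= X]mulrC; apply: ler_wpM2l; last exact: phsum.
      exact: sqr_ge0.
    rewrite sumr_const card_ord -[_ *+ d]mulr_natl.
    have -> : d%:R * (B * (96 * tau ^+ 2) ^+ 3) = tau ^+ 2 * B * (96 * 96 * 96 * (d%:R * tau) * (tau * tau ^+ 2)) by ring.
    have tB : 0 <= tau ^+ 2 * B by rewrite mulr_ge0 // ltW.
    rewrite -[leRHS]mulr1; apply: ler_wpM2l => //.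
    rewrite dt; have t1 : tau <= 1.
      by rewrite -(@ler_sqr R) ?nnegrE ?(ltW tau0) // expr1n (le_trans tau1).
    have k0 : 0 <= 96 * 96 * 96 * e by lra.
    have k1 : tau * tau ^+ 2 <= e * e by rewrite -[leRHS]mul1r; apply: ler_pM => //; exact: ltW.
    exact: le_trans (ler_wpM2l k0 k1) e3.
  have := mulr_ge0 (ltW tsq0) B0; move: h1 h2; move: (\sum_l _) (\sum_l _) => u v.
  by rewrite -!mulrA; move: (tau ^+ 2 * B) => *; lra.
- rewrite /p natrM natrX NE.
  have -> : 6 * (200 * tau ^+ 2) * ((17 * 100) * d%:R ^+ 2) = (12 * 100) * (17 * 100) * (d%:R ^+ 2 * tau ^+ 2) by ring.
  by rewrite tsmall.
- exact: ltW.
Qed.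

Variables (d : nat) (v : 'I_d -> 'rV[F]_m) (nu e : R).
Hypotheses (eE : (32 * 64) * e = 1) (d0 : (0 < d)%N) (nu0 : 0 < nu) (nu1 : nu <= 1 / 4).
Hypothesis v_free : row_free (\matrix_i v i).
Hypothesis vK : forall i, v i \in K.
Hypothesis v_short : forall i, 32 * energy R (v i) <= (e / 8 / d%:R ^+ 3) ^+ 2.

Let X : 'M[R]_(d, m) := \matrix_(i, j) ((ilift (v i 0 j))%:~R / q%:R).
Let rho : R := e / 8 / d%:R ^+ 3.
Let tau : R := e / d%:R.
Let dR0 : 0 < d%:R :> R. Proof. by rewrite ltr0n. Qed.
Let dR1 : 1 <= d%:R :> R. Proof. by rewrite ler1n. Qed.

Lemma lift_free : row_free X.
Proof.
pose T : 'M[int]_(d, m) := \matrix_(i, j) ilift (v i 0 j).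
have E : X = q%:R^-1 *: map_mx (fun z : int => z%:~R : R) T.
  by apply/matrixP => i j; rewrite !mxE mulrC.
have EF : \matrix_i v i = map_mx (fun z : int => z%:~R : F) T.
  by apply/matrixP => i j; rewrite !mxE iliftK.
rewrite E /row_free eqmx_scale ?invr_eq0 // eqn_leq rank_leq_row /=.
apply: leq_trans (rank_intmx_reduction F R T).
by rewrite -EF; move/eqP: v_free => ->.
Qed.

Lemma lift_short i : \sum_j X i j ^+ 2 <= rho ^+ 2.
Proof.
apply: (@le_trans _ _ (32 * energy R (v i))).
  by rewrite mulr_sumr; apply: ler_sum => j _; rewrite mxE sqr_ilift_le.
exact: v_short.
Qed.

(** [rho] is [tau] / (8 d^2), so that d errors 3 [tau] d [rho] in the Gram matrix add up to at most
    [tau]^2 / 2. Multiplication by (2 pi)^2, which lies between 16 and 64, then yields the constants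
    8, 96 and 128 = 96 + 32 of [angle_growth]. *)
Lemma short_vectors_growth (eta : R) : 0 <= eta -> eta <= nu / 4 ->
  (1 + nu / (50 * 50)) ^+ d * weight_sum nu K <= weight_sum eta K.
Proof.
move=> eta0 eta1.
have e0 : 0 < e by have := eE; lra.
have e1 : e * (32 * 64) = 1 by rewrite mulrC.
have rho0 : 0 <= rho by rewrite !divr_ge0 ?exprn_ge0 // ltW.
have tau0 : 0 < tau by rewrite divr_gt0.
have dt : d%:R * tau = e by rewrite /tau mulrCA mulfV ?mulr1 // gt_eqF.
have rt : rho * (8 * d%:R ^+ 2) = tau.
  by rewrite /rho /tau; field; rewrite gt_eqF.
have rt' : d%:R * rho * 8 * d%:R = tau by rewrite -rt; ring.
have drho0 : 0 <= d%:R * rho by rewrite mulr_ge0.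
have drt : d%:R * rho <= tau / 8 by have := ler_wpM2l drho0 dR1; lra.
have [|n /= [nd no]] := @near_orthogonal R d m X rho tau lift_free lift_short rho0 tau0 _ d (leqnn d).
  by lra.
pose W l j := \sum_i (n l i)%:~R * X i j.
rewrite -/W in nd no.
(* The same integer combination is read twice: modulo q it stays in [K], and over the reals it gives
   the angles of its coordinates. *)
pose w l : 'rV[F]_m := \sum_i (n l i)%:~R *: v i.
pose Z l j : int := \sum_i n l i * ilift (v i 0 j).
have wE l j : w l 0 j = (Z l j)%:~R.
  rewrite summxE rmorph_sum; apply: eq_bigr => i _.
  by rewrite mxE rmorphM /= iliftK.
have WE l j : W l j = (Z l j)%:~R / q%:R.
  rewrite rmorph_sum mulr_suml; apply: eq_bigr => i _.
  by rewrite mxE rmorphM /= mulrA.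
pose ph l j := 2 * pi * W l j.
have ccw l j : cc R (w l 0 j) = 1 - cos (ph l j) by rewrite wE cc_int -WE.
have snw l j : sn R (w l 0 j) = sin (ph l j) by rewrite wE sn_int -WE.
have p2 := @pi_ge2 R; have p4 : pi <= 4 :> R by have := @pihalf_lt2 R; lra.
set pp := (2 * pi : R) ^+ 2.
have pp0 : 16 <= pp by rewrite /pp; nra.
have pp1 : pp <= 64 by rewrite /pp; nra.
have phph l l' : \sum_j ph l j * ph l' j = pp * \sum_j W l j * W l' j.
  by rewrite mulr_sumr; apply: eq_bigr => j _; rewrite /ph /pp; ring.
set de := 3 * tau * (d%:R * rho).
have de0 : 0 <= de by rewrite /de !mulr_ge0 // ltW.
have dde : d%:R * de <= tau ^+ 2 / 2.
  have -> : d%:R * de = 3 / 8 * tau * (d%:R * rho * 8 * d%:R) by rewrite /de; field.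
  by rewrite rt' expr2; have := sqr_ge0 tau; lra.
have det : de <= tau ^+ 2 / 2 by apply: le_trans dde; rewrite ler_peMl.
have dW l : tau ^+ 2 / 2 <= \sum_j W l j ^+ 2 <= 3 / 2 * tau ^+ 2.
  by have := nd l; rewrite -/de ler_norml => /andP[h1 h2]; apply/andP; split; lra.
have tsq0 : 0 < tau ^+ 2 by rewrite exprn_gt0.
have gram l : \sum_l' `|\sum_j ph l j * ph l' j| <= 128 * tau ^+ 2.
  rewrite (bigD1 l) //=; apply: (@le_trans _ _ (96 * tau ^+ 2 + \sum_(l' | l' != l) 64 * de)).
    apply: lerD.
      rewrite phph ger0_norm; last first.
        rewrite mulr_ge0 ?sqr_ge0 // sumr_ge0 // => j _; exact: sqr_ge0.
      have /andP[h1 h2] := dW l.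
      under eq_bigr do rewrite -expr2.
      by have := ler_wpM2l (sqr_ge0 (2 * pi : R)) h2; rewrite -/pp; nra.
    apply: ler_sum => l' ll'; rewrite phph normrM ger0_norm ?sqr_ge0 //.
    by apply: ler_pM => //; rewrite ?sqr_ge0 // no // eq_sym.
  have : \sum_(l' < d | l' != l) 64 * de <= \sum_(l' < d) 64 * de.
    by rewrite [leRHS](bigD1 l) //= lerDr mulr_ge0.
  by rewrite [X in _ <= X -> _]sumr_const card_ord -mulr_natl; lra.
have A0 : 0 <= 128 * tau ^+ 2 by rewrite mulr_ge0 // ltW.
have besselph := bessel A0 gram.
have phsum l : \sum_j ph l j ^+ 2 <= 96 * tau ^+ 2.
  under eq_bigr do rewrite expr2.
  rewrite phph; under eq_bigr do rewrite -expr2.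
  have /andP[h1 h2] := dW l.
  by have := ler_wpM2l (sqr_ge0 (2 * pi : R)) h2; rewrite -/pp; nra.
have ph1 l j : ph l j ^+ 2 <= 96 * tau ^+ 2.
  by apply: le_trans (phsum l); rewrite (bigD1 j) //= lerDl sumr_ge0 // => j' _; apply: sqr_ge0.
have tsmall : d%:R ^+ 2 * tau ^+ 2 = e * e by rewrite -exprMn dt expr2.
have tau1 : tau ^+ 2 <= e * e.
  rewrite -tsmall; apply: ler_peMl; [exact: ltW | exact: exprn_ege1].
apply: (@angle_growth e d tau nu w ph) => //.
- by move=> l; apply: subgroup_sum => // i _; apply: subgroupZ.
- move=> l; under eq_bigr do rewrite expr2.
  rewrite phph; under eq_bigr do rewrite -expr2.
  have /andP[h1 h2] := dW l.
  by have := ler_wpM2l (sqr_ge0 (2 * pi : R)) h1; rewrite -/pp => h; apply: le_trans h; rewrite -[leLHS]mul1r; nra.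
Qed.

End ShortVectorGrowth.

(** * Packing: large balls contain many independent short vectors *)

Section Packing.
Variables (R : realType) (q m : nat).
Hypothesis q_pr : prime q.
Local Notation F := 'F_q.

Definition span_set (S : {set 'rV[F]_m}) : 'M[F]_m :=
  span_on (@id 'rV[F]_m) S [ffun t => t] 0.

Lemma span_set_in (S : {set 'rV[F]_m}) t : t \in S -> (t <= span_set S)%MS.
Proof. by move=> /(span_on_in (@id 'rV[F]_m) [ffun t => t] 0); rewrite ffunE. Qed.

Lemma span_set_free (S : {set 'rV[F]_m}) d : (d <= \rank (span_set S))%N ->
  exists v : 'I_d -> 'rV[F]_m, row_free (\matrix_i v i) /\ forall i, v i \in S.
Proof.
move=> dr; have [A [sA eA rA]] := basis_extract (@id 'rV[F]_m) S [ffun t => t] 0.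
rewrite mxrank0 add0n in rA.
have dA : (d <= #|A|)%N by rewrite -rA eA.
pose M : 'M[F]_(#|A|, m) := \matrix_i enum_val i.
have fM : row_free M.
  rewrite /row_free eqn_leq rank_leq_row /= -[leqLHS]rA; apply: mxrankS.
  suff : (span_on id A [ffun t => t] 0 <= genmx M)%MS by rewrite genmxE.
  rewrite span_on_sub sub0mx; apply/forall_inP => t tA; rewrite ffunE genmxE.
  have -> : t = row (enum_rank_in tA t) M by rewrite rowK enum_rankK_in.
  exact: row_sub.
pose w (i : 'I_d) := widen_ord dA i.
exists (fun i => enum_val (w i)); split; last first.
  by move=> i; apply: (subsetP sA); apply: enum_valP.
have -> : \matrix_i enum_val (w i) = rowsub w 1%:M *m M.
  by rewrite mul_rowsub_mx mul1mx; apply/matrixP => i j; rewrite !mxE.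
rewrite /row_free mxrankMfree //; apply/row_freeP; exists (rowsub w 1%:M)^T.
apply/matrixP => i j; rewrite !mxE (bigD1 (w i)) //= big1 => [|k ki].
  by rewrite !mxE eqxx mul1r addr0 eq_sym -!val_eqE.
by rewrite !mxE eq_sym (negbTE ki) mul0r.
Qed.

Lemma geometric_le (B : R) T : 0 < B -> \sum_(a < T) expR (- (a%:R / B)) <= 1 + B.
Proof.
move=> B0; pose r := expR (- B^-1).
have r1 : r * (1 + B) <= B.
  rewrite /r expRN ler_pdivrMl ?expR_gt0 //.
  have := ler_wpM2r (ltW B0) (expR_ge1Dx B^-1).
  by rewrite mulrDl mul1r mulVf ?gt_eqF // addrC.
have r0 : 0 <= r by apply: expR_ge0.
suff H : \sum_(a < T) expR (- (a%:R / B)) <= 1 + B - (1 + B) * r ^+ T.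
  by apply: le_trans H _; rewrite lerBlDr lerDl mulr_ge0 ?exprn_ge0 // addr_ge0 // ltW.
elim: T => [|T IH]; first by rewrite big_ord0 expr0 mulr1 subrr.
rewrite big_ord_recr /=.
have -> : expR (- (T%:R / B)) = r ^+ T by rewrite /r -expRM_natl mulrN.
have := exprn_ge0 T r0; rewrite exprS; nra.
Qed.

(** Exponential moment method: each point has weight at least exp(-m) under the product of the
    weights exp(-|z_j| / B), and the total mass of one coordinate, with both signs, is at most 2 (1
    + B). *)
Lemma card_int_points (I : finType) (P : pred I) (z : I -> 'I_m -> int) (B : R) : 0 < B ->
  {in P &, injective (fun i => [ffun j => z i j])} ->
  (forall i, P i -> \sum_j (absz (z i j))%:R <= m%:R * B) ->
  #|P|%:R <= (2 * expR 1 * (1 + B)) ^+ m.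
Proof.
move=> B0 z_inj zB.
pose T := (\max_i \max_j absz (z i j)).+1.
have zT i j : (absz (z i j) < T)%N.
  by rewrite ltnS; apply: leq_trans (leq_bigmax i); apply: (leq_bigmax (F := fun j => absz (z i j))).
pose co i : {ffun 'I_m -> bool * 'I_T} := [ffun j => (z i j < 0, Ordinal (zT i j))].
have co_inj : {in P &, injective co}.
  move=> i i' Pi Pi' /ffunP e; apply: z_inj => //; apply/ffunP => j; have := e j.
  rewrite !ffunE => -[s /= a].
  by rewrite -[z i j]mulz_sign_abs -[z i' j]mulz_sign_abs s a.
pose g (c : bool * 'I_T) : R := expR (- (c.2%:R / B)).
have -> : #|P|%:R = \sum_(i in P) (1 : R) by rewrite sumr_const.
apply: (@le_trans _ _ (\sum_(i in P) expR m%:R * \prod_j g (co i j))).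
  apply: ler_sum => i iP; rewrite -expR_sum -expRD -[leLHS]expR0 ler_expR sumrN subr_ge0.
  rewrite -mulr_suml ler_pdivrMr //; under eq_bigr do rewrite ffunE /=.
  exact: zB.
rewrite -mulr_sumr; apply: (@le_trans _ _ (expR m%:R * \sum_(c : {ffun 'I_m -> bool * 'I_T}) \prod_j g (c j))).
  apply: ler_wpM2l; first exact: expR_ge0.
  rewrite -(big_imset (fun c : {ffun 'I_m -> bool * 'I_T} => \prod_j g (c j)) (h := co) (A := P)) //=.
  rewrite [leRHS](bigID (mem (co @: P))) /= lerDl sumr_ge0 // => c _.
  by apply: prodr_ge0 => j _; apply: expR_ge0.
rewrite -(bigA_distr_bigA (fun=> g)) /= prodr_const card_ord -[m%:R]mulr1 expRM_natl -exprMn.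
apply: lerXn2r; rewrite ?nnegrE.
- by rewrite mulr_ge0 ?expR_ge0 // sumr_ge0 // => c _; apply: expR_ge0.
- by rewrite !mulr_ge0 ?expR_ge0 // addr_ge0 // ltW.
rewrite [X in _ <= X * _]mulrC -mulrA; apply: ler_wpM2l; first exact: expR_ge0.
rewrite (eq_bigr (fun c : bool * 'I_T => expR (- (c.2%:R / B)))) //.
rewrite -(pair_bigA _ (fun (_ : bool) (a : 'I_T) => expR (- (a%:R / B)))) /= big_bool /=.
by have := geometric_le T B0; lra.
Qed.

(** Round the scaled lifts to integer cells. Two elements of one cell differ by a vector of energy
    at most [e1], so a cell holds at most as many elements as the span of the small ball;
    Cauchy-Schwarz bounds the l1 norm of the cells, and [card_int_points] counts them. *)
Lemma card_ball_le (K : {set 'rV[F]_m}) (s e1 : R) : subgroup_set K -> 0 <= s -> 0 < e1 ->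
  #|ball K s|%:R <= (q ^ \rank (span_set (ball K e1)))%:R *
     (2 * expR 1 * (2 + 64 * Num.sqrt (s / e1))) ^+ m.
Proof.
move=> sK s0 e10; set U := span_set _.
have q0 : 0 < q%:R :> R by rewrite ltr0n prime_gt0.
pose x (t : 'rV[F]_m) j : R := (ilift (t 0 j))%:~R / q%:R.
(* The summand 1 keeps the scale positive when [m] is 0. *)
pose M2 := (32 * m%:R + 1) / e1; pose M := Num.sqrt M2.
have m0 : 0 <= m%:R :> R by [].
have M20 : 0 < M2 by rewrite divr_gt0 // ltr_wpDl // mulr_ge0.
have M0 : 0 < M by rewrite sqrtr_gt0.
have ME : M ^+ 2 = M2 by rewrite sqr_sqrtr // ltW.
pose z t j := Num.floor (x t j * M).
pose zt t := [ffun j => z t j].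
have p4 : pi <= 4 :> R by have := @pihalf_lt2 R; lra.
have p0 : 0 <= pi :> R by apply: pi_ge0.
have close t t' : t \in K -> t' \in K -> zt t = zt t' -> (t - t' <= U)%MS.
  move=> tK tK' /ffunP e; apply: span_set_in; rewrite inE sK.2 //=.
  apply: (@le_trans _ _ (\sum_(j < m) 32 / M2)); last first.
    rewrite sumr_const card_ord -[_ *+ m]mulr_natl /M2 invf_div.
    have d0 : 0 < 32 * m%:R + 1 :> R by rewrite ltr_wpDl // mulr_ge0.
    have -> : m%:R * (32 * (e1 / (32 * m%:R + 1))) = 32 * m%:R * e1 / (32 * m%:R + 1).
      by field; rewrite gt_eqF.
    by rewrite ler_pdivrMr // mulrDr mulr1 [e1 * _]mulrC lerDl ltW.
  apply: ler_sum => j _; rewrite mxE [(- t') _ _]mxE -[t 0 j](iliftK q_pr) -[t' 0 j](iliftK q_pr).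
  rewrite -intrB cc_int //; apply: le_trans (cos_lower _) _.
  set y := _ / q%:R; have yE : y = x t j - x t' j by rewrite /y intrB mulrBl.
  have : (y * M) ^+ 2 <= 1.
    rewrite yE mulrBl -real_normK ?num_real // expr_le1 ?normr_ge0 // ler_norml.
    have := e j; rewrite !ffunE /z => ez.
    have /andP[a1 a2] := floor_itv (x t j * M); have /andP[b1 b2] := floor_itv (x t' j * M).
    rewrite ez intrD in a1 a2; rewrite intrD in b2.
    by apply/andP; split; lra.
  rewrite exprMn ME -ler_pdivlMr // => hy.
  have : (2 * pi) ^+ 2 <= 64 :> R by nra.
  by rewrite exprMn => h1; have := sqr_ge0 y; have := ler_wpM2r (sqr_ge0 y) h1; lra.
have zsum t : t \in ball K s -> \sum_j (absz (z t j))%:R <= m%:R * (1 + 64 * Num.sqrt (s / e1)).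
  rewrite inE => /andP[tK ts].
  apply: (@le_trans _ _ (\sum_(j < m) (1 + M * `|x t j|))).
    apply: ler_sum => j _; rewrite natr_absz intr_norm.
    have /andP[a1 a2] := floor_itv (x t j * M); rewrite intrD in a2.
    have h := normrM (x t j) M; rewrite (gtr0_norm M0) in h.
    have : `|x t j * M| <= M * `|x t j| by rewrite h mulrC.
    by rewrite ler_norml -/(z t j) in a1 a2 * => /andP[b1 b2]; rewrite ler_norml; apply/andP; split; lra.
  rewrite big_split /= sumr_const card_ord mulrDr mulr1 lerD2l -mulr_sumr.
  set S := \sum_(j < m) _.
  have S0 : 0 <= S by apply: sumr_ge0 => j _.
  have S2 : S ^+ 2 <= 32 * s * m%:R.
    have := cauchy_schwarz (fun j => `|x t j|) (fun=> 1).
    under eq_bigr do rewrite mulr1.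
    under [X in _ <= _ * X]eq_bigr do rewrite expr1n.
    rewrite sumr_const card_ord -/S => /le_trans; apply; apply: ler_wpM2r => //.
    apply: (@le_trans _ _ (32 * energy R t)); last by rewrite ler_wpM2l.
    rewrite mulr_sumr; apply: ler_sum => j _; rewrite real_normK ?num_real //.
    exact: sqr_ilift_le.
  rewrite -(@ler_sqr R) ?nnegrE ?mulr_ge0 ?sqrtr_ge0 ?(ltW M0) //.
  rewrite !exprMn ME sqr_sqrtr ?divr_ge0 // ?(ltW e10) //.
  apply: (@le_trans _ _ (M2 * (32 * s * m%:R))); first by rewrite ler_wpM2l // ltW.
  rewrite /M2 mulrAC [leRHS]mulrA [leRHS]mulrA ler_pM2r ?invr_gt0 //.
  have mm : m%:R <= m%:R ^+ 2 :> R by rewrite -natrX ler_nat; case: (m) => // k; rewrite expnS expn1 leq_pmull.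
  have sm : 0 <= s * m%:R by rewrite mulr_ge0.
  have smm : s * m%:R <= s * m%:R ^+ 2 by rewrite ler_wpM2l.
  by have := mulr_ge0 s0 (sqr_ge0 m%:R : 0 <= m%:R ^+ 2 :> R); lra.
pose Bl := ball K s.
pose rep t := odflt t [pick t' in Bl | zt t' == zt t].
have repP t : t \in Bl -> rep t \in Bl /\ zt (rep t) = zt t.
  move=> tB; rewrite /rep; case: pickP => [t' /andP[? /eqP]|/(_ t)] //=.
have rep_eq t t' : t \in Bl -> t' \in Bl -> zt t = zt t' -> rep t = rep t'.
  move=> tB tB' e; rewrite /rep.
  rewrite (eq_pick (Q := fun u => (u \in Bl) && (zt u == zt t'))) => [|u]; last by rewrite /= e.
  by case: pickP => // /(_ t'); rewrite tB' eqxx.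
have inK t : t \in Bl -> t \in K by rewrite inE => /andP[].
pose P := rep @: Bl.
have -> : #|ball K s|%:R = \sum_(p in P) #|[set t in Bl | rep t == p]|%:R :> R.
  rewrite -natr_sum; congr _%:R; rewrite -sum1_card (partition_big rep (mem P)) /=.
    by apply: eq_bigr => p _; rewrite -sum1_card; apply: eq_bigl => t; rewrite inE.
  by move=> t tB; apply: imset_f.
apply: (@le_trans _ _ (\sum_(p in P) (q ^ \rank U)%:R)).
  apply: ler_sum => p /imsetP[t0 t0B ->]; rewrite ler_nat.
  rewrite -[q in (q ^ _)%N](card_Fp q_pr) -card_rowg.
  rewrite -(card_imset _ (@addIr _ (- rep t0))); apply: subset_leq_card.
  apply/subsetP => y /imsetP[t]; rewrite inE => /andP[tB /eqP et] ->.
  have [r1 r2] := repP _ t0B; have [r3 r4] := repP _ tB.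
  by rewrite inE; apply: close; rewrite ?inK // -et r4.
rewrite sumr_const -[_ *+ _]mulr_natr; apply: ler_wpM2l; first exact: ler0n.
have -> : 2 + 64 * Num.sqrt (s / e1) = 1 + (1 + 64 * Num.sqrt (s / e1)) by rewrite addrA.
apply: (@card_int_points _ (mem P) z) => [|t t'|t].
- by rewrite ltr_wpDr // mulr_ge0 ?sqrtr_ge0.
- move=> /imsetP[t0 t0B ->] /imsetP[t1 t1B ->] e.
  have [_ r2] := repP _ t0B; have [_ r4] := repP _ t1B.
  by apply: rep_eq => //; rewrite -r2 -r4.
- by move=> /imsetP[t0 t0B ->]; apply: zsum; have [] := repP _ t0B.
Qed.

Lemma weight_sum_ge0 (mu : R) (K : {set 'rV[F]_m}) : 0 <= mu <= 1 / 4 -> 0 <= weight_sum mu K.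
Proof.
move=> mu14; apply: sumr_ge0 => t _; apply: le_trans (prod_lazy_ge _ mu14); exact: expR_ge0.
Qed.

(** Beyond the radius, [nu] energy exceeds 4 d, and half of it already gives exp(-2 d) times the
    weight at [eta]. If the weight at [eta] is less than exp(d) times the one at [nu], the far part
    is at most half of the total. *)
Lemma ball_carries_mass (K : {set 'rV[F]_m}) (nu eta : R) (d : nat) :
  (0 < d)%N -> 0 < nu -> nu <= 1 / 4 -> 0 <= eta -> eta <= nu / 4 ->
  weight_sum eta K < (1 + nu / (50 * 50)) ^+ d * weight_sum nu K ->
  weight_sum nu K <= 2 * #|ball K (4 * d%:R / nu)|%:R.
Proof.
move=> d0 nu0 nu1 eta0 eta1; set s := 4 * d%:R / nu; set Z := weight_sum nu K => lt.
have nu14 : 0 <= nu <= 1 / 4 by apply/andP; split; lra.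
have nu12 : 0 <= nu <= 1 / 2 by apply/andP; split; lra.
have eta14 : 0 <= eta <= 1 / 4 by apply/andP; split; lra.
have Z0 : 0 <= Z := weight_sum_ge0 K nu14.
have nus : nu * s = 4 * d%:R by rewrite /s mulrC divfK // gt_eqF.
have far : \sum_(t in K | ~~ (energy R t <= s)) \prod_j (1 - nu * cc R (t 0 j)) <= expR (- (2 * d%:R)) * weight_sum eta K.
  rewrite mulr_sumr [leRHS](bigID (fun t => energy R t <= s)) /= -[leLHS]add0r; apply: lerD.
    apply: sumr_ge0 => t _; rewrite mulr_ge0 ?expR_ge0 //.
    by apply: le_trans (prod_lazy_ge _ eta14); apply: expR_ge0.
  apply: ler_sum => t /andP[_]; rewrite -ltNge => st.
  apply: le_trans (prod_lazy_le _ nu12) _.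
  apply: le_trans (ler_wpM2l (expR_ge0 _) (prod_lazy_ge _ eta14)).
  rewrite -expRD ler_expR.
  have E0 := energy_ge0 R t; have h1 := ler_wpM2r E0 eta1.
  by have := ler_wpM2l (ltW nu0) (ltW st); rewrite nus; lra.
have near : \sum_(t in K | energy R t <= s) \prod_j (1 - nu * cc R (t 0 j)) <= #|ball K s|%:R.
  rewrite -sum1_card natr_sum big_mkcond [leRHS]big_mkcond; apply: ler_sum => t _.
  rewrite inE; case: ifP => // _.
  apply: le_trans (prod_lazy_le _ nu12) _.
  by rewrite -[leRHS]expR0 ler_expR oppr_le0 mulr_ge0 ?energy_ge0 // ltW.
have g1 : 1 + nu / (50 * 50) <= expR 1 by have := expR_ge1Dx (1 : R); lra.
have g0 : 0 <= 1 + nu / (50 * 50) by lra.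
have G : expR (- (2 * d%:R)) * (1 + nu / (50 * 50)) ^+ d <= 1 / 2.
  apply: (@le_trans _ _ (expR (- (2 * d%:R)) * expR 1 ^+ d)).
    by apply: ler_wpM2l; [exact: expR_ge0 | rewrite lerXn2r ?nnegrE ?expR_ge0].
  rewrite -expRM_natl -expRD mulr1.
  have -> : - (2 * d%:R) + d%:R = - d%:R :> R by ring.
  rewrite expRN -[leLHS]mul1r ler_pdivrMr ?expR_gt0 //.
  have := expR_ge1Dx (d%:R : R); have : 1 <= d%:R :> R by rewrite ler1n.
  by move: (expR _) => *; lra.
have ZE : Z = \sum_(t in K | energy R t <= s) \prod_j (1 - nu * cc R (t 0 j)) +
  \sum_(t in K | ~~ (energy R t <= s)) \prod_j (1 - nu * cc R (t 0 j)).
  by rewrite /Z /weight_sum (bigID (fun t => energy R t <= s)).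
have h1 := ler_wpM2l (expR_ge0 (- (2 * d%:R) : R)) (ltW lt).
have h2 := ler_wpM2r Z0 G; rewrite mulrA in h1.
have := le_trans far (le_trans h1 h2); rewrite ZE in near *.
move: near; set u := (\sum_(t in K | energy R t <= s) _); set v := (\sum_(t in K | ~~ _) _).
by move: u v => u v; lra.
Qed.

(* If the weight does not grow, a ball of small energy carries half of it; by packing, this ball contains
   [d] independent vectors short enough for [short_vectors_growth]. *)
Lemma dense_growth (K : {set 'rV[F]_m}) (nu eta e : R) (d : nat) :
  subgroup_set K -> 32 * 64 * e = 1 -> (0 < d)%N -> 0 < nu -> nu <= 1 / 4 ->
  0 <= eta -> eta <= nu / 4 ->
  2 * (q ^ d)%:R * (2 * expR 1 * (2 + 64 * Num.sqrt ((4 * d%:R / nu) / ((e / 8 / d%:R ^+ 3) ^+ 2 / 32)))) ^+ m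
    < weight_sum nu K ->
  (1 + nu / (50 * 50)) ^+ d * weight_sum nu K <= weight_sum eta K.
Proof.
move=> sK eE d0 nu0 nu1 eta0 eta1.
have e0 : 0 < e by lra.
set s := 4 * d%:R / nu; set e1 := _ / 32; set P := 2 * expR 1 * _ => ZP.
have dR : 0 < d%:R :> R by rewrite ltr0n.
have e10 : 0 < e1 by rewrite divr_gt0 // exprn_gt0 // !divr_gt0 // exprn_gt0.
have s0 : 0 <= s by rewrite divr_ge0 ?(ltW nu0) // mulr_ge0.
have P0 : 0 <= P by rewrite !mulr_ge0 ?expR_ge0 // addr_ge0 // mulr_ge0 ?sqrtr_ge0.
have := card_ball_le sK s0 e10; set r := \rank _; rewrite -/P => cb.
have [rd|dr] := ltnP r d; last first.
  have [v [fv vS]] := span_set_free dr.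
  apply: (@short_vectors_growth R q m q_pr K sK d v nu e) => // i.
    by have := vS i; rewrite inE => /andP[].
  have := vS i; rewrite inE => /andP[_]; rewrite /e1 ler_pdivlMr ?ltr0n // [leLHS]mulrC //.
rewrite leNgt; apply/negP => /(ball_carries_mass d0 nu0 nu1 eta0 eta1).
move=> h; move: ZP; rewrite ltNge => /negP; apply; apply: le_trans h _; rewrite -[leRHS]mulrA ler_wpM2l // -/s.
apply: le_trans cb _; apply: ler_wpM2r; first exact: exprn_ge0.
by rewrite ler_nat leq_pexp2l ?prime_gt0 // ltnW.
Qed.

End Packing.

(** * Annihilators with small support *)

Section Transposition.
Variables (R : realFieldType) (E A B : finType) (w : E -> R).

Definition transp (x : {ffun A -> {ffun B -> E}}) : {ffun B -> {ffun A -> E}} :=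
  [ffun b => [ffun a => x a b]].

Lemma pw_transp (G : {ffun B -> {ffun A -> E}} -> R) :
  \sum_(x : {ffun A -> {ffun B -> E}}) pw (pw w (T := B)) x * G (transp x) =
  \sum_(c : {ffun B -> {ffun A -> E}}) pw (pw w (T := A)) c * G c.
Proof.
rewrite [RHS](reindex transp) /=.
  apply: eq_bigr => x _; congr (_ * _); rewrite /pw exchange_big /=.
  by apply: eq_bigr => b _; apply: eq_bigr => a _; rewrite !ffunE.
exists (fun c : {ffun B -> {ffun A -> E}} => [ffun a => [ffun b => c b a]]) => [x _|c _].
  by apply/ffunP => a; apply/ffunP => b; rewrite !ffunE.
by apply/ffunP => a; apply/ffunP => b; rewrite !ffunE.
Qed.

End Transposition.

Section Supports.
Variables (R : realType) (q m : nat).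
Hypothesis q_pr : prime q.
Local Notation F := 'F_q.
Local Notation tv := (fun e : 'I_3 => (tern e)%:~R : F).

Definition supp (D : {set 'rV[F]_m}) : {set 'I_m} := [set j | [exists t in D, t 0 j != 0]].

(** For [j] in the support the character t -> chi(t_j) is nontrivial on [D], so [cc] of this
    coordinate has mean exactly 1 over [D]. The support is therefore no larger than the mean
    energy. *)
Lemma card_supp_le (D : {set 'rV[F]_m}) (s : R) : subgroup_set D ->
  (forall t, t \in D -> energy R t <= s) -> #|supp D|%:R <= s.
Proof.
move=> sD Ds.
have D0 : 0 < #|D|%:R :> R by rewrite ltr0n; apply/card_gt0P; exists 0; exact: sD.1.
have col j : j \in supp D -> \sum_(t in D) cc R (t 0 j) = #|D|%:R.
  rewrite inE => /exists_inP[t0 t0D t0j].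
  have dj t : dot t (delta_mx 0 j) = t 0 j.
    rewrite /dot (bigD1 j) //= big1 ?addr0 ?mxE ?eqxx ?mulr1 // => i /negbTE ij.
    by rewrite mxE ij andbF mulr0.
  have := @chi_orthogonal R q q_pr m D (delta_mx 0 j) sD.
  have -> : [forall t in D, dot t (delta_mx 0 j) == 0] = false.
    by apply/negbTE/forall_inPn; exists t0; rewrite ?dj.
  rewrite mulr0 => /(congr1 (@complex.Re R)) /= e.
  under eq_bigr do rewrite /cc.
  rewrite sumrB sumr_const -[X in _ - X = _](_ : complex.Re (\sum_(t in D) chi R (dot t (delta_mx 0 j))) = _).
    by rewrite e subr0.
  by rewrite raddf_sum; apply: eq_bigr => t _; rewrite dj.
rewrite -(ler_pM2r D0).
apply: (@le_trans _ _ (\sum_(t in D) energy R t)); last first.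
  by rewrite mulr_natr -sumr_const; apply: ler_sum.
rewrite exchange_big /= [leRHS](bigID (mem (supp D))) /= (eq_bigr _ col).
rewrite sumr_const -[_ *+ #|supp D|]mulr_natl -[X in X <= _]addr0 lerD ?lexx //.
by apply: sumr_ge0 => j _; apply: sumr_ge0 => t _; apply: cc_ge0.
Qed.

Lemma card_span_set (D : {set 'rV[F]_m}) : (#|D| <= q ^ \rank (span_set D))%N.
Proof.
rewrite -[q in (q ^ _)%N](card_Fp q_pr) -card_rowg; apply: subset_leq_card.
by apply/subsetP => t tD; rewrite inE span_set_in.
Qed.

(** Elements of [D] are linear relations among the columns of [x] indexed by the support. They span
    more than [e] dimensions, because [D] has more than q^e elements, and each dimension lowers the
    rank of these columns by one. *)
Lemma kernel_support N (x : {ffun 'I_N -> {ffun 'I_m -> 'I_3}}) (D : {set 'rV[F]_m}) e :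
  D \subset annihilator (span_on (@vec_of F _ tv m) [set: 'I_N] x 0) ->
  (q ^ e < #|D|)%N ->
  (\rank (span_on (@vec_of F _ tv N) (supp D) (transp x) 0) + e.+1 <= #|supp D|)%N.
Proof.
move=> DK De; set c := transp x; set I0 := supp D.
pose A : 'M[F]_(#|I0|, m) := \matrix_i delta_mx 0 (enum_val i).
pose Ht : 'M[F]_(m, N) := \matrix_j vec_of tv (c j).
apply: leq_trans (rank_leq_row A); rewrite -(mxrank_mul_ker A Ht); apply: leq_add.
  apply: mxrankS; suff : (span_on (vec_of tv (m:=N)) I0 c 0 <= genmx (A *m Ht))%MS by rewrite genmxE.
  rewrite span_on_sub sub0mx; apply/forall_inP => j jI; rewrite genmxE.
  have -> : vec_of tv (c j) = row (enum_rank_in jI j) (A *m Ht).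
    by rewrite row_mul rowK enum_rankK_in // -rowE rowK.
  exact: row_sub.
apply: (@leq_trans (\rank (span_set D))).
  have := leq_trans De (card_span_set D).
  by rewrite ltn_exp2l ?prime_gt1.
apply: mxrankS; suff : (span_set D <= genmx (A :&: kermx Ht))%MS by rewrite genmxE.
rewrite span_on_sub sub0mx; apply/forall_inP => t tD; rewrite ffunE genmxE sub_capmx.
apply/andP; split.
  have -> : t = t *m A^T *m A; last exact: submxMl.
  apply/rowP => j; rewrite !mxE; have [jI|jI] := boolP (j \in I0).
    rewrite (bigD1 (enum_rank_in jI j)) //= big1 ?addr0 => [|i ij].
      rewrite !mxE enum_rankK_in // !eqxx mulr1 (bigD1 j) //= big1 ?addr0 => [|k kj].
        by rewrite !mxE enum_rankK_in // !eqxx mulr1.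
      by rewrite !mxE enum_rankK_in // (negbTE kj) andbF mulr0.
    rewrite !mxE; case: (j =P enum_val i) => [e1|]; rewrite ?andbF ?mulr0 //.
    by case/negP: ij; apply/eqP/enum_val_inj; rewrite enum_rankK_in.
  rewrite big1 => [|i _].
    by apply/eqP; apply: contraNT jI => tj; rewrite inE; apply/exists_inP; exists t.
  rewrite !mxE; case: (j =P enum_val i) => [e1|]; rewrite ?andbF ?mulr0 //.
  by case/negP: jI; rewrite e1 enum_valP.
apply/sub_kermxP/rowP => i; rewrite [RHS]mxE.
have := subsetP DK _ tD; rewrite inE => /eqP tK.
have xi : (vec_of tv (x i) <= span_on (@vec_of F _ tv m) [set: 'I_N] x 0)%MS by apply: span_on_in; rewrite inE.
have [C eC] := submxP xi.
have : vec_of tv (x i) *m t^T = 0 by rewrite eC -mulmxA tK mulmx0.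
move=> /matrixP/(_ 0 0); rewrite [X in X = _ -> _]mxE [X in _ = X -> _]mxE => e0.
rewrite mxE; apply: etrans e0.
by apply: eq_bigr => j _; rewrite !mxE !ffunE mulrC.
Qed.

(** Union bound over the small sets [I0]. The sum of 2^|J| over sets with at most [s] elements is
    bounded by weighting J with y^(|J| - s) >= 1, which makes it a binomial product. *)
Lemma sparse_deficiency_bound N (w : 'I_3 -> R) (al y : R) (s d : nat) :
  injective tv -> (forall e, 0 <= w e) -> \sum_e w e = 1 -> (forall e, w e <= al) ->
  0 <= al <= 1 -> 0 < y <= 1 -> (s <= N)%N ->
  \sum_(x : {ffun 'I_N -> {ffun 'I_m -> 'I_3}}) pw (pw w (T := 'I_m)) x *
    [exists I0 : {set 'I_m}, (#|I0| <= s)%N &&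
       (\rank (span_on (@vec_of F _ tv N) I0 (transp x) 0) + d <= #|I0|)%N]%:R
  <= al ^+ ((N - s) * d) * ((1 + 2 * y) ^+ m * y^-1 ^+ s).
Proof.
move=> tvi w0 w1 wal /andP[al0 al1] /andP[y0 y1] sN.
pose ev (I0 : {set 'I_m}) (c : {ffun 'I_m -> {ffun 'I_N -> 'I_3}}) : R :=
  (\rank (span_on (@vec_of F _ tv N) I0 c 0) + d <= #|I0|)%N%:R.
apply: (@le_trans _ _ (\sum_(x : {ffun 'I_N -> {ffun 'I_m -> 'I_3}}) \sum_(I0 : {set 'I_m} | (#|I0| <= s)%N)
   pw (pw w (T := 'I_m)) x * ev I0 (transp x))).
  apply: ler_sum => x _; rewrite -mulr_sumr; apply: ler_wpM2l.
    by apply: pw_ge0 => o; apply: pw_ge0.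
  case: existsP => [[I0 /andP[sI dI]]|_]; last by apply: sumr_ge0 => I0 _; apply: ler0n.
  rewrite (bigD1 I0) //= {1}/ev dI lerDl; apply: sumr_ge0 => I _; exact: ler0n.
rewrite exchange_big /=.
apply: (@le_trans _ _ (\sum_(I0 : {set 'I_m} | (#|I0| <= s)%N) 2 ^+ #|I0| * al ^+ ((N - s) * d))).
  apply: ler_sum => I0 sI; rewrite pw_transp.
  apply: le_trans (rank_deficient_subset _ _ al0 al1 _ _ _) _.
  - by move=> o; apply: pw_ge0.
  - exact: sum_pw.
  - move=> V; exact: (hit_le_expn w0 w1 tvi wal).
  apply: ler_wpM2l; first exact: exprn_ge0.
  by apply: ler_wiXn2l => //; rewrite leq_mul2r leq_sub2l ?orbT.
rewrite -mulr_suml mulrC; apply: ler_wpM2l; first exact: exprn_ge0.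
have yi : 1 <= y^-1 by rewrite invf_ge1.
have -> : (1 + 2 * y) ^+ m = \sum_(J : {set 'I_m}) (2 * y) ^+ #|J|.
  rewrite -[m in LHS]card_ord -prodr_const.
  transitivity (\prod_(i : 'I_m) ((fun=> 2 * y) i + (fun=> 1) i)); first by apply: eq_bigr => i _; rewrite addrC.
  rewrite bigA_distr /=; apply: eq_bigr => J _.
  by rewrite -big_mkcond /= prodr_const.
rewrite mulr_suml big_mkcond; apply: ler_sum => J _; case: ifP => sJ; last first.
  by rewrite mulr_ge0 ?exprn_ge0 ?mulr_ge0 // ?ltW // invr_gt0.
rewrite exprMn -mulrA ler_peMr ?exprn_ge0 //.
rewrite -(subnKC sJ) exprD mulrA -exprMn mulfV ?gt_eqF // expr1n mul1r.
exact: exprn_ege1.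
Qed.

End Supports.

(** * Rank deficiency of a lazy bipartite matrix *)

Lemma bin_le_expn n e : ('C(n, e) <= n ^ e)%N.
Proof.
elim: e n => [|e IH] [|n]; rewrite ?bin0 //.
have := mul_bin_diag n.+1 e; rewrite /= => h.
apply: (@leq_trans (e.+1 * 'C(n.+1, e.+1))); first by rewrite leq_pmull.
rewrite -h expnS leq_mul2l /=; apply: leq_trans (IH n) _.
by case: (e) => // e'; rewrite leq_exp2r.
Qed.

Lemma bin_le_exp2n n e : ('C(n, e) <= 2 ^ n)%N.
Proof.
have [en|ne] := leqP e n; last by rewrite bin_small.
rewrite -[2%N]/(1 + 1)%N expnDn; under eq_bigr do rewrite !exp1n !muln1.
have ei : (e < n.+1)%N by [].
by rewrite (bigD1 (Ordinal ei)) //= leq_addr.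
Qed.

Section Levels.
Variables (R : realType) (q m N : nat).
Hypothesis q_pr : prime q.
Local Notation F := 'F_q.
Local Notation tv := (fun e : 'I_3 => (tern e)%:~R : F).
Local Notation O := {ffun 'I_m -> 'I_3}.
Local Notation rv := (@vec_of F _ tv m).
Local Notation lw mu := (pw (lazy mu) (T := 'I_m)).
Local Notation sp x := (span_on rv [set: 'I_N] x 0).
Local Notation prob mu ev := (\sum_(x : {ffun 'I_N -> O}) pw (lw mu) x * (ev x : bool)%:R).

(* An upper bound for the probability that a lazy or Bernoulli vector is orthogonal to [t]. *)
Definition line_hit (mu : R) (t : 'rV[F]_m) : R :=
  (\sum_a \prod_j (1 - mu * cc R (a * t 0 j))) / q%:R.

Definition structured (mu ga : R) (V : 'M[F]_m) : bool :=
  [exists t in annihilator V, (t != 0) && (ga <= line_hit mu t)].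

Definition bad (mu ga : R) (V : 'M[F]_m) : bool :=
  (4 < m - \rank V)%N || (0 < m - \rank V)%N && structured mu ga V.

Variables (nu eta : R).
Hypotheses (nu0 : 0 < nu) (nu1 : nu <= 1 / 4) (eta0 : 0 < eta) (eta1 : eta <= nu / 4).
Hypotheses (q9 : (9 < q)%N) (mN : (m <= N)%N) (Nq : (N <= q)%N).

Let nu01 : 0 <= nu <= 1. Proof. by apply/andP; have := nu0; have := nu1; split; lra. Qed.
Let eta01 : 0 <= eta <= 1. Proof. by apply/andP; have := eta0; have := eta1; have := nu1; split; lra. Qed.
Let nu14 : 0 <= nu <= 1 / 4. Proof. by apply/andP; have := nu0; have := nu1; split; lra. Qed.
Let lnu0 o : 0 <= lw nu o. Proof. by apply: pw_ge0 => e; apply: lazy_ge0. Qed.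
Let leta0 o : 0 <= lw eta o. Proof. by apply: pw_ge0 => e; apply: lazy_ge0. Qed.
Let lnu_sum : \sum_o lw nu o = 1. Proof. by apply: sum_pw; apply: lazy_sum. Qed.
Let leta_sum : \sum_o lw eta o = 1. Proof. by apply: sum_pw; apply: lazy_sum. Qed.
Let qR : 9 < q%:R :> R. Proof. by rewrite ltr_nat. Qed.
Let q_gt0 : 0 < q%:R :> R. Proof. by rewrite ltr0n prime_gt0. Qed.

Lemma tern_inj : injective tv.
Proof.
have q3 : (2 < q)%N by apply: leq_trans q9.
have n2 : (2%:R != 0 :> F) by rewrite -(dvdn_pcharf (pchar_Fp q_pr)) gtnNdvd.
have n1 : (1 != 0 :> F) by rewrite oner_eq0.
have nm1 : (-1 != 1 :> F) by rewrite -subr_eq0 -opprD oppr_eq0 -[1 + 1]/(2%:R).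
have nm0 : (-1 != 0 :> F) by rewrite oppr_eq0.
move=> a b; apply: contra_eq => ab.
case: a ab => [[|[|[|//]]] ia]; case: b => [[|[|[|//]]] ib] // ab; rewrite /tern /= ?mulrNz ?mulr1z //; rewrite eq_sym ?oppr_eq0 //.
Qed.

Lemma hit_le_lazy (mu : R) (V : 'M[F]_m) : 0 <= mu <= 1 / 2 -> hit rv (lw mu) V <= (1 - mu) ^+ (m - \rank V).
Proof.
move=> /andP[m0 m1]; apply: hit_le_expn.
- by move=> e; apply: lazy_ge0; rewrite m0 /=; lra.
- exact: lazy_sum.
- exact: tern_inj.
- by move=> e; apply: lazy_le; rewrite m0.
Qed.

(** The exchange with [r = 0]: after a basis is chosen, the N - d other rows cost q^-4 each, and the
    choice of the basis costs at most N^(N - d) <= q^(N - d). The remaining q^(-3 (N - d)) suffices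
    because the corank is at least 5. *)
Lemma spread_level d : (d + 5 <= m)%N ->
  prob nu (fun x => (\rank (sp x) == d) && (hit rv (lw nu) <<sp x>>%MS <= (q%:R ^+ 4)^-1))
  <= (q%:R ^+ (2 * (m - d) + 4))^-1.
Proof.
move=> dm.
have dN : (d <= N)%N by rewrite (leq_trans _ mN) // (leq_trans _ dm) // leq_addr.
have e3 : (2 * (m - d) + 4 <= 3 * (N - d))%N.
  have : (m - d <= N - d)%N by rewrite leq_sub2r.
  have : (5 <= m - d)%N by rewrite leq_subRL ?(leq_trans _ dm) ?leq_addr // addnC.
  by move: (m - d)%N (N - d)%N => a b; clear; lia.
pose be : R := ((q%:R ^+ 4)^-1) ^+ (N - d).
have be0 : 0 <= be by rewrite exprn_ge0 // invr_ge0 exprn_ge0.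
apply: le_trans (@exchange_bound R F m _ rv _ (lw eta) lnu0 leta0 lnu_sum leta_sum N 0 d
  (fun V => hit rv (lw nu) V <= (q%:R ^+ 4)^-1) be be0 (leq0n _) _) _.
  move=> V rV; rewrite (hit_eqmx _ _ (genmxE V)) => hV.
  have fh : 1 <= free_hit rv (lw eta) 0 V.
    by rewrite -(expr0 (hit rv (lw eta) V - 0)); apply: free_hit_ge => //; apply: hit_ge0.
  split; first exact: lt_le_trans fh.
  rewrite subn0 -[leLHS]mulr1; apply: ler_pM => //; first by rewrite exprn_ge0 // hit_ge0.
  by rewrite lerXn2r ?nnegrE ?hit_ge0 ?invr_ge0 ?exprn_ge0.
rewrite subn0 -bin_sub //; set e := (N - d)%N in be be0 e3 *.
apply: (@le_trans _ _ (q%:R ^+ e * be)).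
  apply: ler_wpM2r => //; rewrite -natrX ler_nat; apply: leq_trans (bin_le_expn _ _) _.
  by case: (e) => // e'; rewrite leq_exp2r.
have q1 : 1 <= q%:R :> R by rewrite ler1n prime_gt0.
have -> : q%:R ^+ e * be = (q%:R ^+ (3 * e))^-1.
  rewrite /be -exprMn exprS invfM mulrA mulfV ?gt_eqF // mul1r.
  by rewrite exprVn -exprM.
rewrite lef_pV2 ?posrE ?exprn_gt0 //.
exact: ler_weXn2l.
Qed.

(** Each of the [r] exchanged rows gains 1 / L and loses a factor 2 for avoiding the span of the
    earlier ones; [Hr] makes that span negligible against a hit probability above q^-4. *)
Lemma growth_level r d (L : R) : 1 <= L -> (d <= m)%N ->
  2 * (1 - eta) ^+ (m - r) <= (q%:R ^+ 4)^-1 ->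
  prob nu (fun x => (\rank (sp x) == d) && (((q%:R ^+ 4)^-1 < hit rv (lw nu) <<sp x>>%MS) &&
    (L * hit rv (lw nu) <<sp x>>%MS <= hit rv (lw eta) <<sp x>>%MS)))
  <= 2 ^+ N * (2 / L) ^+ r.
Proof.
move=> L1 dm Hr; have L0 : 0 < L by apply: lt_le_trans L1.
have be0 : 0 <= (2 / L) ^+ r by rewrite exprn_ge0 // divr_ge0 // ltW.
have q4 : 0 < (q%:R ^+ 4)^-1 :> R by rewrite invr_gt0 exprn_gt0.
have eta12 : 0 <= eta <= 1 / 2 by have := eta0; have := eta1; have := nu1; move=> *; apply/andP; split; lra.
have nu12 : 0 <= nu <= 1 / 2 by have := nu0; have := nu1; move=> *; apply/andP; split; lra.
have x0 : 0 <= 1 - eta by have := eta01; rewrite subr_ge0 => /andP[].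
have x1 : 1 - eta <= 1 by have := eta0; rewrite lerBlDr lerDl => /ltW.
have [rd|dr] := leqP r d; last first.
  (* For d < r the event is empty: a space of such small rank is hit with probability at most (1 -
     [eta])^(m - r), which is below q^-4. *)
  rewrite big1 => [|x _]; first by rewrite mulr_ge0 // exprn_ge0.
  case: andP => [[/eqP rx /andP[hx _]]|_]; last by rewrite mulr0.
  move: hx; rewrite (hit_eqmx _ _ (genmxE _)) ltNge => /negP; case.
  apply: le_trans (hit_le_lazy _ nu12) _; rewrite rx.
  apply: le_trans Hr; apply: (@le_trans _ _ ((1 - eta) ^+ (m - d))).
    have n0 : 0 <= 1 - nu by rewrite subr_ge0; have /andP[] := nu01.
    have ne : 1 - nu <= 1 - eta by have := eta1; have := nu0; move=> *; lra.
    by apply: lerXn2r; rewrite ?nnegrE.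
  apply: (@le_trans _ _ ((1 - eta) ^+ (m - r))); first by apply: ler_wiXn2l => //; rewrite leq_sub2l // ltnW.
  by rewrite ler_peMl ?exprn_ge0 // ler1n.
apply: le_trans (@exchange_bound R F m _ rv _ (lw eta) lnu0 leta0 lnu_sum leta_sum N r d
  (fun V => ((q%:R ^+ 4)^-1 < hit rv (lw nu) V) && (L * hit rv (lw nu) V <= hit rv (lw eta) V)) _ be0 rd _) _.
  move=> V rV; rewrite !(hit_eqmx _ _ (genmxE V)) => /andP[hV LV].
  set h := hit rv (lw nu) V in hV LV *; set h' := hit rv (lw eta) V in LV *.
  have h0 : 0 < h by apply: lt_trans hV.
  have h1 : h <= 1.
    by rewrite /h -lnu_sum /hit [leRHS](bigID (fun o => (rv o <= V)%MS)) /= lerDl sumr_ge0.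
  have hh' : h <= h' by apply: le_trans LV; rewrite ler_peMl // ltW.
  have fh : (h' / 2) ^+ r <= free_hit rv (lw eta) r V.
    apply: le_trans (_ : (h' - (1 - eta) ^+ (m - r)) ^+ r <= _).
      have : 2 * (1 - eta) ^+ (m - r) <= h' by apply: le_trans Hr _; apply: le_trans (ltW hV) _.
      set u := _ ^+ (m - r) => u2.
      by apply: lerXn2r; rewrite ?nnegrE; lra.
    apply: (free_hit_ge leta0 leta_sum) => [U rU|].
      apply: le_trans (hit_le_lazy _ eta12) _; apply: ler_wiXn2l => //.
      by rewrite leq_sub2l // ltnW.
    have : 2 * (1 - eta) ^+ (m - r) <= h' by apply: le_trans Hr _; apply: le_trans (ltW hV) _.
    by move=> h2; apply: le_trans h2; rewrite ler_peMl ?exprn_ge0 // ler1n.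
  have h'0 : 0 < h' by apply: lt_le_trans h0 hh'.
  split; first by apply: lt_le_trans fh; rewrite exprn_gt0 // divr_gt0.
  apply: (@le_trans _ _ (h ^+ r)).
    by apply: ler_wiXn2l => //; [exact: ltW | rewrite leq_subRL; [rewrite subnK // (leq_trans dm) | rewrite (leq_trans (leq_subr _ _)) // (leq_trans dm)]].
  apply: le_trans (ler_wpM2l be0 fh); rewrite -exprMn; apply: lerXn2r; rewrite ?nnegrE.
  - exact: ltW.
  - by rewrite mulr_ge0 // divr_ge0 // ltW.
  have -> : 2 / L * (h' / 2) = L^-1 * h' by field; rewrite gt_eqF.
  by rewrite ler_pdivlMl.
apply: ler_wpM2r => //; rewrite -natrX ler_nat.
exact: bin_le_exp2n.
Qed.

Local Notation wsum mu V := (weight_sum mu (annihilator V)).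

Lemma line_le_weight_sum (t : 'rV[F]_m) (V : 'M[F]_m) : t \in annihilator V -> t != 0 ->
  q%:R * line_hit nu t <= wsum nu V.
Proof.
move=> tV t0; rewrite /line_hit mulrC divfK ?gt_eqF //.
have inj : injective (fun a : F => a *: t).
  by move=> a b /eqP; rewrite -subr_eq0 -scalerBl scaler_eq0 (negbTE t0) orbF subr_eq0 => /eqP.
have -> : \sum_a \prod_j (1 - nu * cc R (a * t 0 j)) =
  \sum_(u in [set a *: t | a in F]) \prod_j (1 - nu * cc R (u 0 j)).
  rewrite big_imset /=; last by move=> a b _ _; apply: inj.
  by apply: eq_big => [a|a _]; [rewrite inE | apply: eq_bigr => j _; rewrite mxE].
have sub : [set a *: t | a in F] \subset annihilator V.
  by apply/subsetP => u /imsetP[a _ ->]; apply: subgroupZ => //; apply: annihilator_subgroup.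
rewrite /weight_sum [leRHS](bigID (mem [set a *: t | a in F])) /= -[leLHS]addr0; apply: lerD.
  rewrite [leRHS](eq_bigl (mem [set a *: t | a in F])) ?lexx // => u; rewrite /= -in_setI.
  by rewrite (setIidPr sub).
by apply: sumr_ge0 => u _; apply: le_trans (prod_lazy_ge _ nu14); apply: expR_ge0.
Qed.

Variable ga : R.
Hypothesis ga3 : 3 < q%:R * ga.

Lemma hitE (mu : R) (V : 'M[F]_m) : hit rv (lw mu) V = wsum mu V / q%:R ^+ (m - \rank V).
Proof.
by rewrite -hit_weight_sum // natrX mulfK // expf_neq0 // gt_eqF.
Qed.

(** The weight sum is q^k times the hit probability, k being the corank. For k > 4 it exceeds q^(k -
    4), and q > 3. For k <= 4 the truncated exponent k - 5 is 0, and the line through a structured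
    vector alone weighs more than 3. *)
Lemma bad_weight (V : 'M[F]_m) : bad nu ga V ->
  ((4 < m - \rank V)%N -> (q%:R ^+ 4)^-1 < hit rv (lw nu) V) ->
  (q%:R ^+ 4)^-1 < hit rv (lw nu) V /\ 3 * q%:R ^+ (m - \rank V - 5) < wsum nu V.
Proof.
rewrite /bad hitE; set k := (m - \rank V)%N; set Z := wsum nu V => bV hk.
have qk n : 0 < q%:R ^+ n :> R by rewrite exprn_gt0.
have q1 : 1 <= q%:R :> R by rewrite ler1n prime_gt0.
have [k5|k5] := ltnP 4 k.
  split; first exact: hk.
  have qE : q%:R ^+ k = q%:R ^+ (k - 5) * q%:R * q%:R ^+ 4 :> R.
    by rewrite -mulrA -exprS -exprD subnK.
  have := hk k5; rewrite ltr_pdivlMr // mulrC qE mulfK ?gt_eqF // => h.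
  apply: le_lt_trans h; rewrite mulrC ler_wpM2l ?exprn_ge0 ?ltW //.
  by apply: lt_trans qR; rewrite ltr_nat.
move: bV; rewrite ltnNge k5 /= => /andP[k0 /existsP[t /and3P[tV t0 tg]]].
have Z3 : 3 < Z.
  apply: lt_le_trans ga3 _; apply: le_trans (line_le_weight_sum tV t0).
  by rewrite ler_wpM2l // ltW.
split.
  rewrite ltr_pdivlMr // mulrC ltr_pdivrMr //.
  apply: (@le_lt_trans _ _ (q%:R ^+ 4)); first exact: ler_weXn2l.
  by rewrite ltr_pMl //; apply: lt_trans Z3; rewrite ltr1n.
have -> : (k - 5 = 0)%N by apply/eqP; rewrite subn_eq0 (leq_trans k5).
by rewrite expr0 mulr1.
Qed.

(** A hit probability above q^-4 says that the annihilator has at most q^4 times its weight sum many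
    elements, which is La = 4 ln q in [growth_or_subgroup]; the factor 3 in the hypothesis pays for
    the one in its conclusion. *)
Lemma growth_dichotomy (V : 'M[F]_m) j : eta = nu / 4 ^+ j.+1 ->
  (q%:R ^+ 4)^-1 < hit rv (lw nu) V -> 3 * q%:R ^+ (m - \rank V - 5) < wsum nu V ->
  (3 / 2) ^+ j / 6 * hit rv (lw nu) V <= hit rv (lw eta) V \/
  exists D : {set 'rV[F]_m}, [/\ subgroup_set D, D \subset annihilator V,
    (q ^ (m - \rank V - 5) < #|D|)%N &
    forall t, t \in D -> energy R t <= 4 ^+ j * ((2 * (4 * ln q%:R) + 5) / nu)].
Proof.
move=> etaE; rewrite !hitE; set k := (m - \rank V)%N; set Z := wsum nu V => hV Z3.
have qk n : 0 < q%:R ^+ n :> R by rewrite exprn_gt0.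
have Z0 : 0 < Z by apply: lt_trans Z3; rewrite mulr_gt0.
have [|||[D [sD DK ZD De]]] := @growth_or_subgroup R q q_pr m (annihilator V) nu eta (4 * ln q%:R) j (annihilator_subgroup V) _ etaE Z0.
- by rewrite nu0 nu1.
- rewrite card_annihilator // -/k natrX expRM_natl lnK ?posrE // -/Z.
  by move: hV; rewrite ltr_pdivlMr // mulrC ltr_pdivrMr // => /ltW; rewrite [Z * _]mulrC.
- by move=> g; left; rewrite mulrA ler_pM2r ?invr_gt0.
right; exists D; split=> //.
by rewrite -(ltr_nat R) natrX -(ltr_pM2l (ltr0n R 3)); apply: lt_le_trans ZD.
Qed.

(** One term for each alternative: a row space that is rarely hit, a gain by the lazier law, or a
    subgroup of small energy in the annihilator, whose small support forces deficient columns. *)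
Lemma level_small j r s y d : eta = nu / 4 ^+ j.+1 -> (d < m)%N ->
  2 * (1 - eta) ^+ (m - r) <= (q%:R ^+ 4)^-1 -> 1 <= (3 / 2 : R) ^+ j / 6 ->
  0 < y <= 1 -> (s <= N)%N -> 4 ^+ j * ((2 * (4 * ln q%:R) + 5) / nu) <= s%:R ->
  prob nu (fun x => (\rank (sp x) == d) && bad nu ga (sp x)) <=
    (q%:R ^+ (2 * (m - d) + 4))^-1 + 2 ^+ N * (2 / ((3 / 2) ^+ j / 6)) ^+ r +
    (1 - nu) ^+ ((N - s) * (m - d - 5).+1) * ((1 + 2 * y) ^+ m * y^-1 ^+ s).
Proof.
move=> etaE dm Hr L1 y01 sN Hs; set L := _ / 6 in L1 *.
have nu12 : 0 <= nu <= 1 / 2 by have := nu0; have := nu1; move=> *; apply/andP; split; lra.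
pose ev1 x := (4 < m - d)%N && ((\rank (sp x) == d) && (hit rv (lw nu) <<sp x>>%MS <= (q%:R ^+ 4)^-1)).
pose ev2 x := (\rank (sp x) == d) && (((q%:R ^+ 4)^-1 < hit rv (lw nu) <<sp x>>%MS) &&
    (L * hit rv (lw nu) <<sp x>>%MS <= hit rv (lw eta) <<sp x>>%MS)).
pose ev3 x := [exists I0 : {set 'I_m}, (#|I0| <= s)%N &&
       (\rank (span_on (@vec_of F _ tv N) I0 (transp x) 0) + (m - d - 5).+1 <= #|I0|)%N].
apply: (@le_trans _ _ (prob nu ev1 + prob nu ev2 + prob nu ev3)); last first.
  apply: lerD; last first.
    apply: sparse_deficiency_bound => //.
    - exact: tern_inj.
    - by move=> e; apply: lazy_ge0.
    - exact: lazy_sum.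
    - by move=> e; apply: lazy_le.
    - by have := nu01; rewrite subr_ge0 lerBlDr lerDl andbC.
  apply: lerD; last by apply: growth_level => //; apply: ltnW.
  rewrite /ev1; case: ltnP => [k5|_] /=.
    by apply: spread_level; rewrite -leq_subRL // ltnW.
  rewrite big1 ?invr_ge0 ?exprn_ge0 // => x _; exact: mulr0.
rewrite -!big_split /=; apply: ler_sum => x _; rewrite -!mulrDr; apply: ler_wpM2l.
  exact: pw_ge0.
case: andP => [[/eqP rx bx]|_]; last by rewrite addr_ge0 // addr_ge0.
have gx := hit_eqmx _ _ (genmxE (sp x)).
have [k5|k5] := boolP ((4 < m - d)%N && (hit rv (lw nu) (sp x) <= (q%:R ^+ 4)^-1)).
  have -> : ev1 x by rewrite /ev1 rx eqxx gx; case/andP: k5 => -> ->.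
  by rewrite -addrA lerDl addr_ge0.
have [|h1 h2] := @bad_weight (sp x) bx.
  by rewrite rx => k4; move: k5; rewrite k4 /= -ltNge.
have [g|[D [sD DK De Den]]] := growth_dichotomy etaE h1 h2.
  have -> : ev2 x by rewrite /ev2 rx eqxx !gx h1 g.
  by rewrite addrAC lerDr addr_ge0.
have -> : ev3 x.
  apply/existsP; exists (supp D); rewrite rx in De; rewrite (kernel_support q_pr DK De) andbT.
  by rewrite -(ler_nat R); apply: le_trans Hs; apply: card_supp_le.
by rewrite lerDr addr_ge0.
Qed.

(** For large corank a hit probability above q^-4 alone makes the weight sum exceed the packing
    threshold of [dense_growth], so the lazier law gains and no sparse alternative remains. *)
Lemma level_large dg r d e : (d + 5 <= m)%N -> (0 < dg)%N -> 32 * 64 * e = 1 ->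
  2 * (1 - eta) ^+ (m - r) <= (q%:R ^+ 4)^-1 ->
  2 * (q ^ dg)%:R * (2 * expR 1 * (2 + 64 * Num.sqrt ((4 * dg%:R / nu) / ((e / 8 / dg%:R ^+ 3) ^+ 2 / 32)))) ^+ m
    < q%:R ^+ (m - d - 4) ->
  prob nu (fun x => (\rank (sp x) == d) && bad nu ga (sp x)) <=
    (q%:R ^+ (2 * (m - d) + 4))^-1 + 2 ^+ N * (2 / (1 + nu / (50 * 50)) ^+ dg) ^+ r.
Proof.
move=> dm dg0 eE Hr HP; set L := _ ^+ dg.
have L1 : 1 <= L by apply: exprn_ege1; rewrite lerDl divr_ge0 ?(ltW nu0) ?mulr_ge0 ?ler0n.
pose ev1 x := (\rank (sp x) == d) && (hit rv (lw nu) <<sp x>>%MS <= (q%:R ^+ 4)^-1).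
pose ev2 x := (\rank (sp x) == d) && (((q%:R ^+ 4)^-1 < hit rv (lw nu) <<sp x>>%MS) &&
    (L * hit rv (lw nu) <<sp x>>%MS <= hit rv (lw eta) <<sp x>>%MS)).
apply: (@le_trans _ _ (prob nu ev1 + prob nu ev2)); last first.
  apply: lerD; first exact: spread_level.
  by apply: growth_level => //; apply: leq_trans dm; apply: leq_addr.
rewrite -big_split /=; apply: ler_sum => x _; rewrite -mulrDr; apply: ler_wpM2l.
  exact: pw_ge0.
case: andP => [[/eqP rx bx]|_]; last by rewrite addr_ge0.
have gx := hit_eqmx _ _ (genmxE (sp x)).
rewrite /ev1 /ev2 rx eqxx !gx /=; case: lerP => [_|h1] /=; first by rewrite addr0.
suff -> : L * hit rv (lw nu) (sp x) <= hit rv (lw eta) (sp x) by rewrite add0r.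
have qk n : 0 < q%:R ^+ n :> R by rewrite exprn_gt0.
rewrite !hitE mulrA ler_pM2r ?invr_gt0 //.
apply: (dense_growth q_pr (annihilator_subgroup _) eE) => //; first exact: ltW.
apply: lt_trans HP _; move: h1; rewrite hitE rx ltr_pdivlMr // => h1.
apply: le_lt_trans h1; rewrite mulrC ler_pdivlMr // -exprD.
by rewrite subnK // leq_subRL // (leq_trans _ dm) // ?leq_add2l // leq_addr.
Qed.

End Levels.

(** * Numerical estimates behind the choice of constants *)

Lemma level_exponent k : (0 < k)%N -> (2 * k + 4 <= 6 * k)%N.
Proof. lia. Qed.

Lemma fifth_le k : (k <= (k - 5).+1 * 5)%N.
Proof. lia. Qed.

Lemma quarter_ge m : (20 <= m)%N -> (m <= m %/ 4 * 5)%N.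
Proof. lia. Qed.

Lemma quarter_le m : (m <= (m - m %/ 4) * 2)%N.
Proof. lia. Qed.

Section Numerics.
Variable R : realType.
Implicit Types nu u X : R.

Lemma poly_le_exp (A : R) : 0 <= A -> exists2 C : R, 1 <= C &
  forall X, C <= X -> A * X ^+ 7 <= expR (X / 4).
Proof.
move=> A0; exists (1 + A * 32 ^+ 8) => [|X CX].
  by rewrite lerDl mulr_ge0 // exprn_ge0.
have p32 : 0 < 32 ^+ 8 :> R by rewrite exprn_gt0.
have X0 : 0 < X by apply: lt_le_trans CX; rewrite ltr_pwDl // mulr_ge0 // exprn_ge0.
have -> : X / 4 = 8 * (X / 32) by field.
rewrite expRM_natl; apply: (@le_trans _ _ ((X / 32) ^+ 8)); last first.
  apply: lerXn2r; rewrite ?nnegrE ?expR_ge0 ?divr_ge0 ?(ltW X0) //.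
  by apply: le_trans (expR_ge1Dx _); rewrite lerDr.
rewrite expr_div_n ler_pdivlMr // mulrAC exprS [leRHS]mulrC [leLHS]mulrC.
apply: ler_wpM2l; first by rewrite exprn_ge0 // ltW.
by apply: le_trans CX; rewrite lerDr.
Qed.

Lemma geometric_unbounded (B : R) : exists j, B <= (3 / 2) ^+ j / 6.
Proof.
have [j hj] : exists j : nat, 12 * B <= j%:R by exists (Num.truncn (`|12 * B|)).+1; apply/ltW/(le_lt_trans (ler_norm _))/truncnS_gt.
exists j; rewrite ler_pdivlMr //.
have : 1 + j%:R / 2 <= (3 / 2) ^+ j :> R.
  elim: (j) => [|i IH]; first by rewrite mul0r addr0 expr0.
  by rewrite exprS -natr1; have : 0 <= i%:R :> R by []; lra.
lra.
Qed.

(** Since r >= m / 5, the gain exp(r (10 + 30 X)) covers 2^N <= exp(2 m) together with (2 k + 4) u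
    <= 6 k u <= 6 X m. *)
Lemma growth_numeric (m N k r : nat) (L X u : R) : (N <= m.+1)%N -> (0 < m)%N -> (0 < k)%N -> 0 <= u -> 0 <= X ->
  m%:R / 5 <= r%:R :> R -> k%:R * u <= X * m%:R -> 2 * expR (10 + 30 * X) <= L ->
  2 ^+ N * (2 / L) ^+ r <= expR (- ((2 * k + 4)%:R * u)).
Proof.
move=> Nm m0 k0 u0 X0 rm ku HL.
have E0 : 0 < expR (10 + 30 * X) := expR_gt0 _.
have L0 : 0 < L by apply: lt_le_trans HL; rewrite mulr_gt0.
have e2 : 2 <= expR 1 :> R by have := expR_ge1Dx (1 : R); lra.
have h1 : 2 ^+ N <= expR (2 * m%:R) :> R.
  apply: (@le_trans _ _ (expR 1 ^+ N)); first by rewrite lerXn2r ?nnegrE ?expR_ge0.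
  rewrite -expRM_natl mulr1 ler_expR -natrM ler_nat; apply: leq_trans Nm _.
  by rewrite mul2n -addnn -addn1 leq_add2l.
have h2 : (2 / L) ^+ r <= expR (- (r%:R * (10 + 30 * X))).
  rewrite -mulrN expRM_natl; apply: lerXn2r; rewrite ?nnegrE ?expR_ge0 ?divr_ge0 ?(ltW L0) //.
  by rewrite expRN ler_pdivrMr // ler_pdivlMl // mulrC.
have h3 : (2 * k + 4)%:R * u <= 6 * (X * m%:R).
  apply: (@le_trans _ _ (6 * (k%:R * u))); last by rewrite ler_wpM2l.
  rewrite mulrA; apply: ler_wpM2r => //; rewrite -natrM ler_nat; exact: level_exponent.
apply: (@le_trans _ _ (expR (2 * m%:R) * expR (- (r%:R * (10 + 30 * X))))).
  by apply: ler_pM => //; rewrite exprn_ge0 // divr_ge0 // ltW.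
rewrite -expRD ler_expR.
have h4 : 0 <= 10 + 30 * X by lra.
by have := ler_wpM2r h4 rm; lra.
Qed.

(** The deficiency gives exp(-[nu] m k / 10). One half of it pays for the two entropy factors
    exp([nu] m / 40), the other half for (2 k + 4) u. *)
Lemma sparse_numeric (m N s k : nat) (nu sg u : R) : 0 < nu -> nu <= 1 / 4 ->
  (m <= N)%N -> (0 < k)%N -> 0 <= u ->
  s%:R <= sg * m%:R -> sg <= 1 / 2 -> sg * ln ((nu / 80)^-1) <= nu / 40 ->
  u <= nu / 120 * m%:R ->
  (1 - nu) ^+ ((N - s) * (k - 5).+1) * ((1 + 2 * (nu / 80)) ^+ m * (nu / 80)^-1 ^+ s)
    <= expR (- ((2 * k + 4)%:R * u)).
Proof.
move=> nu0 nu1 mN k0 u0 sm sg1 sgl um.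
have m0 : 0 <= m%:R :> R by [].
have y0 : 0 < nu / 80 by rewrite divr_gt0.
have l0 : 0 <= ln ((nu / 80)^-1) by rewrite ln_ge0 // invf_ge1 //; lra.
have h1 : (1 - nu) ^+ ((N - s) * (k - 5).+1) <= expR (- (nu * (m%:R * k%:R / 10))).
  apply: (@le_trans _ _ (expR (- nu) ^+ ((N - s) * (k - 5).+1))).
    by apply: lerXn2r; rewrite ?nnegrE ?expR_ge0 ?subr_ge0 ?expR_ge1Dx //; lra.
  rewrite -expRM_natl ler_expR mulrN lerN2 [leRHS]mulrC; apply: ler_wpM2l; first exact: ltW.
  have s2 : s%:R <= m%:R / 2 :> R by apply: le_trans sm _; have := ler_wpM2r m0 sg1; lra.
  have sN : (s <= N)%N by apply: leq_trans mN; rewrite -(ler_nat R); lra.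
  have a1 : m%:R / 2 <= (N - s)%:R :> R.
    rewrite natrB //; have : m%:R <= N%:R :> R by rewrite ler_nat.
    by move: s2; move: (s%:R) (N%:R) (m%:R) => *; lra.
  have a2 : k%:R / 5 <= (k - 5).+1%:R :> R.
    by rewrite ler_pdivrMr // -natrM ler_nat; exact: fifth_le.
  rewrite natrM; apply: le_trans (ler_pM _ _ a1 a2); rewrite ?divr_ge0 //.
  by rewrite [leLHS](_ : _ = m%:R / 2 * (k%:R / 5)) //; field.
have h2 : (1 + 2 * (nu / 80)) ^+ m <= expR (nu / 40 * m%:R).
  rewrite [nu / 40 * _]mulrC expRM_natl; apply: lerXn2r; rewrite ?nnegrE ?expR_ge0 //; first lra.
  by apply: le_trans (expR_ge1Dx _); lra.
have h3 : (nu / 80)^-1 ^+ s <= expR (nu / 40 * m%:R).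
  rewrite -{1}[(nu / 80)^-1]lnK ?posrE ?invr_gt0 // -expRM_natl ler_expR.
  have a := ler_wpM2r l0 sm; have b := ler_wpM2r m0 sgl.
  by apply: le_trans a _; rewrite mulrAC.
apply: (@le_trans _ _ (expR (- (nu * (m%:R * k%:R / 10))) * (expR (nu / 40 * m%:R) * expR (nu / 40 * m%:R)))).
  apply: ler_pM => //.
  - by apply: exprn_ge0; lra.
  - by rewrite mulr_ge0 // exprn_ge0 ?invr_ge0 ?(ltW y0) //; lra.
  - by apply: ler_pM => //; rewrite exprn_ge0 ?invr_ge0 ?(ltW y0) //; lra.
rewrite -!expRD ler_expR.
have k1 : 1 <= k%:R :> R by rewrite ler1n.
have h4 : (2 * k + 4)%:R * u <= 6 * k%:R * (nu / 120 * m%:R).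
  apply: (@le_trans _ _ (6 * k%:R * u)); last by rewrite ler_wpM2l // mulr_ge0.
  by apply: ler_wpM2r => //; rewrite -natrM ler_nat; exact: level_exponent.
have h5 : nu * m%:R <= nu * m%:R * k%:R by rewrite ler_peMr // mulr_ge0 // ltW.
lra.
Qed.

Lemma odlyzko_numeric (m r : nat) (eta u th : R) : 0 < eta -> eta <= 1 / 2 -> (r <= m)%N ->
  m%:R / 2 <= (m - r)%:R :> R -> u <= 3 * th * m%:R -> 12 * th <= eta / 4 -> 4 <= eta * m%:R ->
  2 * (1 - eta) ^+ (m - r) <= expR (- (4 * u)).
Proof.
move=> e0 e1 rm mr um th1 em.
have m0 : 0 <= m%:R :> R by [].
have h1 : (1 - eta) ^+ (m - r) <= expR (- (eta * (m%:R / 2))).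
  apply: (@le_trans _ _ (expR (- eta) ^+ (m - r))).
    by apply: lerXn2r; rewrite ?nnegrE ?expR_ge0 ?subr_ge0 ?expR_ge1Dx //; lra.
  by rewrite -expRM_natl ler_expR mulrN lerN2 [leRHS]mulrC; apply: ler_wpM2l mr; exact: ltW.
have h2 : 2 <= expR (eta * m%:R / 4).
  by apply: le_trans (expR_ge1Dx _); lra.
apply: (@le_trans _ _ (expR (eta * m%:R / 4) * expR (- (eta * (m%:R / 2))))).
  by apply: ler_pM => //; apply: exprn_ge0; lra.
rewrite -expRD ler_expR.
by have := ler_wpM2r m0 th1; lra.
Qed.

Lemma one_plus_ge_exp (w : R) : 0 <= w <= 1 / 2 -> expR w <= 1 + 2 * w.
Proof.
move=> /andP[w0 w1]; rewrite -[w in expR w]opprK expRN.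
have h : 1 - w <= expR (- w) := expR_ge1Dx _.
apply: (@le_trans _ _ (1 - w)^-1); first by rewrite lef_pV2 ?posrE ?expR_gt0 //; lra.
by rewrite -[leLHS]mul1r ler_pdivrMr; [nra | lra].
Qed.

(** The quotient under the root is a constant times dg^7 and is at least 1, so the root is bounded
    by its argument. *)
Lemma packing_numeric nu (e : R) : 0 < nu -> nu <= 1 / 4 -> 0 < e -> e <= 1 -> exists2 A, 0 <= A &
  forall dg : nat, (0 < dg)%N ->
  2 * expR 1 * (2 + 64 * Num.sqrt ((4 * dg%:R / nu) / ((e / 8 / dg%:R ^+ 3) ^+ 2 / 32))) <= A * dg%:R ^+ 7.
Proof.
move=> nu0 nu1 e0 e1; pose T := 4 * 32 * 64 / (nu * e ^+ 2).
have T0 : 0 <= T by rewrite divr_ge0 // mulr_ge0 ?sqr_ge0 // ltW.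
exists (2 * expR 1 * (2 + 64 * T)) => [|dg dg0].
  by rewrite !mulr_ge0 ?expR_ge0 // addr_ge0 // mulr_ge0.
have d1 : 1 <= dg%:R ^+ 7 :> R by rewrite exprn_ege1 // ler1n.
have dn : dg%:R != 0 :> R by rewrite pnatr_eq0 -lt0n.
have -> : (4 * dg%:R / nu) / ((e / 8 / dg%:R ^+ 3) ^+ 2 / 32) = T * dg%:R ^+ 7.
  by rewrite /T; field; rewrite dn !gt_eqF.
rewrite -[leRHS]mulrA; apply: ler_wpM2l; first by rewrite mulr_ge0 ?expR_ge0.
have T1 : 1 <= T.
  rewrite ler_pdivlMr ?mulr_gt0 ?exprn_gt0 // mul1r.
  have : e ^+ 2 <= 1 by rewrite expr_le1 // ltW.
  have := sqr_ge0 e; nra.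
have Td : 1 <= T * dg%:R ^+ 7.
  by rewrite -[leLHS]mulr1; apply: ler_pM.
have : Num.sqrt (T * dg%:R ^+ 7) <= T * dg%:R ^+ 7.
  rewrite -{2}[T * _]ger0_norm ?(le_trans _ Td) // -sqrtr_sqr ler_wsqrtr // expr2.
  by rewrite ler_peMl // (le_trans _ Td).
move: Td d1 T1; set D := dg%:R ^+ 7; set x := T * D; set w := Num.sqrt x.
have -> : (2 + 64 * T) * D = 2 * D + 64 * x by rewrite /x; ring.
move: (w) (D) (x) (T) => *; lra.
Qed.

End Numerics.

Section BadMoment.
Variable R : realType.
Local Notation tv q := (fun e : 'I_3 => (tern e)%:~R : 'F_q).

Lemma expR1_ge2 : 2 <= expR 1 :> R.
Proof. by have := expR_ge1Dx (1 : R); lra. Qed.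

Lemma expR2_gt2 : 2 < expR 2 :> R.
Proof. by have := expR_ge1Dx (2 : R); lra. Qed.

(** With k the corank and u = ln q, the parameter X = k u / m compares q^k with exp(m). For X <= C a
    fixed number [j] of dilations gives enough growth. For larger X the gain must grow with X, which
    [dg] of order X short vectors provide. *)
Lemma bad_level (nu : R) : 0 < nu -> nu <= 1 / 4 -> exists2 th0 : R, 0 < th0 &
  forall th, 0 < th -> th <= th0 -> exists m0 : nat,
  forall (m N q : nat) (ga : R) d, prime q -> (m0 <= m)%N -> (m <= N <= m.+1)%N ->
  expR (th * m%:R) <= q%:R -> q%:R <= expR (3 * th * m%:R) -> 3 < q%:R * ga -> (d < m)%N ->
  \sum_(x : {ffun 'I_N -> {ffun 'I_m -> 'I_3}}) pw (pw (lazy nu) (T := 'I_m)) x *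
    ((\rank (span_on (@vec_of _ _ (tv q) m) [set: 'I_N] x 0) == d) &&
       bad nu ga (span_on (@vec_of _ _ (tv q) m) [set: 'I_N] x 0))%:R
   <= 3 * (q%:R ^+ (2 * (m - d) + 4))^-1.
Proof.
move=> nu0 nu1.
pose e : R := (32 * 64)^-1.
have eE : 32 * 64 * e = 1 by rewrite mulfV // mulf_neq0.
have e0 : 0 < e by rewrite invr_gt0 mulr_gt0.
have e1 : e <= 1 by rewrite invf_le1 ?mulr_gt0 // -[leLHS]mulr1; apply: ler_pM => //; rewrite ler1n.
have [A0 A00 HA] := packing_numeric nu0 nu1 e0 e1.
(* With dg >= [Ga] X the gain (1 + [nu] / 2500)^dg is at least exp(41 X), which covers 2 exp(10 + 30
   X) for X >= 1. *)
pose Ga : R := 41 * (100 * 50) / nu.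
have Ga0 : 0 < Ga by rewrite divr_gt0 // !mulr_gt0.
have Ag0 : 0 <= A0 * (Ga + 1) ^+ 7 by rewrite mulr_ge0 // exprn_ge0 // addr_ge0 // ltW.
(* Beyond [C] the packing factor, at most [A0] dg^7 with dg <= ([Ga] + 1) X, is below exp(X / 4). *)
have [C C1 HC] := poly_le_exp Ag0.
have [j Hj] := geometric_unbounded (2 * expR (10 + 30 * C)).
have L1 : 1 <= (3 / 2 : R) ^+ j / 6.
  have E1 : 1 <= expR (10 + 30 * C) by rewrite -[leLHS]expR0 ler_expR; lra.
  by apply: le_trans Hj; lra.
pose eta := nu / 4 ^+ j.+1.
have f4 : 1 <= 4 ^+ j.+1 :> R by rewrite exprn_ege1 // ler1n.
have eta0 : 0 < eta by rewrite divr_gt0 // (lt_le_trans _ f4).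
have eta1 : eta <= nu / 4.
  rewrite /eta exprS invfM mulrA ler_piMr ?divr_ge0 ?(ltW nu0) //.
  by rewrite invf_le1 ?exprn_gt0 // exprn_ege1 // ler1n.
have eta12 : eta <= 1 / 2 by lra.
pose y := nu / 80; have y0 : 0 < y by rewrite divr_gt0.
have y1 : y < 1 by rewrite /y; lra.
pose l := ln (y^-1); have l0 : 0 < l by rewrite ln_gt0 // invf_gt1.
(* The admissible density of a sparse support: the entropy y^-s stays below exp([nu] m / 40) for s
   <= [sg] m. *)
pose sg := Num.min (1 / 2) (nu / 40 / l).
have sg0 : 0 < sg by rewrite lt_min !divr_gt0.
have sg1 : sg <= 1 / 2 by rewrite ge_min lexx.
have sgl : sg * l <= nu / 40 by rewrite -ler_pdivlMr // ge_min lexx orbT.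
pose c4 : R := 4 ^+ j; have c40 : 0 < c4 by rewrite exprn_gt0.
(* In order, the bounds serve [odlyzko_numeric], [sparse_numeric], the size of the sparse supports,
   the factor q^dg in the packing bound, and k >= 40 when X > C. *)
exists (Num.min (Num.min (eta / 48) (nu / 360)) (Num.min (sg * nu / (48 * c4)) (Num.min (1 / (12 * Ga)) (1 / 120)))).
  have b1 : 0 < eta / 48 by rewrite divr_gt0.
  have b2 : 0 < nu / 360 by apply: divr_gt0; [exact: nu0 | rewrite ltr0n].
  have b3 : 0 < sg * nu / (48 * c4) by apply: divr_gt0; apply: mulr_gt0.
  have b4 : 0 < 1 / (12 * Ga) by apply: divr_gt0 => //; apply: mulr_gt0.
  have b5 : 0 < 1 / 120 :> R by apply: divr_gt0.
  by rewrite !lt_min b1 b2 b3 b4 b5.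
move=> th th_gt0; rewrite !le_min => /andP[/andP[t1 t2] /andP[t3 /andP[t4 t5]]].
pose B := 20 + 4 / eta + (c4 * 5 / nu + 1) * 2 / sg + 8 / th ^+ 2.
exists (Num.truncn B).+1 => m N q ga d q_pr m0m /andP[mN Nm] qlo qhi ga3 dm.
have Bm : B <= m%:R.
  by apply/ltW/(lt_le_trans (truncnS_gt _)); rewrite ler_nat.
have p1 : 0 <= 4 / eta by rewrite divr_ge0 // ltW.
have p2 : 0 <= (c4 * 5 / nu + 1) * 2 / sg.
  by rewrite divr_ge0 ?(ltW sg0) // mulr_ge0 // addr_ge0 // divr_ge0 ?(ltW nu0) // mulr_ge0 // ltW.
have p3 : 0 <= 8 / th ^+ 2 by rewrite divr_ge0 // exprn_ge0 // ltW.
have m20 : 20 <= m%:R :> R by move: Bm p1 p2 p3; rewrite /B; lra.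
have m4 : 4 <= eta * m%:R by rewrite mulrC -ler_pdivrMr //; move: Bm p1 p2 p3; rewrite /B; lra.
have mc : c4 * 5 / nu + 1 <= sg * m%:R / 2.
  have : (c4 * 5 / nu + 1) * 2 / sg <= m%:R by move: Bm p1 p2 p3; rewrite /B; lra.
  by rewrite ler_pdivrMr // ler_pdivlMr // [m%:R * _]mulrC.
have mt : 8 <= m%:R * th ^+ 2.
  by rewrite -ler_pdivrMr ?exprn_gt0 //; move: Bm p1 p2 p3; rewrite /B; lra.
have m0 : (0 < m)%N by rewrite -(ltr_nat R) (lt_le_trans _ m20).
have mp : 0 < m%:R :> R by rewrite ltr0n.
have q0 : 0 < q%:R :> R by rewrite ltr0n prime_gt0.
pose u : R := ln q%:R.
have uE : expR u = q%:R by rewrite lnK // posrE.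
have ulo : th * m%:R <= u by rewrite -ler_expR uE.
have uhi : u <= 3 * th * m%:R by rewrite -ler_expR uE.
have u0 : 0 < u by apply: lt_le_trans ulo; rewrite mulr_gt0.
have qn n : (q%:R ^+ n)^-1 = expR (- (n%:R * u)) by rewrite -uE -expRM_natl expRN.
have Nq : (N <= q)%N.
  rewrite -(ler_nat R); apply: (@le_trans _ _ (2 * m%:R)).
    rewrite -natrM ler_nat; apply: leq_trans Nm _; by rewrite mul2n -addnn -addn1 leq_add2l.
  apply: le_trans qlo; have -> : th * m%:R = 2 * (th * m%:R / 2) by field.
  rewrite expRM_natl; apply: (@le_trans _ _ ((th * m%:R / 2) ^+ 2)).
    have -> : (th * m%:R / 2) ^+ 2 = m%:R * (m%:R * th ^+ 2) / 4 by field.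
    by rewrite ler_pdivlMr //; have := ler_wpM2l (ltW mp) mt; clear; lra.
  have w0 : 0 <= th * m%:R / 2 by rewrite divr_ge0 // mulr_ge0 // ltW.
  apply: lerXn2r; rewrite ?nnegrE ?expR_ge0 //.
  by apply: le_trans (expR_ge1Dx _); rewrite lerDr.
have q9 : (9 < q)%N by apply: leq_trans Nq; apply: leq_trans mN; rewrite -(ler_nat R); apply: le_trans m20; rewrite ler_nat.
pose r := (m %/ 4)%N.
have rm5 : m%:R / 5 <= r%:R :> R.
  rewrite ler_pdivrMr // -natrM ler_nat; move: m20; rewrite ler_nat /r => ?; exact: quarter_ge.
have rm : (r <= m)%N by apply: leq_div.
have mr : m%:R / 2 <= (m - r)%:R :> R.
  by rewrite ler_pdivrMr // -natrM ler_nat /r; apply: quarter_le.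
have Hr : 2 * (1 - eta) ^+ (m - r) <= (q%:R ^+ 4)^-1.
  rewrite qn; apply: (@odlyzko_numeric R m r eta u th) => //.
  by move: t1; rewrite ler_pdivlMr // => h; clear -h; lra.
pose k := (m - d)%N; have k0 : (0 < k)%N by rewrite subn_gt0.
have k1 : 1 <= k%:R :> R by rewrite ler1n.
pose X := k%:R * u / m%:R.
have X0 : 0 < X by rewrite divr_gt0 // mulr_gt0 // ltr0n.
have kuX : k%:R * u = X * m%:R by rewrite divfK // gt_eqF.
have [XC|CX] := lerP X C.
  pose s := (Num.truncn (c4 * ((2 * (4 * ln q%:R) + 5) / nu))).+1.
  have Hs : c4 * ((2 * (4 * ln q%:R) + 5) / nu) <= s%:R by apply/ltW/truncnS_gt.
  have sm : s%:R <= sg * m%:R.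
    rewrite -natr1; apply: (@le_trans _ _ (c4 * ((2 * (4 * ln q%:R) + 5) / nu) + 1)).
      have a0 : 0 <= c4 * ((2 * (4 * ln q%:R) + 5) / nu).
        by rewrite mulr_ge0 ?(ltW c40) // divr_ge0 ?(ltW nu0) // addr_ge0 // !mulr_ge0 // ltW.
      by rewrite lerD2r; have /andP[] := truncn_itv a0.
    have -> : c4 * ((2 * (4 * ln q%:R) + 5) / nu) + 1 = c4 * 8 / nu * u + (c4 * 5 / nu + 1).
      by rewrite /u; field; rewrite gt_eqF.
    have c8 : 0 <= c4 * 8 / nu by rewrite divr_ge0 ?(ltW nu0) // mulr_ge0 // ltW.
    have h1 := ler_wpM2l c8 uhi.
    have h2 : c4 * 8 / nu * (3 * th) <= sg / 2.
      move: t3; rewrite ler_pdivlMr ?mulr_gt0 // => h.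
      have -> : c4 * 8 / nu * (3 * th) = th * (48 * c4) / 2 / nu by field; rewrite gt_eqF.
      by rewrite ler_pdivrMr //; clear -h; lra.
    have := ler_wpM2r (ltW mp) h2; move: h1 mc; rewrite !mulrA; clear; lra.
  have sN : (s <= N)%N.
    apply: leq_trans mN; rewrite -(ler_nat R); apply: le_trans sm _.
    by have := ler_wpM2r (ltW mp) sg1; have := mp; clear; lra.
  have H := @level_small R q m N q_pr nu eta nu0 nu1 eta0 eta1 q9 mN Nq ga ga3 j r s y d erefl dm Hr L1 _ sN Hs.
  apply: le_trans (H _) _; first by rewrite y0 ltW.
  rewrite -/k; have -> : 3 * (q%:R ^+ (2 * k + 4))^-1 = (q%:R ^+ (2 * k + 4))^-1 + (q%:R ^+ (2 * k + 4))^-1 + (q%:R ^+ (2 * k + 4))^-1 :> R by ring.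
  apply: lerD; first apply: lerD => //.
    rewrite qn; apply: (@growth_numeric R m N k r _ C u) => //.
    - exact: ltW.
    - exact: le_trans C1.
    - by rewrite kuX ler_pM2r.
  rewrite qn; apply: (@sparse_numeric R m N s k nu sg u) => //; first exact: ltW.
  apply: le_trans uhi _; apply: ler_wpM2r => //; move: t2; clear; lra.
pose dg := (Num.truncn (Ga * X)).+1.
have X1 : 1 <= X by apply: le_trans (ltW CX).
have dgl : Ga * X <= dg%:R by apply/ltW/truncnS_gt.
have dgu : dg%:R <= Ga * X + 1.
  have a0 : 0 <= Ga * X by rewrite mulr_ge0 // ltW.
  by rewrite -natr1 lerD2r; have /andP[] := truncn_itv a0.
have k40 : 40 <= k%:R :> R.
  have h1 : m%:R < k%:R * (3 * th * m%:R).
    apply: lt_le_trans (ler_wpM2l _ uhi) => //; rewrite kuX ltr_pMl //.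
    by apply: le_lt_trans CX.
  have h2 : 1 < k%:R * (3 * th) by rewrite -(ltr_pM2r mp) mul1r -mulrA.
  have h3 : k%:R * (3 * th) <= k%:R * (3 * (1 / 120)) by rewrite ler_wpM2l // ler_wpM2l.
  by apply/ltW; move: h2 h3; clear; lra.
have k5 : (d + 5 <= m)%N.
  by rewrite -leq_subRL ?(ltnW dm) // -/k -(ler_nat R); apply: le_trans k40; rewrite ler_nat.
pose P := 2 * expR 1 * (2 + 64 * Num.sqrt ((4 * dg%:R / nu) / ((e / 8 / dg%:R ^+ 3) ^+ 2 / 32))).
have HP : 2 * (q ^ dg)%:R * P ^+ m < q%:R ^+ (m - d - 4).
  have P0 : 0 <= P by rewrite !mulr_ge0 ?expR_ge0 // addr_ge0 // mulr_ge0 ?sqrtr_ge0.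
  have PX : P <= expR (X / 4).
    apply: le_trans (HA dg isT) _; apply: le_trans (HC X (ltW CX)).
    rewrite -mulrA -exprMn; apply: ler_wpM2l => //; apply: lerXn2r; rewrite ?nnegrE //.
      by rewrite mulr_ge0 ?(ltW X0) // addr_ge0 // ltW.
    by apply: le_trans dgu _; rewrite mulrDl mul1r lerD2l.
  have Pm : P ^+ m <= expR (k%:R * u / 4).
    apply: (@le_trans _ _ (expR (X / 4) ^+ m)); first by rewrite lerXn2r ?nnegrE ?expR_ge0.
    by rewrite -expRM_natl kuX mulrCA mulrA.
  have qd : (q ^ dg)%:R <= expR (k%:R * u / 4 + u) :> R.
    rewrite natrX -uE -expRM_natl ler_expR.
    have h1 : Ga * X <= k%:R / 4.
      rewrite /X !mulrA ler_pdivrMr // mulrAC -mulrA.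
      have h2 : Ga * u <= m%:R / 4.
        have h3 : Ga * (3 * th) <= 1 / 4.
          have c12 : 0 < 12 * Ga by apply: mulr_gt0.
          move: t4; rewrite ler_pdivlMr // => h.
          have -> : Ga * (3 * th) = th * (12 * Ga) / 4 by field.
          by rewrite ler_pM2r ?invr_gt0.
        have := ler_wpM2l (ltW Ga0) uhi; have := ler_wpM2r (ltW mp) h3.
        by rewrite !mulrA; clear; lra.
      have -> : Ga * (u * k%:R) = k%:R * (Ga * u) by rewrite mulrA mulrC.
      have -> : k%:R / 4 * m%:R = k%:R * (m%:R / 4) :> R by rewrite -mulrA [4^-1 * _]mulrC.
      exact: ler_wpM2l.
    have := ler_wpM2r (ltW u0) (le_trans dgu (lerD h1 (lexx 1))); clear; lra.
  have e2 := expR2_gt2.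
  have -> : q%:R ^+ (m - d - 4) = expR ((k%:R - 4) * u) :> R.
    rewrite -uE -expRM_natl natrB // -(ler_nat R) -/k.
    by apply: le_trans k40; rewrite ler_nat.
  apply: (@le_lt_trans _ _ (2 * (expR (k%:R * u / 4 + u) * expR (k%:R * u / 4)))).
    by rewrite -mulrA ler_wpM2l //; apply: ler_pM => //; apply: exprn_ge0.
  apply: (@lt_le_trans _ _ (expR 2 * (expR (k%:R * u / 4 + u) * expR (k%:R * u / 4)))).
    by rewrite ltr_pM2r // mulr_gt0 ?expR_gt0.
  rewrite -!expRD ler_expR.
  have h40 := ler_wpM2r (ltW u0) k40.
  have h20 : 20 <= k%:R * u by rewrite kuX -[leLHS]mul1r; apply: ler_pM.
  by move: h40 h20; clear; lra.
have H := @level_large R q m N q_pr nu eta nu0 nu1 eta0 eta1 q9 mN Nq ga dg r d e k5 isT eE Hr HP.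
apply: le_trans H _; rewrite -/k.
have qi : 0 <= (q%:R ^+ (2 * k + 4))^-1 :> R by rewrite invr_ge0 exprn_ge0.
have : 2 ^+ N * (2 / (1 + nu / (50 * 50)) ^+ dg) ^+ r <= (q%:R ^+ (2 * k + 4))^-1.
  rewrite qn; apply: (@growth_numeric R m N k r _ X u) => //; [exact: ltW | exact: ltW | by rewrite kuX | ].
  have w1 : expR (nu / (50 * 50) / 2) <= 1 + nu / (50 * 50).
    have -> : 1 + nu / (50 * 50) = 1 + 2 * (nu / (50 * 50) / 2) by field.
    by apply: one_plus_ge_exp; apply/andP; move: nu0 nu1; clear; split; lra.
  apply: (@le_trans _ _ (expR (nu / (50 * 50) / 2) ^+ dg)); last first.
    by rewrite lerXn2r ?nnegrE ?expR_ge0 // addr_ge0 // divr_ge0 ?(ltW nu0) ?mulr_ge0.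
  have e2 := expR1_ge2.
  apply: (@le_trans _ _ (expR 1 * expR (10 + 30 * X))); first by rewrite ler_wpM2r ?expR_ge0.
  rewrite -expRM_natl -expRD ler_expR.
  have c0 : 0 <= nu / (50 * 50) / 2 by rewrite !divr_ge0 ?(ltW nu0) ?mulr_ge0.
  apply: le_trans (ler_wpM2r c0 dgl).
  have -> : Ga * X * (nu / (50 * 50) / 2) = 41 * X by rewrite /Ga; field; rewrite gt_eqF.
  by move: X1; clear; lra.
move=> h; move: h qi; clear; lra.
Qed.

(** Every level contributes q^(2 (m - d)) times 3 q^(-2 (m - d) - 4), that is 3 q^-4; there are m
    levels, and 3 m <= q^2. *)
Lemma bad_moment (nu : R) : 0 < nu -> nu <= 1 / 4 -> exists2 th0 : R, 0 < th0 &
  forall th, 0 < th -> th <= th0 -> exists m0 : nat,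
  forall (m N q : nat) (ga : R), prime q -> (m0 <= m)%N -> (m <= N <= m.+1)%N ->
  expR (th * m%:R) <= q%:R -> q%:R <= expR (3 * th * m%:R) -> 3 < q%:R * ga -> (3 * m <= q ^ 2)%N ->
  \sum_(x : {ffun 'I_N -> {ffun 'I_m -> 'I_3}}) pw (pw (lazy nu) (T := 'I_m)) x *
    (q%:R ^+ (2 * (m - \rank (span_on (@vec_of _ _ (tv q) m) [set: 'I_N] x 0))) *
       (bad nu ga (span_on (@vec_of _ _ (tv q) m) [set: 'I_N] x 0))%:R)
   <= (q%:R ^+ 2)^-1.
Proof.
move=> nu0 nu1; have [th0 th00 H] := bad_level nu0 nu1; exists th0 => // th tp tle.
have [m0 {}H] := H th tp tle; exists m0 => m N q ga q_pr m0m mN qlo qhi ga3 mq.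
have {H} Hd d : (d < m)%N -> _ <= _ := H m N q ga d q_pr m0m mN qlo qhi ga3.
set sp := fun x : {ffun 'I_N -> {ffun 'I_m -> 'I_3}} => span_on (@vec_of _ _ (tv q) m) [set: 'I_N] x 0.
rewrite -/(sp _) in Hd *.
have q0 : 0 < q%:R :> R by rewrite ltr0n prime_gt0.
have qn n : 0 < q%:R ^+ n :> R by rewrite exprn_gt0.
have nu01 : 0 <= nu <= 1 by apply/andP; split; lra.
apply: (@le_trans _ _ (\sum_(d < m) q%:R ^+ (2 * (m - d)) *
  \sum_(x : {ffun 'I_N -> {ffun 'I_m -> 'I_3}}) pw (pw (lazy nu) (T := 'I_m)) x *
    ((\rank (sp x) == d) && bad nu ga (sp x))%:R)).
  under [leRHS]eq_bigr do rewrite mulr_sumr.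
  rewrite exchange_big /=; apply: ler_sum => x _.
  have w0 : 0 <= pw (pw (lazy nu) (T := 'I_m)) x.
    by apply: pw_ge0 => o; apply: pw_ge0 => t; apply: lazy_ge0.
  case bx : (bad nu ga (sp x)); last first.
    by rewrite !mulr0; apply: sumr_ge0 => d _; rewrite !mulr_ge0 // ltW.
  have rm : (\rank (sp x) < m)%N.
    move: bx; rewrite /bad => /orP[h|/andP[h _]]; by rewrite -subn_gt0 // (leq_trans _ h).
  rewrite (bigD1 (Ordinal rm)) //= eqxx mulrCA lerDl sumr_ge0 // => d _.
  by rewrite !mulr_ge0 // ltW.
apply: (@le_trans _ _ (\sum_(d < m) 3 * (q%:R ^+ 4)^-1)).
  apply: ler_sum => d _; apply: le_trans (ler_wpM2l (ltW (qn _)) (Hd d _)) _ => //.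
  by rewrite mulrCA ler_wpM2l // exprD invfM mulrA mulfV ?mul1r // gt_eqF.
rewrite sumr_const card_ord -[_ *+ m]mulr_natl mulrA -[4%N]/(2 + 2)%N exprD invfM mulrA.
rewrite -[leRHS]mul1r ler_wpM2r ?invr_ge0 ?(ltW (qn _)) // ler_pdivrMr // mul1r.
by rewrite mulrC -natrM -natrX ler_nat.
Qed.

End BadMoment.

(** * From the graph to its bipartite part *)

Lemma pw_mean_le (R : realFieldType) (E T : finType) (w : E -> R) (G : {ffun T -> E} -> R) (S : R) :
  (forall e, 0 <= w e) -> \sum_e w e = 1 -> (forall h, G h <= S) -> \sum_h pw w h * G h <= S.
Proof.
move=> w0 w1 GS; rewrite -[S]mul1r -[X in _ <= X * _](sum_pw w1 T) mulr_suml.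
by apply: ler_sum => h _; apply: ler_wpM2l; rewrite ?pw_ge0.
Qed.

Lemma natr_card_sum (R : pzSemiRingType) (U : finType) (b : pred U) : #|[set u | b u]|%:R = \sum_u (b u)%:R :> R.
Proof.
by rewrite -sum1_card natr_sum big_mkcond; apply: eq_bigr => u _; rewrite inE; case: (b u).
Qed.

Lemma sum_card_pair (R : pzSemiRingType) (U V : finType) (a : pred V) (b : pred U) :
  \sum_u \sum_v (a v && b u)%:R = #|[set u | b u]|%:R * #|[set v | a v]|%:R :> R.
Proof.
rewrite !natr_card_sum big_distrlr /=; apply: eq_bigr => u _; apply: eq_bigr => v _.
by rewrite -natrM mulnb andbC.
Qed.

Lemma double_exponent a b : (a <= b.+1 -> a + b <= (2 * b).+1)%N.
Proof. lia. Qed.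

Section Adjacency.
Variable F : fieldType.

(** The coins are indexed by ordered pairs, of which those with i < j are read, so that blocks and
    minors are cut out by plain injections of index sets. *)
Definition adj n (h : {ffun 'I_n * 'I_n -> bool}) : 'M[F]_n :=
  \matrix_(i, j) if (i < j)%N then (h (i, j))%:R else if (j < i)%N then (h (j, i))%:R else 0.

Lemma adj_sym n (h : {ffun 'I_n * 'I_n -> bool}) : (adj h)^T = adj h.
Proof. by apply/matrixP => i j; rewrite !mxE; case: ltngtP. Qed.

Definition bipartite (E : Type) (v : E -> F) N m (x : {ffun 'I_N * 'I_m -> E}) : 'M[F]_(N, m) :=
  \matrix_(a, b) v (x (a, b)).

Definition left_part N m (h : {ffun 'I_(N + m) * 'I_(N + m) -> bool}) : {ffun 'I_N * 'I_N -> bool} :=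
  [ffun t => h (lshift m t.1, lshift m t.2)].
Definition right_part N m (h : {ffun 'I_(N + m) * 'I_(N + m) -> bool}) : {ffun 'I_m * 'I_m -> bool} :=
  [ffun t => h (rshift N t.1, rshift N t.2)].
Definition cross_part N m (h : {ffun 'I_(N + m) * 'I_(N + m) -> bool}) : {ffun 'I_N * 'I_m -> bool} :=
  [ffun t => h (lshift m t.1, rshift N t.2)].

Local Notation bv := (fun b : bool => b%:R : F).

Lemma adj_block N m (h : {ffun 'I_(N + m) * 'I_(N + m) -> bool}) :
  adj h = block_mx (adj (left_part h)) (bipartite bv (cross_part h))
                   (bipartite bv (cross_part h))^T (adj (right_part h)).
Proof.
apply/matrixP => i j; rewrite [LHS]mxE; case: (split_ordP i) => i' ->; case: (split_ordP j) => j' ->.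
- by rewrite block_mxEul mxE !ffunE.
- by rewrite block_mxEur mxE ffunE /= ltn_addr.
- by rewrite block_mxEdl !mxE ffunE /= ltnNge ltnW /= ltn_addr.
- by rewrite block_mxEdr mxE !ffunE /= !ltn_add2l.
Qed.

Lemma mul_adj N m (h : {ffun 'I_(N + m) * 'I_(N + m) -> bool}) (u : 'rV[F]_N) (v : 'rV[F]_m) :
  row_mx u v *m adj h =
  row_mx (u *m adj (left_part h) + v *m (bipartite bv (cross_part h))^T)
         (u *m bipartite bv (cross_part h) + v *m adj (right_part h)).
Proof. by rewrite adj_block mul_row_block. Qed.

End Adjacency.

Section Positivity.
Variables (R : realType) (q : nat).
Hypothesis q_pr : prime q.
Local Notation F := 'F_q.
Local Notation tv := (fun e : 'I_3 => (tern e)%:~R : F).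
Local Notation bv := (fun b : bool => b%:R : F).
Variable p : R.
Hypotheses (p0 : 0 < p) (p1 : p < 1).
Local Notation nu := (p * (1 - p)).

Let p01 : 0 <= p <= 1. Proof. by rewrite !ltW. Qed.
Let ber0 b : 0 <= ber p b. Proof. exact: ber_ge0. Qed.
Let ber1 : \sum_b ber p b = 1. Proof. exact: ber_sum. Qed.

(** Both products depend on the same entries; a single linear form carries them jointly, so that one
    Fourier comparison treats both events. *)
Lemma bipartite_lform (E : finType) (v : E -> F) N m (x : {ffun 'I_N * 'I_m -> E}) (a : 'rV[F]_N) (b : 'rV[F]_m) :
  lform v (fun t : 'I_N * 'I_m => row_mx (b 0 t.2 *: delta_mx 0 t.1) (a 0 t.1 *: delta_mx 0 t.2)) x =
  row_mx (b *m (bipartite v x)^T) (a *m bipartite v x).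
Proof.
rewrite /lform; apply/rowP => j; rewrite summxE; case: (split_ordP j) => j' ->.
- rewrite row_mxEl mxE; under eq_bigr do rewrite mxE row_mxEl !mxE /=.
  transitivity (\sum_a' \sum_b' v (x (a', b')) * (b 0 b' * (j' == a')%:R)).
    by rewrite pair_bigA; apply: eq_bigr => -[a' b'] _.
  rewrite (bigD1 j') //= [X in _ + X]big1 ?addr0 => [|a' /negbTE ne].
    by apply: eq_bigr => b' _; rewrite !mxE eqxx mulr1 mulrC.
  by rewrite big1 // => b' _; rewrite eq_sym ne !mulr0.
- rewrite row_mxEr mxE; under eq_bigr do rewrite mxE row_mxEr !mxE /=.
  transitivity (\sum_a' \sum_b' v (x (a', b')) * (a 0 a' * (j' == b')%:R)).
    by rewrite pair_bigA; apply: eq_bigr => -[a' b'] _.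
  apply: eq_bigr => a' _; rewrite (bigD1 j') //= [X in _ + X]big1 ?addr0 => [|b' /negbTE ne].
    by rewrite !mxE eqxx mulr1 mulrC.
  by rewrite eq_sym ne !mulr0.
Qed.

Lemma cross_dominated N m (u : 'rV[F]_N) (v : 'rV[F]_m) (w1 : 'rV[F]_N) (w2 : 'rV[F]_m) :
  \sum_(x : {ffun 'I_N * 'I_m -> bool}) pw (ber p) x *
     ((v *m (bipartite bv x)^T == w1) && (u *m bipartite bv x == w2))%:R <=
  \sum_(x : {ffun 'I_N * 'I_m -> 'I_3}) pw (lazy nu) x *
     ((v *m (bipartite tv x)^T == 0) && (u *m bipartite tv x == 0))%:R.
Proof.
have := @prob_le_dominated R q q_pr _ _ _ (ber p) (lazy nu) bv tv (fun a => 1 - nu * cc R a) _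
  (fun t : 'I_N * 'I_m => row_mx (v 0 t.2 *: delta_mx 0 t.1) (u 0 t.1 *: delta_mx 0 t.2)) (row_mx w1 w2).
move=> /(_ (fun a => normc_charf_ber a p01) (fun a => charf_lazy q_pr nu a)).
under eq_bigr do rewrite bipartite_lform.
under [X in _ <= X]eq_bigr do rewrite bipartite_lform.
have e (y1 w1' : 'rV[F]_N) (y2 w2' : 'rV[F]_m) : (row_mx y1 y2 == row_mx w1' w2') = (y1 == w1') && (y2 == w2').
  by apply/eqP/andP => [/eq_row_mx[-> ->]|[/eqP-> /eqP->]].
under eq_bigr do rewrite e.
by under [X in _ <= X]eq_bigr do rewrite row_mx_eq0.
Qed.

Definition cross_edge N m (t : 'I_N * 'I_m) : 'I_(N + m) * 'I_(N + m) := (lshift m t.1, rshift N t.2).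

Lemma cross_edge_inj N m : injective (@cross_edge N m).
Proof. by move=> [a b] [a' b'] [/val_inj -> /addnI/val_inj ->]. Qed.

Definition cross_edges N m : {set 'I_(N + m) * 'I_(N + m)} := [set cross_edge t | t : 'I_N * 'I_m].

(* All the edges inside the two sides are frozen: conditionally on them the
   event only depends on the bipartite part. *)
Lemma cross_mix N m (G : {ffun 'I_(N + m) * 'I_(N + m) -> bool} -> {ffun 'I_N * 'I_m -> bool} -> R) :
  (forall (h h' : {ffun 'I_(N + m) * 'I_(N + m) -> bool}) (x : {ffun 'I_N * 'I_m -> bool}), (forall t, t \notin cross_edges N m -> h t = h' t) -> G h x = G h' x) ->
  \sum_h pw (ber p) h * G h (cross_part h) =
  \sum_h pw (ber p) h * \sum_x pw (ber p) x * G h x.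
Proof.
move=> HG; rewrite (pw_mix ber1 (cross_edges N m)); apply: eq_bigr => g _.
transitivity (\sum_f pw (ber p) g * (pw (ber p) f * G g [ffun t => f (cross_edge t)])).
  apply: eq_bigr => f _; rewrite [pw _ f * _]mulrC -mulrA; congr (_ * (_ * _)).
  rewrite (HG _ g) => [|t /negbTE tn]; last by rewrite ffunE tn.
  congr G; apply/ffunP => t; rewrite !ffunE.
  by rewrite (_ : (_, _) = cross_edge t) // imset_f.
rewrite -mulr_sumr; congr (_ * _).
exact: (pw_marg ber1 (G g) (@cross_edge_inj N m)).
Qed.

Lemma side_parts_frozen N m (h h' : {ffun 'I_(N + m) * 'I_(N + m) -> bool}) :
  (forall t, t \notin cross_edges N m -> h t = h' t) ->
  left_part h = left_part h' /\ right_part h = right_part h'.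
Proof.
move=> H; split; apply/ffunP => -[a b]; rewrite !ffunE /=; apply: H; apply/imsetP => -[[a' b'] _ []] /=.
  by move=> _ e; have := ltn_ord b; rewrite e ltnNge leq_addr.
by move=> e _; have := ltn_ord a'; rewrite -e ltnNge leq_addr.
Qed.

(** The diagonal blocks only move the target, and the domination bound is the same for every
    target. *)
Lemma adj_image_dominated N m (u : 'rV[F]_N) (v : 'rV[F]_m) (w : 'rV[F]_(N + m)) :
  \sum_h pw (ber p) h * (row_mx u v *m adj F h == w)%:R <=
  \sum_(x : {ffun 'I_N * 'I_m -> 'I_3}) pw (lazy nu) x *
     ((v *m (bipartite tv x)^T == 0) && (u *m bipartite tv x == 0))%:R.
Proof.
pose G (h : {ffun 'I_(N + m) * 'I_(N + m) -> bool}) (x : {ffun 'I_N * 'I_m -> bool}) : R :=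
  ((v *m (bipartite bv x)^T == lsubmx w - u *m adj F (left_part h)) &&
   (u *m bipartite bv x == rsubmx w - v *m adj F (right_part h)))%:R.
have -> : \sum_h pw (ber p) h * (row_mx u v *m adj F h == w)%:R = \sum_h pw (ber p) h * G h (cross_part h).
  apply: eq_bigr => h _; congr (_ * _%:R); rewrite mul_adj -{1}[w]hsubmxK.
  congr nat_of_bool; apply/eqP/andP => [/eq_row_mx[<- <-]|[/eqP e1 /eqP e2]].
    by rewrite addrC addKr addrK !eqxx.
  by rewrite e1 e2 addrC subrK subrK.
rewrite cross_mix => [|h h' x /side_parts_frozen[e1 e2]]; last by rewrite /G e1 e2.
apply: (pw_mean_le ber0 ber1) => h; exact: cross_dominated.
Qed.

Lemma card_left_kernel N m (M : 'M[F]_(N, m)) : #|[set u : 'rV[F]_N | u *m M == 0]| = (q ^ (N - \rank M))%N.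
Proof.
have -> : [set u : 'rV[F]_N | u *m M == 0] = rowg (kermx M).
  by apply/setP => u; rewrite !inE sub_kermx.
by rewrite card_rowg mxrank_ker card_Fp.
Qed.

Lemma card_right_kernel N m (M : 'M[F]_(N, m)) : #|[set v : 'rV[F]_m | v *m M^T == 0]| = (q ^ (m - \rank M))%N.
Proof. by rewrite card_left_kernel mxrank_tr. Qed.

Lemma sum_row_mx N m (f : 'rV[F]_(N + m) -> R) :
  \sum_u f u = \sum_u \sum_v f (row_mx u v).
Proof.
rewrite pair_bigA /= (reindex (fun uv : 'rV[F]_N * 'rV[F]_m => row_mx uv.1 uv.2)) //=.
exists (fun u => (lsubmx u, rsubmx u)) => [[u v] _|u _] /=; last exact: hsubmxK.
by rewrite row_mxKl row_mxKr.
Qed.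

Lemma span_on_rows N m (x : {ffun 'I_N -> {ffun 'I_m -> 'I_3}}) :
  (span_on (@vec_of F _ tv m) [set: 'I_N] x 0 :=: bipartite tv [ffun t => x t.1 t.2])%MS.
Proof.
set M := bipartite _ _; have rE i : row i M = vec_of tv (x i).
  by apply/rowP => j; rewrite !mxE ffunE.
apply/eqmxP/andP; split.
  rewrite -(genmxE M) span_on_sub sub0mx; apply/forall_inP => i _; rewrite genmxE -rE.
  exact: row_sub.
by apply/row_subP => i; rewrite rE; apply: span_on_in; rewrite inE.
Qed.

(** If u_a is nonzero, column b of the equation determines the edge ab from edges that avoid a. The
    N - 1 edges at a are thus determined by the others. *)
Lemma adj_image_atom N (u w : 'rV[F]_N) : u != 0 ->
  \sum_h pw (ber p) h * (u *m adj F h == w)%:R <= Num.max p (1 - p) ^+ N.-1.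
Proof.
move=> u0; have [a ua] : exists a, u 0 a != 0.
  by apply/existsP; apply: contraR u0 => /existsPn H; apply/eqP/rowP => a; rewrite mxE; apply/eqP/negPn/H.
pose ed (b : 'I_N) : 'I_N * 'I_N := if (a < b)%N then (a, b) else (b, a).
have edi : injective ed.
  move=> b b'; rewrite /ed; case: ltnP => ab; case: ltnP => ab' [] // e1 e2.
  - by rewrite -e1 e2.
  - by rewrite e1 -e2.
pose P := [set ed b | b in [set~ a]].
have <- : #|P| = N.-1 by rewrite card_imset // cardsC1 card_ord.
pose A : {set {ffun 'I_N * 'I_N -> bool}} := [set h | u *m adj F h == w].
have -> : \sum_h pw (ber p) h * (u *m adj F h == w)%:R = \sum_(h in A) pw (ber p) h.
  rewrite [RHS]big_mkcond; apply: eq_bigr => h _; rewrite inE.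
  by case: eqP; rewrite ?mulr1 ?mulr0.
apply: (sum_pw_determined ber0 ber1) => [e|f g fA gA fg].
  by rewrite /ber; case: e; rewrite le_max lexx ?orbT.
have Pa c b : c != a -> b != a -> (c, b) \notin P.
  move=> ca ba; apply/imsetP => -[b' _]; rewrite /ed; case: ifP => _ [] e1 e2.
    by rewrite e1 eqxx in ca.
  by rewrite e2 eqxx in ba.
apply/ffunP => t; have [/imsetP[b]|/fg //] := boolP (t \in P).
rewrite !inE => ba ->.
have ab : adj F f a b = adj F g a b.
  move: fA gA; rewrite !inE => /eqP fw /eqP gw.
  have := congr1 (fun M : 'rV[F]_N => M 0 b) fw; rewrite -gw /= !mxE.
  rewrite (bigD1 a) //= [X in _ = X](bigD1 a) //=.
  rewrite [X in _ + X = _](eq_bigr (fun c => u 0 c * adj F g c b)) => [|c ca].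
    by move=> /addIr /(mulfI ua); rewrite !mxE.
  by rewrite !mxE !fg // Pa.
move: ab; rewrite !mxE /ed; case: ltngtP => [_|_|e].
- by case: (f _) (g _) => -[] //= /eqP; rewrite ?oner_eq0 // eq_sym oner_eq0.
- by case: (f _) (g _) => -[] //= /eqP; rewrite ?oner_eq0 // eq_sym oner_eq0.
- by rewrite (val_inj e) eqxx in ba.
Qed.

Section Block.
Variables (N m : nat) (ga : R).
Hypotheses (mN : (m <= N)%N) (Nm : (N <= m.+1)%N).
Local Notation B x := (bipartite tv x).
Local Notation K x := (m - \rank (B x))%N.
Local Notation E G := (\sum_(x : {ffun 'I_N * 'I_m -> 'I_3}) pw (lazy nu) x * G x).

Definition structured_kernel (x : {ffun 'I_N * 'I_m -> 'I_3}) : bool :=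
  [exists t : 'rV[F]_m, [&& t *m (B x)^T == 0, t != 0 & ga <= line_hit nu t]].

Definition bad_block (x : {ffun 'I_N * 'I_m -> 'I_3}) : bool :=
  (4 < K x)%N || (0 < K x)%N && structured_kernel x.

Hypothesis Hbad : E (fun x => q%:R ^+ (2 * K x) * (bad_block x)%:R) <= (q%:R ^+ 2)^-1.

Let q0 : 0 < q%:R :> R. Proof. by rewrite ltr0n prime_gt0. Qed.
Let q1 : 1 <= q%:R :> R. Proof. by rewrite ler1n prime_gt0. Qed.
Let nu01 : 0 <= nu <= 1.
Proof. by have := p0; have := p1; move=> *; apply/andP; split; nra. Qed.
Let lz0 e : 0 <= lazy nu e. Proof. exact: lazy_ge0. Qed.
Let lz1 : \sum_e lazy nu e = 1. Proof. exact: lazy_sum. Qed.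

(** Outside [bad_block] the corank is at most 4; the bad blocks are paid by [Hbad], whose exponent 2
    covers every i <= 2. *)
Lemma moment_le i j : (i <= 2)%N -> (forall k, (k <= 4)%N -> i * k <= j)%N ->
  E (fun x => q%:R ^+ (i * K x)) <= q%:R ^+ j + (q%:R ^+ 2)^-1.
Proof.
move=> i2 ij; apply: (@le_trans _ _ (E (fun x => q%:R ^+ j) + E (fun x => q%:R ^+ (2 * K x) * (bad_block x)%:R))).
  rewrite -big_split /=; apply: ler_sum => x _; rewrite -mulrDr; apply: ler_wpM2l; first exact: pw_ge0.
  rewrite /bad_block; have [k4|k4] := ltnP 4 (K x).
    rewrite /= mulr1 -[leLHS]add0r; apply: lerD; first by rewrite exprn_ge0 // ltW.
    by apply: ler_weXn2l => //; rewrite leq_mul2r i2 orbT.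
  rewrite -[leLHS]addr0; apply: lerD; last by rewrite mulr_ge0 // exprn_ge0 // ltW.
  by apply: ler_weXn2l => //; apply: ij.
by apply: lerD => //; rewrite -mulr_suml sum_pw // mul1r.
Qed.

Lemma left_exponent (x : {ffun 'I_N * 'I_m -> 'I_3}) : (N - \rank (B x) <= (K x).+1)%N.
Proof. by rewrite leq_subLR addnS subnKC ?rank_leq_col. Qed.

Lemma kernel_mean :
  \sum_h pw (ber p) h * #|[set u : 'rV[F]_(N + m) | u *m adj F h == 0]|%:R
    <= q%:R * (q%:R ^+ 8 + (q%:R ^+ 2)^-1).
Proof.
apply: (@le_trans _ _ (\sum_u \sum_h pw (ber p) h * (u *m adj F h == 0 :> 'rV[F]_(N + m))%:R)).
  rewrite exchange_big /=; apply: ler_sum => h _; rewrite -mulr_sumr.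
  rewrite -sum1_card natr_sum big_mkcond /=; apply: ler_wpM2l; first exact: pw_ge0.
  by apply: ler_sum => u _; rewrite inE; case: ifP.
rewrite sum_row_mx.
apply: (@le_trans _ _ (E (fun x => q%:R * q%:R ^+ (2 * K x)))).
  apply: (@le_trans _ _ (\sum_(u : 'rV[F]_N) \sum_(v : 'rV[F]_m) E (fun x => ((v *m (B x)^T == 0) && (u *m B x == 0))%:R))).
    by apply: ler_sum => u _; apply: ler_sum => v _; apply: adj_image_dominated.
  under eq_bigr do rewrite exchange_big /=.
  rewrite exchange_big /=; apply: ler_sum => x _.
  under eq_bigr do rewrite -mulr_sumr.
  rewrite -mulr_sumr; apply: ler_wpM2l; first exact: pw_ge0.
  have -> : \sum_(u : 'rV[F]_N) \sum_(v : 'rV[F]_m) ((v *m (B x)^T == 0) && (u *m B x == 0))%:R =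
     #|[set u : 'rV[F]_N | u *m B x == 0]|%:R * #|[set v : 'rV[F]_m | v *m (B x)^T == 0]|%:R :> R.
    exact: sum_card_pair.
  rewrite card_left_kernel card_right_kernel !natrX -exprS -exprD.
  by apply: ler_weXn2l => //; exact/double_exponent/left_exponent.
under eq_bigr do rewrite mulrCA.
rewrite -mulr_sumr; apply: ler_wpM2l; first exact: ltW.
by apply: moment_le => // k; lia.
Qed.

Definition dense u := ga <= line_hit nu (u : 'rV[F]_m).

(** Write u as (u1, v). If v is nonzero and dense, domination turns the event into a structured
    kernel, hence a bad block, and [Hbad] applies. If v = 0, density carries no information: the
    first diagonal block then gives the atom bound, and the cross block the mean size of the left
    kernel. *)
Lemma adj_image_dense (w : 'rV[F]_(N + m)) : (0 < N)%N ->
  \sum_(u | (u != 0) && dense (rsubmx u)) \sum_h pw (ber p) h * (u *m adj F h == w)%:R <=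
  q%:R * (q%:R ^+ 2)^-1 + Num.max p (1 - p) ^+ N.-1 * (q%:R * (q%:R ^+ 4 + (q%:R ^+ 2)^-1)).
Proof.
move=> N0; pose T u := \sum_h pw (ber p) h * (u *m adj F h == w)%:R.
have T0 u : 0 <= T u by apply: sumr_ge0 => h _; rewrite mulr_ge0 ?pw_ge0.
rewrite -/T big_mkcond /= sum_row_mx.
apply: (@le_trans _ _ (\sum_(u : 'rV[F]_N) ((\sum_(v : 'rV[F]_m) (if (v != 0) && dense v then T (row_mx u v) else 0)) +
   (if u != 0 then T (row_mx u 0) else 0)))).
  apply: ler_sum => u _; rewrite (bigD1 0) //= [X in _ <= X + _](bigD1 0) //= eqxx /= add0r addrC.
  apply: lerD.
    apply: ler_sum => v v0; rewrite v0 row_mxKr /= row_mx_eq0 (negbTE v0) andbF /=.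
    by case: ifP.
  rewrite row_mxKr row_mx_eq0 eqxx andbT; case: ifP => [/andP[-> _] //|_].
  by case: ifP => // _; apply: T0.
rewrite big_split /=; apply: lerD.
  apply: (@le_trans _ _ (E (fun x => q%:R * (q%:R ^+ (2 * K x) * (bad_block x)%:R)))); last first.
    by under eq_bigr do rewrite mulrCA; rewrite -mulr_sumr; apply: ler_wpM2l => //; exact: ltW.
  apply: (@le_trans _ _ (\sum_(u : 'rV[F]_N) \sum_(v : 'rV[F]_m)
     E (fun x => ([&& v *m (B x)^T == 0, v != 0 & dense v] && (u *m B x == 0))%:R))).
    apply: ler_sum => u _; apply: ler_sum => v _; case: ifP => [vd|_]; last first.
      by apply: sumr_ge0 => x _; rewrite mulr_ge0 ?pw_ge0.
    apply: le_trans (adj_image_dominated _ _ _) _; apply: ler_sum => x _.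
    by rewrite andbT.
  under eq_bigr do rewrite exchange_big /=.
  rewrite exchange_big /=; apply: ler_sum => x _.
  under eq_bigr do rewrite -mulr_sumr.
  rewrite -mulr_sumr; apply: ler_wpM2l; first exact: pw_ge0.
  rewrite (sum_card_pair R (fun v : 'rV[F]_m => [&& v *m (B x)^T == 0, v != 0 & dense v]) (fun u : 'rV[F]_N => u *m B x == 0)).
  rewrite card_left_kernel; set S := [set v | _].
  have [S0|[v]] := set_0Vmem S; first by rewrite S0 cards0 mulr0 !mulr_ge0 ?exprn_ge0 // ltW.
  rewrite inE => /and3P[v1 v2 v3].
  have sk : structured_kernel x by apply/existsP; exists v; rewrite v1 v2.
  have SK : (#|S| <= q ^ K x)%N.
    rewrite -card_right_kernel; apply: subset_leq_card.
    by apply/subsetP => y; rewrite !inE => /andP[].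
  have K0 : (0 < K x)%N.
    rewrite lt0n; apply/eqP => K0.
    have sub : [set 0; v] \subset [set t : 'rV[F]_m | t *m (B x)^T == 0].
      by apply/subsetP => y; rewrite !inE => /orP[] /eqP -> //; rewrite mul0mx.
    by have := subset_leq_card sub; rewrite cards2 eq_sym v2 card_right_kernel K0 expn0.
  rewrite /bad_block K0 sk orbT mulr1 -exprS -!natrM -natrX ler_nat.
  apply: leq_trans (leq_mul (leqnn _) SK) _; rewrite -expnD leq_exp2l ?prime_gt1 //.
  by exact/double_exponent/left_exponent.
apply: (@le_trans _ _ (\sum_(u : 'rV[F]_N) Num.max p (1 - p) ^+ N.-1 * E (fun x => (u *m B x == 0)%:R))).
  apply: ler_sum => u _; case: ifP => [u0|_]; last first.
    apply: mulr_ge0; first by rewrite exprn_ge0 // le_max ltW.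
    by apply: sumr_ge0 => x _; rewrite mulr_ge0 ?pw_ge0.
  pose G (h : {ffun 'I_(N + m) * 'I_(N + m) -> bool}) (x : {ffun 'I_N * 'I_m -> bool}) : R :=
    ((u *m adj F (left_part h) == lsubmx w) && (u *m bipartite bv x == rsubmx w))%:R.
  have -> : T (row_mx u 0) = \sum_h pw (ber p) h * G h (cross_part h).
    apply: eq_bigr => h _; congr (_ * _%:R); rewrite mul_adj !mul0mx !addr0 -{1}[w]hsubmxK.
    by congr nat_of_bool; apply/eqP/andP => [/eq_row_mx[<- <-]|[/eqP -> /eqP ->]].
  rewrite cross_mix => [|h h' x /side_parts_frozen[e1 e2]]; last by rewrite /G e1.
  apply: (@le_trans _ _ (\sum_(h : {ffun 'I_(N + m) * 'I_(N + m) -> bool}) pw (ber p) h * (u *m adj F (left_part h) == lsubmx w)%:R *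
      E (fun x => (u *m B x == 0)%:R))).
    apply: ler_sum => h _; rewrite -mulrA; apply: ler_wpM2l; first exact: pw_ge0.
    rewrite /G; case: (_ == lsubmx w); last by rewrite mul0r big1 // => x _; rewrite mulr0.
    rewrite mul1r; have := cross_dominated u 0 0 (rsubmx w).
    under eq_bigr do rewrite mul0mx eqxx /=.
    by under [X in _ <= X -> _]eq_bigr do rewrite mul0mx eqxx /=.
  rewrite -mulr_suml; apply: ler_wpM2r.
    by apply: sumr_ge0 => x _; rewrite mulr_ge0 ?pw_ge0.
  have li : injective (fun t : 'I_N * 'I_N => (lshift m t.1, lshift m t.2)).
    by move=> [b b'] [c c'] [/val_inj -> /val_inj ->].
  rewrite (pw_marg ber1 (fun h => (u *m adj F h == lsubmx w)%:R) li).
  exact: adj_image_atom.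
rewrite -mulr_sumr; apply: ler_wpM2l; first by rewrite exprn_ge0 // le_max ltW.
rewrite exchange_big /=; apply: (@le_trans _ _ (E (fun x => q%:R * q%:R ^+ (1 * K x)))).
  apply: ler_sum => x _; rewrite -mulr_sumr; apply: ler_wpM2l; first exact: pw_ge0.
  rewrite -natr_card_sum card_left_kernel natrX -exprS.
  by apply: ler_weXn2l => //; rewrite mul1n left_exponent.
under eq_bigr do rewrite mulrCA.
rewrite -mulr_sumr; apply: ler_wpM2l; first exact: ltW.
by apply: moment_le => // k; rewrite mul1n.
Qed.

End Block.

End Positivity.

(** * Singularity *)

Section ProductLaws.
Variables (R : realFieldType) (E : finType) (w : E -> R).
Hypotheses (w0 : forall e, 0 <= w e) (w1 : \sum_e w e = 1).

Definition join (A B : finType) (u : {ffun A -> E}) (v : {ffun B -> E}) : {ffun A + B -> E} :=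
  [ffun s => match s with inl a => u a | inr b => v b end].

Lemma pw_join (A B : finType) (G : {ffun A + B -> E} -> R) :
  \sum_f pw w f * G f = \sum_u \sum_v pw w u * (pw w v * G (join u v)).
Proof.
rewrite pair_bigA /= (reindex (fun uv : {ffun A -> E} * {ffun B -> E} => join uv.1 uv.2)) /=.
  apply: eq_bigr => -[u v] _ /=; rewrite mulrA; congr (_ * _).
  by rewrite /pw big_sumType /=; congr (_ * _); apply: eq_bigr => t _; rewrite ffunE.
exists (fun f : {ffun A + B -> E} => ([ffun a => f (inl a)], [ffun b => f (inr b)])) => [[u v] _|f _] /=.
  by congr pair; apply/ffunP => t; rewrite !ffunE.
by apply/ffunP => -[a|b]; rewrite !ffunE.
Qed.

Lemma pw_pair (T : finType) (G : {ffun T -> E} -> {ffun T -> E} -> R) :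
  \sum_u \sum_v pw w u * (pw w v * G u v) =
  \sum_(c : {ffun T -> E * E}) pw (fun e => w e.1 * w e.2) c * G [ffun t => (c t).1] [ffun t => (c t).2].
Proof.
rewrite pair_bigA /= [RHS](reindex (fun uv : {ffun T -> E} * {ffun T -> E} => [ffun t => (uv.1 t, uv.2 t)])) /=.
  apply: eq_bigr => -[u v] _ /=; rewrite mulrA; congr (_ * _).
    by rewrite /pw -big_split; apply: eq_bigr => t _; rewrite ffunE.
  by congr G; apply/ffunP => t; rewrite !ffunE.
exists (fun c : {ffun T -> E * E} => ([ffun t => (c t).1], [ffun t => (c t).2])) => [[u v] _|c _] /=.
  by congr pair; apply/ffunP => t; rewrite !ffunE.
by apply/ffunP => t; rewrite !ffunE; case: (c t).
Qed.

End ProductLaws.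

Section Decoupling.
Variables (R : realFieldType) (U V : finType) (a : U -> R) (b : V -> R).
Hypotheses (a0 : forall u, 0 <= a u) (a1 : \sum_u a u = 1).
Hypotheses (b0 : forall v, 0 <= b v) (b1 : \sum_v b v = 1).

Lemma mean_sqr (I : finType) (c f : I -> R) : (forall i, 0 <= c i) -> \sum_i c i = 1 ->
  (\sum_i c i * f i) ^+ 2 <= \sum_i c i * f i ^+ 2.
Proof.
move=> c0 c1; set mu := \sum_i _.
have : 0 <= \sum_i c i * (f i - mu) ^+ 2 by apply: sumr_ge0 => i _; rewrite mulr_ge0 ?sqr_ge0.
have -> : \sum_i c i * (f i - mu) ^+ 2 = \sum_i (c i * f i ^+ 2 - 2 * mu * (c i * f i) + mu ^+ 2 * c i).
  by apply: eq_bigr => i _; ring.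
rewrite big_split sumrB /= -!mulr_sumr c1 -/mu; set q := \sum_i _; lra.
Qed.

(** Cauchy-Schwarz twice: over [v], which doubles [u], and then over the pairs of [u], which doubles
    [v]. *)
Lemma decoupling (S : U -> V -> bool) :
  (\sum_u \sum_v a u * (b v * (S u v)%:R)) ^+ 4 <=
  \sum_u \sum_u' a u * (a u' * \sum_v \sum_v' b v * (b v' * [&& S u v, S u' v, S u v' & S u' v']%:R)).
Proof.
have -> : \sum_u \sum_v a u * (b v * (S u v)%:R) = \sum_v b v * \sum_u a u * (S u v)%:R.
  rewrite exchange_big; apply: eq_bigr => v _; rewrite mulr_sumr.
  by apply: eq_bigr => u _; rewrite mulrCA.
set x := (X in X ^+ 4 <= _).
have x0 : 0 <= x.
  by apply: sumr_ge0 => v _; rewrite mulr_ge0 // sumr_ge0 // => u _; rewrite mulr_ge0.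
pose y (p : U * U) := \sum_v b v * ((S p.1 v)%:R * (S p.2 v)%:R).
have h1 : x ^+ 2 <= \sum_p a p.1 * a p.2 * y p.
  apply: le_trans (mean_sqr _ b0 b1) _.
  rewrite -(pair_bigA _ (fun u u' => a u * a u' * y (u, u'))) /= le_eqVlt; apply/orP; left; apply/eqP.
  transitivity (\sum_v \sum_u \sum_u' a u * a u' * (b v * ((S u v)%:R * (S u' v)%:R))).
    apply: eq_bigr => v _; rewrite expr2 mulr_suml mulr_sumr; apply: eq_bigr => u _.
    by rewrite !mulr_sumr; apply: eq_bigr => u' _; ring.
  rewrite exchange_big; apply: eq_bigr => u _; rewrite exchange_big; apply: eq_bigr => u' _.
  by rewrite mulr_sumr.
have aa0 (p : U * U) : 0 <= a p.1 * a p.2 by rewrite mulr_ge0.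
have aa1 : \sum_(p : U * U) a p.1 * a p.2 = 1.
  by rewrite -(pair_bigA _ (fun u u' => a u * a u')) /= -big_distrlr /= a1 mulr1.
have y0 p : 0 <= y p by apply: sumr_ge0 => v _; rewrite !mulr_ge0.
have h2 : x ^+ 4 <= \sum_p a p.1 * a p.2 * y p ^+ 2.
  apply: le_trans (mean_sqr _ aa0 aa1).
  have -> : x ^+ 4 = (x ^+ 2) ^+ 2 by rewrite -exprM.
  by rewrite lerXn2r ?nnegrE ?sqr_ge0 // sumr_ge0 // => p _; rewrite mulr_ge0.
apply: le_trans h2 _; rewrite -(pair_bigA _ (fun u u' => a u * a u' * y (u, u') ^+ 2)) /=.
rewrite le_eqVlt; apply/orP; left; apply/eqP; apply: eq_bigr => u _; apply: eq_bigr => u' _.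
rewrite -mulrA expr2 /y big_distrlr /=; congr (_ * (_ * _)).
apply: eq_bigr => v _; apply: eq_bigr => v' _.
by case: (S u v); case: (S u' v); case: (S u v'); case: (S u' v'); rewrite /= ?(mulr0, mul0r, mulr1).
Qed.

End Decoupling.

Section DotHit.
Variables (R : realType) (q : nat).
Hypothesis q_pr : prime q.
Local Notation F := 'F_q.

Lemma dot_hit_le (E : finType) (w : E -> R) (v : E -> F) (psi : F -> R) n (t : 'rV[F]_n) :
  (forall a, normc (charf w v a) <= psi a) ->
  \sum_(x : {ffun 'I_n -> E}) pw w x * (\sum_j v (x j) * t 0 j == 0)%:R <=
  (\sum_a \prod_j psi (a * t 0 j)) / q%:R.
Proof.
move=> H; have q0 : 0 < q%:R :> R by rewrite ltr0n prime_gt0.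
rewrite ler_pdivlMr //; set L := (X in X * _).
pose A (j : 'I_n) : 'rV[F]_1 := const_mx (t 0 j).
have lE (x : {ffun 'I_n -> E}) : (lform v A x == 0) = (\sum_j v (x j) * t 0 j == 0).
  have -> : lform v A x = const_mx (\sum_j v (x j) * t 0 j).
    by apply/rowP => i; rewrite summxE mxE; apply: eq_bigr => j _; rewrite !mxE.
  apply/eqP/eqP => [/rowP/(_ 0)|->]; first by rewrite !mxE.
  by apply/rowP => i; rewrite !mxE.
have := prob_fourier q_pr w v A 0; under eq_bigr do rewrite lE.
rewrite -/L expn1 => e.
have -> : L * q%:R = complex.Re (real_complex R L * real_complex R q%:R) by rewrite -rmorphM.
rewrite e.
have Re_le (y : R[i]) : complex.Re y <= normc y.
  by case: y => a b; rewrite /normc /= (le_trans (ler_norm a)) // -sqrtr_sqr ler_wsqrtr // lerDl sqr_ge0.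
apply: le_trans (Re_le _) _; apply: le_trans (normc_sum _ _) _.
rewrite (reindex (fun a : F => const_mx a : 'rV[F]_1)) /=; last first.
  exists (fun xi : 'rV[F]_1 => xi 0 0) => [a _|xi _]; first by rewrite mxE.
  by apply/rowP => i; rewrite mxE (ord1 i).
apply: ler_sum => a _; rewrite normcM normc_chi mul1r normc_prod.
apply: ler_prod => j _; apply/andP; split; first by rewrite /normc; case: (charf _ _ _) => c d; apply: sqrtr_ge0.
by rewrite /dot big_ord1 !mxE.
Qed.

End DotHit.

Section Singularity.
Variables (R : realType) (q : nat).
Hypotheses (q_pr : prime q) (q_odd : (2 < q)%N).
Local Notation F := 'F_q.
Local Notation bv := (fun b : bool => b%:R : F).
Variable p : R.
Hypotheses (p0 : 0 < p) (p1 : p < 1).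
Local Notation nu := (p * (1 - p)).
Local Notation be := (Num.max p (1 - p)).

Let p01 : 0 <= p <= 1. Proof. by rewrite !ltW. Qed.
Let ber0 b : 0 <= ber p b. Proof. exact: ber_ge0. Qed.
Let ber1 : \sum_b ber p b = 1. Proof. exact: ber_sum. Qed.
Let q0 : 0 < q%:R :> R. Proof. by rewrite ltr0n prime_gt0. Qed.
Let nu0 : 0 < nu. Proof. by rewrite mulr_gt0 // subr_gt0. Qed.
Let nu4 : nu <= 1 / 4. Proof. by have := sqr_ge0 (p - 1 / 2); lra. Qed.

Definition bits n (x : {ffun 'I_n -> bool}) : 'rV[F]_n := \row_j (x j)%:R.

Lemma bits_inj n : injective (@bits n).
Proof.
move=> x y /rowP e; apply/ffunP => j; have := e j; rewrite !mxE.
by case: (x j) (y j) => -[] //= /eqP; rewrite ?oner_eq0 // eq_sym oner_eq0.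
Qed.

Lemma bits_hit n (t : 'rV[F]_n) :
  \sum_x pw (ber p) x * (bits x *m t^T == 0)%:R <= line_hit nu t.
Proof.
have := @dot_hit_le R q q_pr bool (ber p) bv _ n t (fun a => normc_charf_ber a p01).
under eq_bigr => x _.
  rewrite (_ : (\sum_j _ == 0) = (bits x *m t^T == 0)); first over.
  apply/eqP/eqP => [e|/matrixP/(_ 0 0)].
    by apply/matrixP => i j; rewrite !ord1 !mxE -[RHS]e; apply: eq_bigr => k _; rewrite !mxE.
  by rewrite !mxE => e; rewrite -[RHS]e; apply: eq_bigr => k _; rewrite !mxE.
by [].
Qed.

(** The characteristic function 1 - 2 nu [cc] of the difference lies between 0 and 1 - nu [cc], so
    the same [line_hit] serves for one vector and for a difference. *)
Lemma bits_diff_hit n (t : 'rV[F]_n) :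
  \sum_x \sum_y pw (ber p) x * (pw (ber p) y * ((bits x - bits y) *m t^T == 0)%:R) <= line_hit nu t.
Proof.
rewrite (@pw_pair R bool (ber p) _ (fun x y => ((bits x - bits y) *m t^T == 0)%:R)).
have H a : normc (charf (fun b : bool * bool => ber p b.1 * ber p b.2) (fun b => b.1%:R - b.2%:R : F) a) <= 1 - nu * cc R a.
  rewrite charf_ber_diff // /normc /= expr0n addr0 sqrtr_sqr.
  have := cc_ge0 R a; have := cc_le2 R a; move: (cc R a) => c c2 c0.
  have n0 := nu0; have n4 := nu4.
  rewrite ger0_norm; nra.
have := @dot_hit_le R q q_pr _ _ _ _ n t H.
under eq_bigr => x _.
  rewrite (_ : (\sum_j _ == 0) = ((bits [ffun j => (x j).1] - bits [ffun j => (x j).2]) *m t^T == 0)); first over.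
  apply/eqP/eqP => [e|/matrixP/(_ 0 0)].
    by apply/matrixP => i j; rewrite !ord1 !mxE -[RHS]e; apply: eq_bigr => k _; rewrite !mxE !ffunE.
  by rewrite !mxE => e; rewrite -[RHS]e; apply: eq_bigr => k _; rewrite !mxE !ffunE.
by [].
Qed.

(** It says that (v, 1) is a kernel vector of the matrix obtained from [adj F h] by bordering it
    with the row [x] and a zero diagonal entry. *)
Definition extends n (h : {ffun 'I_n * 'I_n -> bool}) (x : {ffun 'I_n -> bool}) : bool :=
  [exists v : 'rV[F]_n, (v *m adj F h == - bits x) && (v *m (bits x)^T == 0)].

Definition minor n (i : 'I_n.+1) (h : {ffun 'I_n.+1 * 'I_n.+1 -> bool}) : {ffun 'I_n * 'I_n -> bool} :=
  [ffun t => h (lift i t.1, lift i t.2)].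
Definition neighbours n (i : 'I_n.+1) (h : {ffun 'I_n.+1 * 'I_n.+1 -> bool}) : {ffun 'I_n -> bool} :=
  [ffun b => if (i < lift i b)%N then h (i, lift i b) else h (lift i b, i)].

Lemma lift_lt n (i : 'I_n.+1) (a b : 'I_n) : (lift i a < lift i b)%N = (a < b)%N.
Proof. by rewrite !ltnNge /= leq_bump2. Qed.

Lemma adj_minor n (i : 'I_n.+1) h a b : adj F h (lift i a) (lift i b) = adj F (minor i h) a b.
Proof. by rewrite !mxE !lift_lt !ffunE. Qed.

Lemma adj_neighbours n (i : 'I_n.+1) h b : adj F h i (lift i b) = bits (neighbours i h) 0 b.
Proof.
rewrite !mxE ffunE; case: ltngtP => // e.
by case/eqP: (neq_lift i b); apply: val_inj.
Qed.

Lemma singular_extends n (h : {ffun 'I_n.+1 * 'I_n.+1 -> bool}) : (\rank (adj F h) < n.+1)%N ->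
  [exists i, extends (minor i h) (neighbours i h)].
Proof.
move=> sing; have kn0 : kermx (adj F h) != 0.
  by rewrite -mxrank_eq0 mxrank_ker -lt0n subn_gt0.
have [v /sub_kermxP vA v0] := rowV0Pn kn0.
have [i vi] : exists i, v 0 i != 0.
  by apply/existsP; apply: contraR v0 => /existsPn H; apply/eqP/rowP => a; rewrite mxE; apply/eqP/negPn/H.
apply/existsP; exists i; apply/existsP; exists (\row_a (v 0 (lift i a) / v 0 i)).
have E b : v 0 i * adj F h i b + \sum_a v 0 (lift i a) * adj F h (lift i a) b = 0.
  have := congr1 (fun M : 'rV[F]_n.+1 => M 0 b) vA; rewrite [X in X = _]mxE [X in _ = X]mxE => e.
  by rewrite -[RHS]e [RHS](bigD1_ord i).
apply/andP; split; apply/eqP/matrixP => r c; rewrite ord1 !mxE.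
- have := E (lift i c); rewrite adj_neighbours mxE => /eqP; rewrite addr_eq0 => /eqP e.
  apply: (mulfI vi); rewrite mulrN e opprK mulr_sumr; apply: eq_bigr => a _.
  by rewrite [in LHS]mxE -adj_minor mulrA [v 0 i * _]mulrC divfK.
- rewrite ord1; have := E i; rewrite [adj F h i i]mxE ltnn mulr0 add0r => e.
  apply: (mulfI vi); rewrite mulr0 mulr_sumr -[RHS]e; apply: eq_bigr => a _.
  have -> : adj F h (lift i a) i = adj F h i (lift i a).
    by have := congr1 (fun M : 'M[F]_n.+1 => M i (lift i a)) (adj_sym F h); rewrite mxE.
  rewrite adj_neighbours !mxE mulrA [v 0 i * _]mulrC divfK //.
Qed.

(** Union bound over a vertex at which the kernel vector is nonzero. Its neighbours are independent
    of the minor because [io] embeds the two sets of coins disjointly. *)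
Lemma singular_le n :
  \sum_(h : {ffun 'I_n.+1 * 'I_n.+1 -> bool}) pw (ber p) h * (\rank (adj F h) < n.+1)%N%:R <=
  n.+1%:R * \sum_(h : {ffun 'I_n * 'I_n -> bool}) pw (ber p) h * \sum_x pw (ber p) x * (extends h x)%:R.
Proof.
apply: (@le_trans _ _ (\sum_(i < n.+1) \sum_h pw (ber p) h * (extends (minor i h) (neighbours i h))%:R)).
  rewrite exchange_big /=; apply: ler_sum => h _; rewrite -mulr_sumr; apply: ler_wpM2l; first exact: pw_ge0.
  case: ltnP => [/singular_extends/existsP[i ei]|_]; last by apply: sumr_ge0.
  by rewrite (bigD1 i) //= ei lerDl sumr_ge0.
rewrite -[X in X%:R * _](card_ord n.+1) mulr_natl -sumr_const; apply: ler_sum => i _.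
pose io (s : 'I_n * 'I_n + 'I_n) : 'I_n.+1 * 'I_n.+1 :=
  match s with inl t => (lift i t.1, lift i t.2) | inr b => if (i < lift i b)%N then (i, lift i b) else (lift i b, i) end.
have io_inj : injective io.
  move=> [[a b]|b] [[a' b']|b'] /=.
  - by move=> e; rewrite (lift_inj (congr1 fst e)) (lift_inj (congr1 snd e)).
  - by case: ifP => _ e; [have /= e1 := congr1 fst e; case/eqP: (neq_lift i a) | have /= e1 := congr1 snd e; case/eqP: (neq_lift i b)].
  - by case: ifP => _ e; [have /= e1 := congr1 fst e; case/eqP: (neq_lift i a') | have /= e1 := congr1 snd e; case/eqP: (neq_lift i b')].
  - case: ifP => l1; case: ifP => l2 e.
    + by rewrite (lift_inj (congr1 snd e)).
    + by have /= e1 := congr1 snd e; case/eqP: (neq_lift i b).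
    + by have /= e1 := congr1 fst e; case/eqP: (neq_lift i b).
    + by rewrite (lift_inj (congr1 fst e)).
pose G (f : {ffun 'I_n * 'I_n + 'I_n -> bool}) : R :=
  (extends [ffun t => f (inl t)] [ffun b => f (inr b)])%:R.
have -> : \sum_h pw (ber p) h * (extends (minor i h) (neighbours i h))%:R =
   \sum_(h : {ffun 'I_n.+1 * 'I_n.+1 -> bool}) pw (ber p) h * G [ffun s => h (io s)].
  apply: eq_bigr => h _; rewrite /G.
  have -> : [ffun t => [ffun s => h (io s)] (inl t)] = minor i h.
    by apply/ffunP => t; rewrite !ffunE.
  have -> // : [ffun b => [ffun s => h (io s)] (inr b)] = neighbours i h.
  by apply/ffunP => b; rewrite !ffunE /=; case: ifP.
rewrite (pw_marg ber1 G io_inj) pw_join le_eqVlt; apply/orP; left; apply/eqP.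
apply: eq_bigr => h _; rewrite mulr_sumr; apply: eq_bigr => x _; rewrite /G.
have -> : [ffun t => join h x (inl t)] = h by apply/ffunP => t; rewrite !ffunE.
by have -> : [ffun b => join h x (inr b)] = x by apply/ffunP => t; rewrite !ffunE.
Qed.

Section Split.
Variables (N m : nat) (ga : R) (D : R).
Hypothesis ga0 : 0 <= ga.
Local Notation dense u := (ga <= line_hit nu (rsubmx (u : 'rV[F]_(N + m)))).
Hypothesis HD : forall w : 'rV[F]_(N + m),
  \sum_(u : 'rV[F]_(N + m) | (u != 0) && dense u) \sum_h pw (ber p) h * (u *m adj F h == w)%:R <= D.

(** Every factor lies in [0, 1], so dropping coordinates can only increase the product. *)
Lemma line_hit_rsub (u : 'rV[F]_(N + m)) : line_hit nu u <= line_hit nu (rsubmx u).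
Proof.
rewrite /line_hit ler_pM2r ?invr_gt0 //; apply: ler_sum => a _.
have c1 (c : F) : 0 <= 1 - nu * cc R c <= 1.
  have := cc_ge0 R c; have := cc_le2 R c; move: (cc R c) => x x2 x0.
  by have n0 := nu0; have n4 := nu4; apply/andP; split; nra.
rewrite big_split_ord /=; set X := (X in X * _).
have X1 : X <= 1 by apply: prodr_ile1 => j _; apply: c1.
have Y0 : 0 <= \prod_(i < m) (1 - nu * cc R (a * u 0 (rshift N i))).
  by apply: prodr_ge0 => j _; have /andP[] := c1 (a * u 0 (rshift N j)).
under [leRHS]eq_bigr do rewrite mxE.
by rewrite ler_piMl.
Qed.

Definition heavy_kernel (h : {ffun 'I_(N + m) * 'I_(N + m) -> bool}) : bool :=
  [exists u : 'rV[F]_(N + m), [&& u != 0, u *m adj F h == 0 & ga <= line_hit nu u]].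

Lemma heavy_kernel_le : \sum_h pw (ber p) h * (heavy_kernel h)%:R <= D.
Proof.
apply: le_trans (HD 0); rewrite exchange_big /=; apply: ler_sum => h _; rewrite -mulr_sumr.
apply: ler_wpM2l; first exact: pw_ge0.
rewrite /heavy_kernel; case: existsP => [[u /and3P[u0 uA ug]]|_]; last by apply: sumr_ge0.
by rewrite (bigD1 u) ?u0 ?(le_trans ug (line_hit_rsub u)) //= uA lerDl sumr_ge0.
Qed.

Lemma extends_mean_ge0 h : 0 <= \sum_x pw (ber p) x * (@extends (N + m) h x)%:R.
Proof. by apply: sumr_ge0 => x _; rewrite mulr_ge0 ?pw_ge0. Qed.

(** For u in the kernel, v A = -x forces x u^T = 0 by symmetry of A; unless u is heavy this has
    probability below [ga]. *)
Lemma extends_singular h : (\rank (adj F h) < N + m)%N ->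
  \sum_x pw (ber p) x * (extends h x)%:R <= ga + (heavy_kernel h)%:R.
Proof.
move=> sing; have kn0 : kermx (adj F h) != 0.
  by rewrite -mxrank_eq0 mxrank_ker -lt0n subn_gt0.
have [u /sub_kermxP uA u0] := rowV0Pn kn0.
have [ug|ug] := lerP ga (line_hit nu u).
  have -> : heavy_kernel h by apply/existsP; exists u; rewrite u0 uA eqxx.
  rewrite -[leLHS]add0r; apply: lerD => //.
  by apply: (pw_mean_le ber0 ber1) => x; rewrite ler_nat; case: extends.
apply: (@le_trans _ _ (line_hit nu u)); last by apply: (le_trans (ltW ug)); rewrite lerDl ler0n.
apply: le_trans (bits_hit u); apply: ler_sum => x _; apply: ler_wpM2l; first exact: pw_ge0.
rewrite /extends; case: existsP => [[v /andP[/eqP vA _]]|_]; last exact: ler0n.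
have -> // : bits x *m u^T == 0.
have -> : bits x = - (v *m adj F h) by rewrite vA opprK.
by rewrite mulNmx -mulmxA -[adj F h]adj_sym -trmx_mul uA trmx0 mulmx0 oppr0.
Qed.

Lemma bits_split (u : {ffun 'I_N -> bool}) (v : {ffun 'I_m -> bool}) :
  bits [ffun i => join u v (split i)] = row_mx (bits u) (bits v).
Proof.
apply/rowP => i; case: (split_ordP i) => k ->.
  by rewrite row_mxEl [LHS]mxE [RHS]mxE ffunE (unsplitK (inl k)) ffunE.
by rewrite row_mxEr [LHS]mxE [RHS]mxE ffunE (unsplitK (inr k)) ffunE.
Qed.

(* The second difference of a quadratic form is twice the associated bilinear form. *)
Lemma bilinear_cancel (B : 'M[F]_(N + m)) (a a' : 'rV[F]_N) (b b' : 'rV[F]_m) : B^T = B ->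
  let Q a b := row_mx a b *m B *m (row_mx a b)^T in
  Q a b = 0 -> Q a' b = 0 -> Q a b' = 0 -> Q a' b' = 0 ->
  (b - b') *m (rsubmx (row_mx (a - a') 0 *m B))^T = 0.
Proof.
move=> sB Q; pose w := row_mx a' b'; pose z := row_mx (a - a') (0 : 'rV[F]_m).
pose y := row_mx (0 : 'rV[F]_N) (b - b').
have e1 : row_mx a b = w + z + y by rewrite !add_row_mx !addr0 addrC addrNK addrC addrNK.
have e2 : row_mx a' b = w + y by rewrite add_row_mx addr0 addrC addrNK.
have e3 : row_mx a b' = w + z by rewrite add_row_mx addr0 addrC addrNK.
have zy : z *m B *m y^T = y *m B *m z^T.
  rewrite -[LHS]trmxK; set M := (_ *m _)^T; have -> : M = y *m B *m z^T.
    by rewrite /M !trmx_mul trmxK sB mulmxA.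
  by apply/matrixP => i j; rewrite mxE !ord1.
have -> : (b - b') *m (rsubmx (z *m B))^T = y *m B *m z^T.
  rewrite -mulmxA (_ : B *m z^T = (z *m B)^T); last by rewrite trmx_mul sB.
  by rewrite -[in RHS](hsubmxK (z *m B)) tr_row_mx mul_row_col mul0mx add0r.
rewrite /Q e1 e2 e3 -/w !linearD /= !mulmxDl => q1 q2 q3 q4.
have dbl : y *m B *m z^T + y *m B *m z^T = 0.
  rewrite -{1}zy; move: q1 q2 q3 q4 {zy e1 e2 e3}.
  move: (w *m B *m w^T) (w *m B *m z^T) (w *m B *m y^T) (z *m B *m w^T) (z *m B *m z^T)
    (z *m B *m y^T) (y *m B *m w^T) (y *m B *m z^T) (y *m B *m y^T) => A1 A2 A3 A4 A5 A6 A7 A8 A9.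
  move=> q1 q2 q3 q4; have cancel_add (C E : 'M[F]_1) : C = 0 -> E - C = 0 -> E = 0.
    by move=> ->; rewrite subr0.
  apply: (cancel_add _ _ q1); rewrite -[X in X = _]addr0 -{1}q2 -[X in X = _]addr0 -{1}q3 -[LHS]subr0 -{1}q4.
  by apply/matrixP => i j; rewrite !mxE; ring.
have q2n0 : (2%:R : F) != 0.
  rewrite -(dvdn_pcharf (pchar_Fp q_pr)); apply/negP => /dvdn_leq -/(_ isT).
  by rewrite leqNgt q_odd.
move: (y *m B *m z^T) dbl => M dbl; apply/matrixP => i j.
have := congr1 (fun M' : 'M[F]_1 => M' i j) dbl; rewrite /= !mxE.
by rewrite -mulr2n -mulr_natl => /eqP; rewrite mulf_eq0 (negbTE q2n0) => /eqP.
Qed.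

Lemma diff_row_neq0 (a a' : {ffun 'I_N -> bool}) : a != a' -> row_mx (bits a - bits a') (0 : 'rV[F]_m) != 0.
Proof. by apply: contraNneq => /eqP; rewrite row_mx_eq0 subr_eq0 => /andP[/eqP/bits_inj-> _]. Qed.

(** The vector v is forced to be -x A^-1, so the event is that a quadratic form vanishes. After
    decoupling, [bilinear_cancel] leaves the orthogonality of b - b' to the right part of (a - a',
    0) A^-1, which is unlikely unless that part is dense. *)
Lemma extends_regular h : \rank (adj F h) = (N + m)%N ->
  (\sum_x pw (ber p) x * (extends h x)%:R) ^+ 4 <=
  \sum_a \sum_a' pw (ber p) a * (pw (ber p) a' *
     (ga + (dense (row_mx (bits a - bits a') 0 *m invmx (adj F h)) : bool)%:R)).
Proof.
move=> rk; have uA : adj F h \in unitmx by rewrite -row_full_unit /row_full rk.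
set B := invmx (adj F h).
have sB : B^T = B by rewrite /B trmx_inv adj_sym.
pose S (x : {ffun 'I_(N + m) -> bool}) := bits x *m B *m (bits x)^T == 0.
pose G (f : {ffun 'I_N + 'I_m -> bool}) : R := (S [ffun i => f (split i)])%:R.
have -> : \sum_x pw (ber p) x * (extends h x)%:R = \sum_u \sum_v pw (ber p) u * (pw (ber p) v * G (join u v)).
  rewrite -pw_join -(pw_marg ber1 G (can_inj unsplitK)); apply: eq_bigr => x _; congr (_ * _).
  rewrite /G; have -> : [ffun i => [ffun t => x (unsplit t)] (split i)] = x.
    by apply/ffunP => i; rewrite !ffunE splitK.
  have -> // : extends h x = S x.
  apply/existsP/idP => [[v /andP[/eqP vA /eqP vx]]|/eqP Sx].
    rewrite /S; have -> : bits x = - (v *m adj F h) by rewrite vA opprK.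
    by rewrite [- _ *m B]mulNmx mulmxK // vA opprK mulNmx vx oppr0.
  by exists (- (bits x *m B)); rewrite !mulNmx mulmxKV // Sx oppr0 !eqxx.
apply: le_trans (decoupling _ _ _ _ (fun u v => S [ffun i => join u v (split i)])) _.
- exact: pw_ge0.
- exact: sum_pw.
- exact: pw_ge0.
- exact: sum_pw.
apply: ler_sum => a _; apply: ler_sum => a' _; apply: ler_wpM2l; first exact: pw_ge0.
apply: ler_wpM2l; first exact: pw_ge0.
set t := row_mx _ _ *m _.
have [ht|ht] := lerP ga (line_hit nu (rsubmx t)).
  apply: (@le_trans _ _ 1); last by rewrite lerDr.
  under eq_bigr do rewrite -mulr_sumr.
  apply: (pw_mean_le ber0 ber1) => b; apply: (pw_mean_le ber0 ber1) => b'.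
  by rewrite lern1 leq_b1.
rewrite addr0; apply: le_trans (ltW ht); apply: le_trans (bits_diff_hit (rsubmx t)).
apply: ler_sum => b _; apply: ler_sum => b' _.
do 2 (apply: ler_wpM2l; first exact: pw_ge0).
rewrite ler_nat; case: and4P => // -[/eqP s1 /eqP s2 /eqP s3 /eqP s4].
by rewrite (bilinear_cancel sB) ?eqxx // -bits_split.
Qed.

(** For distinct a and a' the vector u = z A^-1 is nonzero and satisfies u A = z, so it is among the
    vectors counted by [HD] at w = z. *)
Lemma regular_dense_le (a a' : {ffun 'I_N -> bool}) :
  \sum_h pw (ber p) h * ((\rank (adj F h) == (N + m)%N)%:R *
     (ga + (dense (row_mx (bits a - bits a') 0 *m invmx (adj F h)) : bool)%:R)) <=
  ga + D + (a == a')%:R.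
Proof.
set z := row_mx _ _.
have D0 : 0 <= D by apply: le_trans heavy_kernel_le; apply: sumr_ge0 => h _; rewrite mulr_ge0 ?pw_ge0.
case: (eqVneq a a') => [aa'|aa'].
  apply: (pw_mean_le ber0 ber1) => h; case: (_ == _); rewrite ?mul0r ?mul1r; last by rewrite !addr_ge0.
  by rewrite -addrA lerD2l; apply: (@le_trans _ _ 1); [case: (ga <= _)%R | rewrite lerDr].
rewrite addr0; apply: (@le_trans _ _ (\sum_(h : {ffun 'I_(N + m) * 'I_(N + m) -> bool}) pw (ber p) h * ga + D)); last first.
  by rewrite -mulr_suml sum_pw // mul1r.
have HDz := HD z; rewrite exchange_big /= in HDz.
apply: (le_trans _ (lerD (lexx (\sum_(h : {ffun 'I_(N + m) * 'I_(N + m) -> bool}) pw (ber p) h * ga)) HDz)); rewrite -big_split /=.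
apply: ler_sum => h _; rewrite -mulr_sumr -mulrDr; apply: ler_wpM2l; first exact: pw_ge0.
case: eqP => rk; last by rewrite mul0r addr_ge0 // sumr_ge0.
rewrite mul1r lerD2l; case: (boolP (ga <= line_hit nu (rsubmx (z *m invmx (adj F h))))) => dz; last by rewrite sumr_ge0.
have uA : adj F h \in unitmx by rewrite -row_full_unit /row_full rk.
have u0 : z *m invmx (adj F h) != 0.
  apply: contra (diff_row_neq0 aa') => /eqP e; rewrite -/z.
  by rewrite -(mulmxKV uA z) e mul0mx.
by rewrite (bigD1 (z *m invmx (adj F h))) ?u0 ?dz //= mulmxKV // eqxx lerDl sumr_ge0.
Qed.

(** A linear substitute for the fourth root, so that expectations over [h] can be taken
    afterwards. *)
Lemma fourth_power_split (x s y : R) : 0 <= x -> 0 < s -> x ^+ 4 <= y -> x <= s + y / s ^+ 3.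
Proof.
move=> x0 s0 xy; have s3 : 0 < s ^+ 3 by rewrite exprn_gt0.
have [xs|sx] := lerP x s.
  rewrite (le_trans xs) // lerDl divr_ge0 ?(ltW s3) //; apply: le_trans xy; exact: exprn_ge0.
rewrite -[leLHS]add0r lerD ?(ltW s0) // ler_pdivlMr //; apply: le_trans xy.
by rewrite [leRHS]exprS ler_wpM2l // lerXn2r ?nnegrE ?(ltW sx) // ltW.
Qed.

Lemma singular_bound s : 0 < s ->
  \sum_(h : {ffun 'I_(N + m).+1 * 'I_(N + m).+1 -> bool}) pw (ber p) h * (\rank (adj F h) < (N + m).+1)%N%:R <=
  (N + m).+1%:R * (ga + D + s + (ga + D + be ^+ N) / s ^+ 3).
Proof.
move=> s0; apply: le_trans (singular_le _) _; rewrite ler_wpM2l ?ler0n //.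
pose Y (h : {ffun 'I_(N + m) * 'I_(N + m) -> bool}) a a' : R := ga + (dense (row_mx (bits a - bits a') 0 *m invmx (adj F h)) : bool)%:R.
pose Z h := \sum_a \sum_a' pw (ber p) a * (pw (ber p) a' * Y h a a').
have Y0 h a a' : 0 <= Y h a a' by rewrite addr_ge0.
have Z0 h : 0 <= Z h.
  by apply: sumr_ge0 => a _; apply: sumr_ge0 => a' _; rewrite !mulr_ge0 ?pw_ge0.
have s3 : 0 < s ^+ 3 by rewrite exprn_gt0.
apply: (@le_trans _ _ (\sum_h pw (ber p) h * (ga + (heavy_kernel h)%:R + s + (\rank (adj F h) == (N + m)%N)%:R * Z h / s ^+ 3))).
  apply: ler_sum => h _; apply: ler_wpM2l; first exact: pw_ge0.
  have := rank_leq_row (adj F h); rewrite leq_eqVlt => /orP[/eqP rk|sing]; last first.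
    apply: le_trans (extends_singular sing) _; rewrite -addrA lerDl addr_ge0 ?(ltW s0) //.
    by rewrite !mulr_ge0 ?invr_ge0 ?(ltW s3).
  rewrite rk eqxx mul1r; apply: le_trans (fourth_power_split (extends_mean_ge0 h) s0 (extends_regular rk)) _.
  by rewrite -addrA lerDr addr_ge0.
have -> : \sum_h pw (ber p) h * (ga + (heavy_kernel h)%:R + s + (\rank (adj F h) == (N + m)%N)%:R * Z h / s ^+ 3) =
  ga + s + \sum_h pw (ber p) h * (heavy_kernel h)%:R + (\sum_h pw (ber p) h * ((\rank (adj F h) == (N + m)%N)%:R * Z h)) / s ^+ 3.
  rewrite -[ga + s]mul1r -(sum_pw ber1 ('I_(N + m) * 'I_(N + m))%type) !mulr_suml -!big_split /=.
  by apply: eq_bigr => h _; ring.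
apply: lerD; first by rewrite -!addrA lerD2l addrC lerD2r heavy_kernel_le.
rewrite ler_pM2r ?invr_gt0 //.
have -> : \sum_h pw (ber p) h * ((\rank (adj F h) == (N + m)%N)%:R * Z h) =
  \sum_a pw (ber p) a * \sum_a' pw (ber p) a' * \sum_h pw (ber p) h * ((\rank (adj F h) == (N + m)%N)%:R * Y h a a').
  under eq_bigr do rewrite mulrA mulr_sumr.
  rewrite exchange_big; apply: eq_bigr => a _; rewrite mulr_sumr.
  under eq_bigr do rewrite mulr_sumr.
  rewrite exchange_big; apply: eq_bigr => a' _; rewrite !mulr_sumr.
  by apply: eq_bigr => h _; ring.
apply: (pw_mean_le ber0 ber1) => a.
(* Coinciding copies make z vanish and are not controlled by [HD]; they have probability at most
   [be ^+ N]. *)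
apply: (@le_trans _ _ (\sum_a' pw (ber p) a' * (ga + D + (a == a')%:R))).
  by apply: ler_sum => a' _; apply: ler_wpM2l; rewrite ?pw_ge0 ?regular_dense_le.
under eq_bigr do rewrite mulrDr.
rewrite big_split -mulr_suml sum_pw //= mul1r lerD2l (bigD1 a) //= big1 => [|a' /negbTE e]; last first.
  by rewrite eq_sym e mulr0.
rewrite eqxx mulr1 addr0 -[X in _ <= _ ^+ X]card_ord -prodr_const; apply: ler_prod => i _.
by rewrite ber0 /ber; case: ifP; rewrite le_max lexx ?orbT.
Qed.

End Split.

End Singularity.

(** * A prime of exponential size *)

Section PrimeRange.
Local Open Scope nat_scope.

Lemma central_binomial_ge n : 2 ^ n <= 'C(2 * n, n).
Proof.
elim: n => // n IH; rewrite (_ : 2 * n.+1 = (2 * n).+2); last by rewrite mulnS.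
rewrite binS expnS mul2n -addnn; apply: leq_add; apply: (leq_trans IH).
  by rewrite binS leq_addl.
by case: n {IH} => // n; rewrite [X in _ <= X]binS leq_addr.
Qed.

(** Legendre's formula: the k-th term contributes at most 1 to the valuation, and nothing once p^k >
    2 n. *)
Lemma logn_central_binomial p n : prime p -> 0 < n -> p ^ logn p 'C(2 * n, n) <= 2 * n.
Proof.
move=> p_pr n0; have p1 := prime_gt1 p_pr; have n2 : 0 < 2 * n by rewrite muln_gt0.
apply: leq_trans (trunc_logP p1 n2); rewrite leq_exp2l //.
have nn : n <= 2 * n by rewrite leq_pmull.
have e : 2 * n - n = n by rewrite mul2n -addnn addnK.
have := congr1 (logn p) (bin_fact nn); rewrite e !lognM ?muln_gt0 ?fact_gt0 ?bin_gt0 // !logn_fact // => E.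
rewrite -(leq_add2r (\sum_(1 <= k < n.+1) n %/ p ^ k + \sum_(1 <= k < n.+1) n %/ p ^ k)) E addnn -mul2n.
have -> : \sum_(1 <= k < n.+1) n %/ p ^ k = \sum_(1 <= k < (2 * n).+1) n %/ p ^ k.
  rewrite [RHS](big_cat_nat (n := n.+1)) //= [X in _ = _ + X]big_nat_cond [X in _ = _ + X]big1 ?addn0 // => k.
  rewrite andbT => /andP[nk _]; apply: divn_small; apply: leq_trans nk _.
  exact: ltnW (ltn_expl k p1).
(* Doubling n changes the quotient by p^k to at most twice its value plus one. *)
have le (k : nat) : (2 * n) %/ p ^ k <= (p ^ k <= 2 * n) + 2 * (n %/ p ^ k).
  have pk : 0 < p ^ k by rewrite expn_gt0 prime_gt0.
  have [lek|ltk] := leqP (p ^ k) (2 * n); last by rewrite divn_small.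
  rewrite -ltnS ltn_divLR // {1}(divn_eq n (p ^ k)); have := ltn_pmod n pk.
  by move: (n %/ p ^ k) (n %% p ^ k) (p ^ k) => a b c bc; rewrite /=; nia.
have cnt : \sum_(1 <= k < (2 * n).+1) (p ^ k <= 2 * n) <= trunc_log p (2 * n).
  set L := trunc_log p (2 * n).
  have Ln : L <= 2 * n.
    by apply: leq_trans (ltnW (ltn_expl L p1)) (trunc_logP p1 n2).
  rewrite (big_cat_nat (n := L.+1)) //= [X in _ + X]big_nat_cond [X in _ + X]big1 ?addn0 => [|k].
    apply: leq_trans (_ : \sum_(1 <= k < L.+1) 1 <= _); first by apply: leq_sum => k _; apply: leq_b1.
    by rewrite sum_nat_const_nat subn1 muln1.
  by rewrite andbT => /andP[Lk _]; apply/eqP; rewrite eqb0 -ltnNge; apply: (leq_trans (trunc_log_ltn _ p1)); rewrite leq_exp2l.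
apply: leq_trans (_ : \sum_(1 <= k < (2 * n).+1) ((p ^ k <= 2 * n) + 2 * (n %/ p ^ k)) <= _).
  by apply: leq_sum => k _; apply: le.
by rewrite big_split /= -big_distrr /= leq_add2r.
Qed.

Lemma prime_dvdn_fact p n : prime p -> p %| n`! -> p <= n.
Proof.
move=> p_pr; elim: n => [|n IH]; first by rewrite dvdn1 => /eqP p1; rewrite p1 in p_pr.
rewrite factS Euclid_dvdM // => /orP[/dvdn_leq -> //|/IH]; exact: leqW.
Qed.

Lemma exp2_gt_sqr x : 7 <= x -> 2 * x ^ 2 < 2 ^ x.
Proof.
elim: x => // x IH; rewrite leq_eqVlt => /orP[/eqP <- //|x7].
by have := IH x7; rewrite -!mulnn [2 ^ x.+1]expnS; move: (2 ^ x) => y; nia.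
Qed.

(** Let n = x^2. Without a prime in the range, the central binomial coefficient has at most x prime
    factors, each with prime power at most 2 n, so it is at most (2 x^2)^x < 2^n, below its lower
    bound. *)
Lemma exists_prime x : 7 <= x -> exists2 q, prime q & x < q <= 2 * x ^ 2.
Proof.
move=> x7; have x0 : 0 < x by apply: leq_trans x7.
pose n := x ^ 2; have n0 : 0 < n by rewrite expn_gt0 x0.
pose C := 'C(2 * n, n).
have C0 : 0 < C by rewrite bin_gt0 leq_pmull.
have [/hasP[q qC xq]|/hasPn none] := boolP (has (fun q => x < q) (primes C)).
  move: qC; rewrite mem_primes => /and3P[q_pr _ qC]; exists q => //; rewrite xq /=.
  have := dvdn_trans qC (_ : C %| (2 * n)`!).
  rewrite -{1}(@bin_fact (2 * n) n) ?leq_pmull // dvdn_mulr // => /(_ isT).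
  exact: prime_dvdn_fact.
have : 2 ^ n < 2 ^ n; last by rewrite ltnn.
apply: leq_ltn_trans (central_binomial_ge n) _; rewrite -/C.
have CE : C = \prod_(q <- primes C) q ^ logn q C.
  by rewrite {1}[C]prod_prime_decomp // prime_decompE big_map.
rewrite CE; apply: (@leq_ltn_trans (\prod_(q <- primes C) (2 * n))).
  rewrite big_seq [X in _ <= X]big_seq; apply: leq_prod => q.
  by rewrite mem_primes => /and3P[q_pr _ _]; apply: logn_central_binomial.
rewrite big_const_seq count_predT iter_muln_1.
have sz : size (primes C) <= x.
  rewrite -(size_iota 1 x); apply: uniq_leq_size (primes_uniq _) _ => q qC.
  have := none q qC; rewrite -leqNgt mem_iota add1n ltnS => ->; rewrite andbT.
  by move: qC; rewrite mem_primes => /and3P[/prime_gt0].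
apply: leq_ltn_trans (_ : (2 * n) ^ x < _).
  by rewrite leq_exp2l // (leq_trans _ (leq_pmulr 2 n0)).
by rewrite (_ : 2 ^ n = (2 ^ x) ^ x) ?ltn_exp2r ?exp2_gt_sqr // -expnM mulnn.
Qed.

End PrimeRange.

(** * Tail bounds in the finite model *)

Lemma corank_ge a b k n : (a <= b -> b + k <= n -> k <= n - a)%N.
Proof. lia. Qed.

Lemma rank_deficient a b k n : (a <= b -> b + k <= n -> 0 < k -> a < n)%N.
Proof. lia. Qed.

Section FiniteModel.
Variables (R : realType) (p : R).
Hypotheses (p0 : 0 < p) (p1 : p < 1).
Local Notation nu := (p * (1 - p)).
Local Notation be := (Num.max p (1 - p)).

Let nu0 : 0 < nu. Proof. by rewrite mulr_gt0 // subr_gt0. Qed.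
Let nu4 : nu <= 1 / 4. Proof. by have := sqr_ge0 (p - 1 / 2); lra. Qed.
Let p01 : 0 <= p <= 1. Proof. by rewrite !ltW. Qed.
Let ber0 b : 0 <= ber p b. Proof. exact: ber_ge0. Qed.
Let ber1 : \sum_b ber p b = 1. Proof. exact: ber_sum. Qed.

(** Let e = exp(th m) and let x be the next integer. The prime is at most 2 x^2 <= 8 e^2 <= e^3,
    since e >= 16; hence the exponent 3. *)
Lemma prime_scale (th : R) : 0 < th -> exists m0 : nat, forall m : nat, (m0 <= m)%N ->
  exists q : nat, [/\ prime q, expR (th * m%:R) <= q%:R, q%:R <= expR (3 * th * m%:R),
    (3 * m <= q ^ 2)%N & 16 <= expR (th * m%:R)].
Proof.
move=> th0; exists (maxn (Num.truncn (15 / th)).+1 (Num.truncn (3 / th ^+ 2)).+1) => m.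
rewrite geq_max => /andP[m1 m2]; set e := expR _.
have big a (l : nat) : 0 <= a -> ((Num.truncn a).+1 <= l)%N -> a <= l%:R :> R.
  move=> a0 al; apply: le_trans (ltW (truncnS_gt a)) _; by rewrite ler_nat.
have {}m1 : 15 <= th * m%:R.
  by rewrite mulrC -ler_pdivrMr //; apply: big m1; rewrite divr_ge0 // ltW.
have {}m2 : 3 <= th ^+ 2 * m%:R.
  by rewrite mulrC -ler_pdivrMr ?exprn_gt0 //; apply: big m2; rewrite divr_ge0 // exprn_ge0 // ltW.
have e8 : 16 <= e by apply: le_trans (expR_ge1Dx _); move: m1; set t := _ * _; lra.
pose x := (Num.truncn e).+1.
have ex : e < x%:R := truncnS_gt e.
have xe : x%:R <= e + 1.
  by rewrite -natr1 lerD2r truncn_le expR_ge0.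
have x7 : (7 <= x)%N by rewrite -(ler_nat R); apply: le_trans (ltW ex); move: e8; lra.
have [q q_pr /andP[xq qx]] := exists_prime x7.
have eq : e < q%:R by apply: lt_trans ex _; rewrite ltr_nat.
exists q; split=> //; first exact: ltW.
- have -> : expR (3 * th * m%:R) = e ^+ 3.
    by rewrite /e -expRM_natl -mulrA; congr expR; rewrite -mulrA.
  apply: (@le_trans _ _ (2 * x%:R ^+ 2)); first by rewrite -natrX -natrM ler_nat.
  move: ex xe e8; rewrite (exprS e 2); set X := x%:R; move=> ex xe e8.
  have X2 : X <= 2 * e by move: xe e8; lra.
  have X0 : 0 <= X by rewrite ler0n.
  have : X ^+ 2 <= (2 * e) ^+ 2 by rewrite lerXn2r ?nnegrE // mulr_ge0 // (le_trans _ e8).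
  rewrite exprMn => h; have : 0 <= e ^+ 2 by exact: sqr_ge0.
  move: (e ^+ 2) (X ^+ 2) h e8 => E Y h e8 E0; nra.
- rewrite -(ler_nat R) natrM natrX; apply: (@le_trans _ _ ((th * m%:R) ^+ 2)).
    rewrite exprMn [m%:R ^+ 2]expr2 mulrA; apply: ler_wpM2r; [exact: ler0n | exact: m2].
  rewrite lerXn2r ?nnegrE ?ler0n //; first by move: m1; lra.
  by apply: le_trans (ltW eq); apply: le_trans (expR_ge1Dx _); rewrite lerDr.
Qed.

Section Bridge.
Variables (q N m : nat) (ga : R).
Hypothesis q_pr : prime q.
Local Notation F := 'F_q.
Local Notation tv := (fun e : 'I_3 => (tern e)%:~R : F).

Lemma bad_block_moment :
  \sum_(x : {ffun 'I_N -> {ffun 'I_m -> 'I_3}}) pw (pw (lazy nu) (T := 'I_m)) x *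
    (q%:R ^+ (2 * (m - \rank (span_on (@vec_of F _ tv m) [set: 'I_N] x 0))) *
       (bad nu ga (span_on (@vec_of F _ tv m) [set: 'I_N] x 0))%:R) =
  \sum_(x : {ffun 'I_N * 'I_m -> 'I_3}) pw (lazy nu) x *
    (q%:R ^+ (2 * (m - \rank (bipartite tv x))) * (bad_block q p ga x)%:R).
Proof.
rewrite [RHS]pw_curry; apply: eq_bigr => x _.
have rk := span_on_rows q x; congr (_ * _); rewrite /bad /bad_block rk.
set V := span_on _ _ _ _; have -> // : structured nu ga V = structured_kernel q p ga [ffun t => x t.1 t.2].
have ann (t : 'rV[F]_m) : (t \in annihilator V) = (t *m (bipartite tv [ffun t => x t.1 t.2])^T == 0).
  by rewrite inE -sub_kermx rk sub_kermx -[in LHS]trmx_eq0 trmx_mul trmxK.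
by apply: eq_existsb => t; rewrite ann.
Qed.

End Bridge.

(** With the splitting parameter y of [singular_bound], errors of order y^5 become y^2 after
    division by y^3 and stay below y. *)
Lemma singular_scale (y b D bN ga : R) : 0 < y -> y <= 1 -> ga = y ^+ 5 -> 0 <= b -> b <= y ^+ 5 ->
  D <= 2 * b -> bN <= b ->
  ga + D + y + (ga + D + bN) / y ^+ 3 <= 8 * y.
Proof.
move=> y0 y1 -> b0 by5 Db bNb; have y3 : 0 < y ^+ 3 by rewrite exprn_gt0.
have y51 : y ^+ 5 <= y by rewrite -[leRHS]expr1; apply: ler_wiXn2l => //; exact: ltW.
have y21 : y ^+ 2 <= y by rewrite -[leRHS]expr1; apply: ler_wiXn2l => //; exact: ltW.
have h : (y ^+ 5 + D + bN) / y ^+ 3 <= 4 * y ^+ 2.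
  rewrite ler_pdivrMr // -mulrA -exprD; move: by5 Db bNb; move: (y ^+ 5) => Y; lra.
apply: le_trans (lerD (lexx _) h) _; move: y51 y21 by5 Db; move: (y ^+ 5) (y ^+ 2) => B C h2 h3 h4 h5; lra.
Qed.

Lemma scaled_blocks : exists2 th : R, 0 < th & exists m0 : nat, forall m N : nat,
  (m0 <= m)%N -> (m <= N <= m.+1)%N -> exists q : nat, [/\ prime q, expR (th * m%:R) <= q%:R,
   \sum_h pw (ber p) h * #|[set u : 'rV['F_q]_(N + m) | u *m adj 'F_q h == 0]|%:R <= q%:R ^+ 10 &
   \sum_(h : {ffun 'I_(N + m).+1 * 'I_(N + m).+1 -> bool}) pw (ber p) h * (\rank (adj 'F_q h) < (N + m).+1)%N%:R <=
   (N + m).+1%:R * (8 * expR (- (th * m%:R / 10)))].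
Proof.
have be1 : be < 1 by rewrite gt_max p1; have := p0; lra.
have be0 : 0 < be by rewrite lt_max p0.
pose lam := - ln be; have lam0 : 0 < lam by rewrite /lam oppr_gt0 ln_lt0 // be0.
have beE : be = expR (- lam) by rewrite /lam opprK lnK // posrE.
have [th0 th00 H] := bad_moment nu0 nu4.
(* Here 42 = 2 * 3 * 7: since q <= exp(3 th m) and m <= 2 (N - 1), the atom bound [be ^+ N.-1] falls
   below q^-7. *)
pose th := Num.min th0 (lam / 42).
have thp : 0 < th by rewrite lt_min th00 divr_gt0.
exists th => //.
have [m1 {}H] := H th thp ltac:(by rewrite ge_min lexx).
have [m2 Hq] := prime_scale thp.
exists (maxn m1 (maxn m2 2)) => m N; rewrite !geq_max => /and3P[m1m m2m m_2] /andP[mN Nm].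
have [q [q_pr qlo qhi mq e16]] := Hq m m2m; exists q.
have q8 : 16 <= q%:R :> R := le_trans e16 qlo.
(* Then 1/q <= y^10, and [ga] = exp(-th m / 2) is exponentially small while q [ga] still exceeds
   3. *)
pose y := expR (- (th * m%:R / 10)); pose ga := y ^+ 5.
have y0 : 0 < y by exact: expR_gt0.
have thm0 : 0 <= th * m%:R by rewrite mulr_ge0 // ltW.
have y1 : y <= 1 by rewrite -expR0 ler_expR oppr_le0 divr_ge0.
have gaE : ga = expR (- (th * m%:R / 2)) by rewrite /ga /y -expRM_natl; congr expR; field.
have q0 : 0 < q%:R :> R by move: q8; lra.
have y10 : (y ^+ 10)^-1 <= q%:R.
  have -> : (y ^+ 10)^-1 = expR (th * m%:R) by rewrite /y -expRM_natl -expRN; congr expR; field.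
  exact: qlo.
have q_odd : (2 < q)%N by rewrite -(ltr_nat R); move: q8; lra.
have ga0 : 0 <= ga by rewrite exprn_ge0 // ltW.
have ga3 : 3 < q%:R * ga.
  apply: lt_le_trans (_ : expR (th * m%:R / 2) <= _); last first.
    apply: (le_trans _ (ler_wpM2r ga0 qlo)); rewrite gaE -expRD ler_expR; move: (th * m%:R) thm0 => t t0; lra.
  have : expR (th * m%:R / 2) ^+ 2 = expR (th * m%:R) by rewrite -expRM_natl; congr expR; field.
  have := expR_gt0 (th * m%:R / 2); move: e16; move: (expR (_ / _)) (expR _) => A B B16 A0 AB; nra.
have m_0 : (m <= N <= m.+1)%N by rewrite mN.
have := H m N q ga q_pr m1m m_0 qlo qhi ga3 mq.
rewrite bad_block_moment // => Hbad.
have N0 : (0 < N)%N by apply: leq_trans mN; apply: leq_trans m_2.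
split=> //.
  apply: le_trans (kernel_mean q_pr p0 p1 mN Nm Hbad) _.
  have : (q%:R ^+ 2)^-1 <= (1 : R) by rewrite invf_le1 ?exprn_gt0 // exprn_ege1 //; move: q8; lra.
  have : 1 <= q%:R ^+ 8 :> R by rewrite exprn_ege1 //; move: q8; lra.
  have -> : q%:R ^+ 10 = q%:R * (q%:R * q%:R ^+ 8) :> R by rewrite -!exprS.
  rewrite ler_pM2l //; move: q8 (q%:R ^+ 8) ((q%:R ^+ 2)^-1); clear.
  move: (q%:R) => Q q8 A B A1 B1; nra.
have Hd w := adj_image_dense q_pr p0 p1 Nm Hbad w N0.
apply: le_trans (singular_bound q_pr q_odd p0 p1 ga0 Hd y0) _.
rewrite ler_wpM2l ?ler0n //.
have qV5 : q%:R^-1 <= y ^+ 5.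
  apply: (@le_trans _ _ (y ^+ 10)); last by apply: ler_wiXn2l => //; exact: ltW.
  by rewrite -[leRHS]invrK lef_pV2 ?posrE ?invr_gt0 ?exprn_gt0.
(* In [adj_image_dense] this atom is multiplied by up to q^6, and 1/q has to remain. *)
have bN7 : be ^+ N.-1 <= (q%:R ^+ 7)^-1.
  apply: (@le_trans _ _ (expR (3 * th * m%:R) ^+ 7)^-1); last first.
    rewrite lef_pV2 ?posrE ?exprn_gt0 ?expR_gt0 //.
    by rewrite lerXn2r // nnegrE ?expR_ge0 // ltW.
  rewrite beE -!expRM_natl -expRN ler_expR mulrN lerN2.
  have th42 : 42 * th <= lam by rewrite mulrC -ler_pdivlMr // ge_min lexx orbT.
  have mN2 : m%:R <= 2 * N.-1%:R :> R by rewrite -natrM ler_nat; move: m_2 mN; clear; lia.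
  have mr0 : 0 <= m%:R :> R := ler0n _ _.
  have n0 : 0 <= N.-1%:R :> R := ler0n _ _.
  move: th42 mN2 mr0 n0 thp; move: (N.-1%:R) (m%:R) => a b h1 h2 h3 h4 h5; nra.
have q7 : (q%:R ^+ 7)^-1 <= q%:R^-1 :> R.
  by rewrite lef_pV2 ?posrE ?exprn_gt0 // -[leLHS]expr1 ler_weXn2l //; move: q8; lra.
apply: (singular_scale (b := q%:R^-1)) => //.
  rewrite [2 * _]mulrDl mul1r; apply: lerD.
    by rewrite expr2 invfM mulrA divff ?mul1r // gt_eqF.
  apply: le_trans (_ : (q%:R ^+ 7)^-1 * q%:R ^+ 6 <= _).
    apply: ler_pM => //; first by rewrite exprn_ge0 // ltW.
    rewrite [leRHS]exprS ler_pM2l //.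
    have : (q%:R ^+ 2)^-1 <= (1 : R) by rewrite invf_le1 ?exprn_gt0 // exprn_ege1 //; move: q8; lra.
    have : 1 <= q%:R ^+ 4 :> R by rewrite exprn_ege1 //; move: q8; lra.
    have -> : q%:R ^+ 5 = q%:R * q%:R ^+ 4 :> R by rewrite -exprS.
    move: q8 (q%:R ^+ 4) ((q%:R ^+ 2)^-1); clear.
    move: (q%:R) => Q q8 A B A1 B1; nra.
  by rewrite [_ ^+ 7]exprS invfM -mulrA mulVf ?mulr1 // gt_eqF // exprn_gt0.
apply: le_trans (le_trans bN7 q7); apply: ler_wiXn2l; rewrite ?leq_pred ?(ltW be0) ?(ltW be1) //.
Qed.

Lemma rank_adj_reduction q n (h : {ffun 'I_n * 'I_n -> bool}) : prime q -> (\rank (adj 'F_q h) <= \rank (adj R h))%N.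
Proof.
move=> q_pr; pose M : 'M[int]_n := \matrix_(i, j) if (i < j)%N then (h (i, j))%:R else if (j < i)%N then (h (j, i))%:R else 0.
have red (F : fieldType) : adj F h = map_mx (fun z : int => z%:~R : F) M.
  apply/matrixP => i j; rewrite !mxE; case: ltngtP => _ /=; rewrite ?mulr0z //.
    by case: (h _); rewrite ?mulr1z ?mulr0z.
  by case: (h _); rewrite ?mulr1z ?mulr0z.
rewrite !red; apply: rank_intmx_reduction.
Qed.

Lemma large_scale (th a : R) : 0 < th -> 0 <= a -> exists m0 : nat, forall m : nat, (m0 <= m)%N ->
  a * m%:R <= expR (th * m%:R).
Proof.
move=> th0 a0; have t2 : 0 < th ^+ 2 by rewrite exprn_gt0.
exists (Num.truncn (4 * a / th ^+ 2)).+1 => m mm.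
have {}mm : 4 * a <= th ^+ 2 * m%:R.
  rewrite [th ^+ 2 * _]mulrC -ler_pdivrMr //; apply: (le_trans (ltW (truncnS_gt _))); by rewrite ler_nat.
have m0 : 0 <= m%:R :> R by [].
have -> : expR (th * m%:R) = expR (th * m%:R / 2) ^+ 2 by rewrite -expRM_natl; congr expR; field.
apply: (@le_trans _ _ ((th * m%:R / 2) ^+ 2)).
  have -> : (th * m%:R / 2) ^+ 2 = th ^+ 2 * m%:R * m%:R / 4 by field.
  by have := ler_wpM2r m0 mm; lra.
have tm : 0 <= th * m%:R / 2 by rewrite divr_ge0 // mulr_ge0 // ltW.
rewrite lerXn2r ?nnegrE ?expR_ge0 //; apply: le_trans (expR_ge1Dx _); by rewrite lerDr.
Qed.

(** From 20 on, k - 10 >= k / 2 makes Markov's bound q^(10 - k) exponential in k m. Below 20 a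
    single bound on singularity covers all k, because k n <= 80 m. *)
Lemma rank_tail : exists2 c : R, 0 < c & exists n0 : nat, forall n k : nat, (n0 <= n)%N -> (0 < k)%N ->
  \sum_(h : {ffun 'I_n * 'I_n -> bool}) pw (ber p) h * (\rank (adj R h) + k <= n)%N%:R <= expR (- (c * k%:R * n%:R)).
Proof.
have [th th0 [m0 H]] := scaled_blocks.
have th20 : 0 < th / 20 by rewrite divr_gt0.
have [m1 H1] := large_scale th20 (ler0n R 32).
pose c := th / (40 * 40); exists c; first by rewrite divr_gt0 // mulr_gt0.
exists (2 * maxn m0 (maxn m1 1)).+2 => n k nn k0.
have [k20|k20] := leqP 20 k.
- pose m := n./2; pose N := (n - m)%N.
  have nE : n = (N + m)%N by rewrite /N /m; move: nn; clear; lia.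
  have mN : (m <= N <= m.+1)%N by rewrite /N /m; clear; lia.
  have m0m : (m0 <= m)%N by move: nn; rewrite /m; clear; lia.
  have n3 : (n <= 3 * m)%N by move: nn; rewrite /m; clear; lia.
  have [q [q_pr qlo Hk _]] := H m N m0m mN; clearbody N m; subst n.
  have q0 : 0 < q%:R :> R by rewrite ltr0n prime_gt0.
  apply: (@le_trans _ _ (q%:R ^+ 10 / q%:R ^+ k)); last first.
    have -> : q%:R ^+ k = q%:R ^+ (k - 10) * q%:R ^+ 10 :> R by rewrite -exprD subnK // (leq_trans _ k20).
    rewrite invfM mulrCA divff ?mulr1; last by rewrite gt_eqF // exprn_gt0.
    rewrite expRN lef_pV2 ?posrE ?exprn_gt0 ?expR_gt0 //.
    apply: le_trans (_ : expR (th * m%:R) ^+ (k - 10) <= _); last by rewrite lerXn2r ?nnegrE ?expR_ge0 // ltW.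
    rewrite -expRM_natl ler_expR.
    have kr : k%:R <= 2 * (k - 10)%:R :> R by rewrite -natrM ler_nat; move: k20; clear; lia.
    have nr : (N + m)%:R <= 3 * m%:R :> R by rewrite -natrM ler_nat.
    have : k%:R * (N + m)%:R <= 6 * ((k - 10)%:R * m%:R) :> R.
      by rewrite (_ : 6 * _ = 2 * (k - 10)%:R * (3 * m%:R)); [apply: ler_pM | ring].
    have : 0 <= (k - 10)%:R * m%:R :> R by rewrite mulr_ge0.
    rewrite -mulrA [_ * (th * _)]mulrCA /c -mulrA ler_pM2l //.
    move: (k%:R * _) (_ * m%:R) => A B; lra.
  rewrite ler_pdivlMr ?exprn_gt0 // mulr_suml; apply: le_trans Hk; apply: ler_sum => h _.
  rewrite -mulrA; apply: ler_wpM2l; first exact: pw_ge0.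
  rewrite card_left_kernel // natrX; case: leqP => [lek|_]; last by rewrite mul0r exprn_ge0 // ltW.
  rewrite mul1r ler_weXn2l // ?ler1n ?prime_gt0 //.
  exact: corank_ge (rank_adj_reduction h q_pr) lek.
(* One vertex is set aside as the border of the minor, so the two blocks split n - 1. *)
- pose m := (n.-1)./2; pose N := (n.-1 - m)%N.
  have nE : n = (N + m).+1 by rewrite /N /m; move: nn; clear; lia.
  have mN : (m <= N <= m.+1)%N by rewrite /N /m; clear; lia.
  have m0m : (m0 <= m)%N by move: nn; rewrite /m; clear; lia.
  have m1m : (m1 <= m)%N by move: nn; rewrite /m; clear; lia.
  have n4 : (n <= 4 * m)%N by move: nn; rewrite /m; clear; lia.
  have [q [q_pr qlo _ Hs]] := H m N m0m mN; clearbody N m; subst n.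
  apply: (@le_trans _ _ ((N + m).+1%:R * (8 * expR (- (th * m%:R / 10))))).
    apply: le_trans Hs; apply: ler_sum => h _; apply: ler_wpM2l; first exact: pw_ge0.
    rewrite ler_nat; have [lek|//] := boolP (_ + k <= _)%N.
    by rewrite lt0b; apply: rank_deficient (rank_adj_reduction h q_pr) lek k0.
  have kr : k%:R <= 20 :> R by rewrite (ler_nat R k 20) ltnW.
  have nr : (N + m).+1%:R <= 4 * m%:R :> R by rewrite -natrM ler_nat.
  have kn : k%:R * (N + m).+1%:R <= 20 * (4 * m%:R) :> R by apply: ler_pM.
  have e1 := H1 m m1m.
  apply: (@le_trans _ _ (expR (th / 20 * m%:R) * expR (- (th * m%:R / 10)))).
    rewrite mulrA; apply: ler_wpM2r; first exact: expR_ge0.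
    by apply: le_trans e1; move: nr; lra.
  rewrite -expRD ler_expR; have := ler_wpM2l (ltW th0) kn; rewrite /c; move: (k%:R) (_.+1%:R) (m%:R) => A B M; lra.
Qed.

End FiniteModel.

(** * Transfer to the probability space *)

Import classical_sets.

Section MeasurableRank.
Local Open Scope classical_set_scope.
Variables (d : measure_display) (T : measurableType d) (R : realType).

(** This writes a rank event as finitely many polynomial equations in the entries, which makes it
    measurable. *)
Lemma rank_le_minors (F : fieldType) n (A : 'M[F]_n) (r : nat) : (\rank A <= r)%N <->
  forall s : 'I_n.+1, (r < s)%N -> forall f g : {ffun 'I_s -> 'I_n}, \det (rowsub g (rowsub f A)^T) = 0.
Proof.
split=> [Ar s rs f g|H].
  apply: contraTeq rs => dn0; rewrite -leqNgt; apply: leq_trans Ar.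
  have U : rowsub g (rowsub f A)^T \in unitmx by rewrite unitmxE unitfE.
  rewrite -[leqLHS](mxrank_unit U); apply: leq_trans (mxrankS (rowsub_sub _ _)) _.
  by rewrite mxrank_tr; exact: mxrankS (rowsub_sub _ _).
rewrite leqNgt; apply/negP => rA; have lt := rank_leq_row A; rewrite -ltnS in lt.
pose f := maxrankfun A; have fA : row_free (rowsub f A) := maxrowsub_free A.
have fAT : row_full (rowsub f A)^T by rewrite /row_full mxrank_tr; apply: fA.
have := H (Ordinal lt) rA [ffun i => f i] [ffun i => fullrankfun fAT i].
have : rowsub (fullrankfun fAT) (rowsub f A)^T \in unitmx by apply: fullrowsub_unit.
rewrite unitmxE unitfE => /eqP h1 h2; apply: h1; rewrite -[RHS]h2; congr (\det _).
by apply/matrixP => i j; rewrite !mxE !ffunE.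
Qed.

Lemma measurable_det n (A : T -> 'M[R]_n) :
  (forall i j, measurable_fun setT (fun t => A t i j)) -> measurable_fun setT (fun t => \det (A t)).
Proof.
move=> mA; apply: measurable_sum => s; apply: measurable_realfun.measurable_funM; first exact: measurable_cst.
by apply: measurable_prod => i _; apply: mA.
Qed.

Lemma measurable_rank_le n (A : T -> 'M[R]_n) (r : nat) :
  (forall i j, measurable_fun setT (fun t => A t i j)) -> measurable [set t | (\rank (A t) <= r)%N].
Proof.
move=> mA.
have -> : [set t | (\rank (A t) <= r)%N] = \bigcap_(s in [set s : 'I_n.+1 | (r < s)%N])
   \bigcap_(f in [set: {ffun 'I_s -> 'I_n}]) \bigcap_(g in [set: {ffun 'I_s -> 'I_n}])
     [set t | \det (rowsub g (rowsub f (A t))^T) = 0].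
  apply/seteqP; split => t /=.
    by move=> /rank_le_minors H s rs f _ g _; apply: H.
  by move=> H; apply/rank_le_minors => s rs f g; apply: (H s rs f I g I).
apply: fin_bigcap_measurable => [|s _]; first exact: finite_finset.
apply: fin_bigcap_measurable => [|f _]; first exact: finite_finset.
apply: fin_bigcap_measurable => [|g _]; first exact: finite_finset.
have := @measurable_det _ (fun t => rowsub g (rowsub f (A t))^T) _ measurableT [set 0] (measurable_set1 0).
rewrite setTI; apply => i j.
by under eq_fun do rewrite !mxE; apply: mA.
Qed.

Lemma measure_bigsetU_le (mu : {measure set T -> \bar R}) (I : Type) (s : seq I) (Q : pred I) (F : I -> set T) :
  (forall i, Q i -> measurable (F i)) ->
  (mu (\big[setU/set0]_(i <- s | Q i) F i) <= \sum_(i <- s | Q i) mu (F i))%E.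
Proof.
move=> mF; elim: s => [|i s IH]; first by rewrite !big_nil measure0.
rewrite !big_cons; case: ifP => Qi //.
apply: le_trans (measureU2 _ _ _) _; [exact: mF | exact: bigsetU_measurable |].
exact: leeD.
Qed.

End MeasurableRank.

Section Transfer.
Local Open Scope classical_set_scope.
Variables (R : realType) (p : R) (d : measure_display) (T : measurableType d) (P : probability T R).
Variables (n : nat) (g : 'I_n -> 'I_n -> {RV P >-> R}).
Hypothesis Hg : gnp_adjacency p g.

Let ber1 : \sum_b ber p b = 1. Proof. exact: ber_sum. Qed.

Local Notation edge := {x : 'I_n * 'I_n | (x.1 < x.2)%N}.

Definition extend_edges (f : {ffun edge -> bool}) : {ffun 'I_n * 'I_n -> bool} :=
  [ffun x => if insub x is Some u then f u else false].

Lemma bernoulli_prob (i j : 'I_n) (b : bool) : (i < j)%N -> P (g i j @^-1` [set b%:R]) = (ber p b)%:E.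
Proof. by move=> ij; have [_ _ /(_ i j ij)[h1 h0] _] := Hg; case: b. Qed.

Lemma bernoulli_null (i j : 'I_n) : (i < j)%N -> P (g i j @^-1` (~` ([set 0] `|` [set 1]))) = 0%E.
Proof.
move=> ij; have m b : measurable (g i j @^-1` [set b%:R]) by apply: measurable_funPTI.
rewrite -preimage_setC preimage_setU probability_setC; last by apply: measurableU; [exact: (m false) | exact: (m true)].
rewrite measureU; [|exact: (m false)|exact: (m true)|]; last first.
  by apply/seteqP; split => t //= [-> /eqP]; rewrite eq_sym oner_eq0.
have /= e0 := bernoulli_prob false ij; have /= e1 := bernoulli_prob true ij.
rewrite e0 e1 -EFinD subrK; exact: (@subee _ 1%:E).
Qed.

(** The entries lie in {0, 1} only almost surely. Off the null set [N] an outcome belongs to the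
    atom [A f] of a bit pattern [f] on the edges, whose probability is a product weight by
    independence. *)
Lemma transfer (Q : 'M[R]_n -> bool) : measurable [set t | Q (random_mx g t)] ->
  (P [set t | Q (random_mx g t)] <= (\sum_h pw (ber p) h * (Q (adj R h))%:R)%:E)%E.
Proof.
move=> mQ; have [g0 gs _ gi] := Hg.
pose D := [set x : 'I_n * 'I_n | (x.1 < x.2)%N]%SET.
pose A (f : {ffun edge -> bool}) := \bigcap_(i in [set i | i \in D]) (g i.1 i.2 @^-1` [set (extend_edges f i)%:R]).
pose N := \big[setU/set0]_(i in D) (g i.1 i.2 @^-1` (~` ([set 0] `|` [set 1]))).
have mA f : measurable (A f).
  by apply: fin_bigcap_measurable => [|i _]; [exact: finite_finset | apply: measurable_funPTI].
have mNi (i : 'I_n * 'I_n) : measurable (g i.1 i.2 @^-1` (~` ([set 0] `|` [set 1]))).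
  by apply: measurable_funPTI; apply: measurableC; apply: measurableU.
have mN : measurable N by apply: bigsetU_measurable => i _.
have N0 : P N = 0%E.
  apply/eqP; rewrite -measure_le0; apply: le_trans (measure_bigsetU_le _ _ _) _ => //.
  rewrite big1 // => i; rewrite inE; exact: bernoulli_null.
have PA f : P (A f) = (pw (ber p) f)%:E.
  rewrite /A (gi D (fun i => [set (extend_edges f i)%:R])) //.
  rewrite /pw -prodEFin; transitivity (\prod_(i in D) (ber p (extend_edges f i))%:E)%E.
    by apply: eq_bigr => i; rewrite inE; apply: bernoulli_prob.
  rewrite (reindex_omap (val : edge -> _) insub) /= => [|i iD]; last first.
    by rewrite inE in iD; rewrite insubT.
  apply: eq_big => [u|u _]; first by rewrite inE valK eqxx (valP u).
  by rewrite ffunE valK.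
pose B := \big[setU/set0]_(f in [pred f : {ffun edge -> bool} | Q (adj R (extend_edges f))]) A f.
have sub : [set t | Q (random_mx g t)] `<=` B `|` N.
  move=> t Qt; have [/forall_inP ok|/forall_inPn[x xD xn]] :=
    boolP [forall x in D, (g x.1 x.2 t == 0) || (g x.1 x.2 t == 1)]; last first.
    right; rewrite /N -bigcup_pred; exists x => //=; case=> e; move: xn; rewrite e eqxx ?orbT //.
  pose f : {ffun edge -> bool} := [ffun u => g (val u).1 (val u).2 t == 1].
  have fE x : x \in D -> g x.1 x.2 t = (extend_edges f x)%:R.
    move=> xD; have := ok x xD; rewrite inE in xD; rewrite ffunE insubT ffunE /=.
    by move=> /orP[] /eqP ->; rewrite ?eqxx // eq_sym oner_eq0.
  left; rewrite /B -bigcup_pred; exists f; last by move=> x xD /=; apply: fE.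
  rewrite /= inE; suff <- : random_mx g t = adj R (extend_edges f) by [].
  apply/matrixP => i j; rewrite !mxE; case: ltngtP => ij.
  - by rewrite -(fE (i, j)) ?inE.
  - by rewrite gs -(fE (j, i)) ?inE.
  - by rewrite (val_inj ij) g0.
have mB : measurable B by apply: bigsetU_measurable.
apply: (@le_trans _ _ (P (B `|` N))); first by apply: le_measure; rewrite ?inE //; apply: measurableU.
rewrite measureU0 //; apply: le_trans (measure_bigsetU_le _ _ _) _ => //.
have -> : \sum_h pw (ber p) h * (Q (adj R h))%:R =
   \sum_(h : {ffun 'I_n * 'I_n -> bool}) pw (ber p) h * (Q (adj R (extend_edges [ffun u : edge => h (val u)])))%:R.
  apply: eq_bigr => h _; congr (_ * (nat_of_bool (Q _))%:R).
  apply/matrixP => i j; rewrite !mxE; case: ltngtP => // ij.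
    by rewrite ffunE insubT /= ffunE.
  by rewrite ffunE insubT /= ffunE.
rewrite (pw_marg ber1 (fun f => (Q (adj R (extend_edges f)))%:R) val_inj) -sumEFin big_mkcond /=.
apply: lee_sum => f _; rewrite PA inE; case: (Q _); rewrite ?mulr1 ?mulr0 //.
Qed.

End Transfer.

Local Open Scope classical_set_scope.

Theorem theorem1p3 (R : realType) (p : R) (hp0 : 0 < p) (hp1 : p < 1) :
  exists c c' Cp : R,
    [/\ 0 < c, 0 < c', 0 < Cp &
      forall (n : nat) (d : measure_display) (T : measurableType d)
        (P : probability T R) (g : 'I_n -> 'I_n -> {RV P >-> R}),
        gnp_adjacency p g ->
        (forall k : int,
           Cp <= k%:~R -> k%:~R <= c * Num.sqrt n%:R ->
           (P [set t | ((\rank (random_mx g t))%:Z <= n%:Z - k)%R]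
              <= (expR (- (c' * k%:~R * n%:R)))%:E)%E) /\
        (p = 2^-1 ->
         forall k : int,
           1 <= k -> k%:~R <= c * Num.sqrt n%:R ->
           (P [set t | ((\rank (random_mx g t))%:Z <= n%:Z - k)%R]
              <= (expR (- (c' * k%:~R * n%:R)))%:E)%E)].
Proof.
have [c' c'0 [n0 tail]] := rank_tail hp0 hp1.
(* With this value, 1 <= k <= c sqrt n forces n0 <= n, the range covered by [tail]. *)
pose c := (Num.sqrt n0%:R + 1)^-1 : R.
have c0 : 0 < c by rewrite invr_gt0 ltr_wpDl // sqrtr_ge0.
exists c, c', 1; split=> // n d T P g Hg.
suff H (k : int) : 1 <= k -> k%:~R <= c * Num.sqrt n%:R ->
    (P [set t | ((\rank (random_mx g t))%:Z <= n%:Z - k)%R] <= (expR (- (c' * k%:~R * n%:R)))%:E)%E.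
  by split=> [k|_ k]; [rewrite (ler_int R 1 k) |]; apply: H.
case: k => // k k1 kn.
have {}k1 : (0 < k)%N by move: k1; lia.
have nn : (n0 <= n)%N.
  rewrite leqNgt; apply/negP => lt; move: kn; apply/negP; rewrite -ltNge.
  apply: (@lt_le_trans _ _ 1); last by rewrite ler1n.
  rewrite mulrC ltr_pdivrMr ?mul1r; last by rewrite ltr_wpDl // sqrtr_ge0.
  by rewrite (le_lt_trans (ler_wsqrtr (_ : n%:R <= n0%:R))) ?ltrDl // ler_nat ltnW.
have E t : ((\rank (random_mx g t))%:Z <= n%:Z - k%:Z) = (\rank (random_mx g t) + k <= n)%N by lia.
have -> : [set t | ((\rank (random_mx g t))%:Z <= n%:Z - k%:Z)%R] = [set t | (\rank (random_mx g t) + k <= n)%N].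
  by apply/seteqP; split => t /=; rewrite E.
pose Q (A : 'M[R]_n) := (\rank A + k <= n)%N.
have mQ : measurable [set t | Q (random_mx g t)].
  have [kn'|nk] := leqP k n; last first.
    rewrite (_ : [set t | _] = set0) //; apply/seteqP; split => t //=.
    by move=> h; have := leq_trans (leq_addl _ _) h; rewrite leqNgt nk.
  rewrite (_ : [set t | _] = [set t | (\rank (random_mx g t) <= n - k)%N]).
    by apply: measurable_rank_le => i j; under eq_fun do rewrite mxE; apply: measurable_funPT.
  by apply/seteqP; split => t /=; rewrite /Q leq_subRL // addnC.
by apply: (le_trans (transfer Hg mQ)); rewrite lee_fin; apply: tail.
Qed.
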